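(* Let $\beta_c=\sqrt2$ and let $\beta>\beta_c$. Let $x_\beta^{(N)}(q)=\mathbb E\big[G_{\beta,N}^{\times 2}\{q_{12}\le q\}\big]$, $0\le q\le 1$, be the averaged distribution function of the overlap of two points sampled from the Gibbs measure of the log-correlated Gaussian field $(X_x,x\in\mathcal X_N)$. Then $$\lim_{N\to\infty}x_\beta^{(N)}(q)=\lim_{N\to\infty}\mathbb E\big[G_{\beta,N}^{\times 2}\{q_{12}\le q\}\big]=\begin{cases}\dfrac{\beta_c}{\beta}, & 0\le q<1,\\[4pt] 1,& q=1.\end{cases}$$
   Context: Field. Let $[0,1]_\sim$ be the unit interval with its endpoints identified, with distance $\|x-x'\|=\min\{|x-x'|,1-|x-x'|\}$. Let $\mathcal C^+=[0,1]_\sim\times(0,\infty)$ with measure $\theta(\mathrm dx,\mathrm dy)=y^{-2}\,\mathrm dx\,\mathrm dy$. Let $\mu$ be a random measure on $\mathcal C^+$, defined on a probability space with law $\mathbb P$ and expectation $\mathbb E$, such that (i) for every measurable $A$ (with $\theta(A)<\infty$), $\mu(A)$ is a centered Gaussian variable of variance $\theta(A)$ (variance parameter $\sigma=1$), and (ii) for disjoint measurable $A_1,A_2,\dots$ the variables $\mu(A_n)$ are independent and $\mu(\bigcup_nA_n)=\sum_n\mu(A_n)$ a.s. For $u>0$ and $x\in[0,1]_\sim$ let $A_u(x)=\{(s,y)\in\mathcal C^+: y\ge u,\ -f(y)/2\le s-x\le f(y)/2\}$, where $f(y)=y$ for $y\in(0,1/2)$ and $f(y)=1/2$ otherwise ($s-x$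 is taken on the circle), and $\omega_u(x)=\mu(A_u(x))$. For $N\in\mathbb N$ put $\varepsilon=1/N$, $\mathcal X_N=\{0,\tfrac1N,\dots,\tfrac{N-1}N\}$, and $X_x=\omega_\varepsilon(x)$ for $x\in\mathcal X_N$. Gibbs measure. For $\beta>0$, $Z_N(\beta)=\sum_{x\in\mathcal X_N}e^{\beta X_x}$ and $G_{\beta,N}(x)=e^{\beta X_x}/Z_N(\beta)$, $x\in\mathcal X_N$; $G_{\beta,N}^{\times2}$ is the product measure on $\mathcal X_N^2$. Overlap. $q(x,y)=q^{(N)}(x,y)=-\frac{\log\|x-y\|}{\log N}$ for $x\ne y$ in $\mathcal X_N$, and $q(x,x)=1$. For $(x_1,x_2)$ sampled from $G_{\beta,N}^{\times2}$ write $q_{12}=q(x_1,x_2)$.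
   Formalization: The value q = 0 is excluded (0 < q ≤ 1 instead of 0 ≤ q ≤ 1): since ‖x−y‖ ≤ 1/2 on the circle, every overlap is positive, so x_β^(N)(0) = 0 for all N ≥ 2 and the claimed limit β_c/β fails at q = 0. *)

(* Defs.v *)
From HB Require Import structures.
From mathcomp Require Import all_boot all_order all_algebra.
From mathcomp Require Import finmap.
From mathcomp Require Import all_classical all_reals all_analysis.

Set Implicit Arguments.
Unset Strict Implicit.
Unset Printing Implicit Defensive.

Import Order.TTheory GRing.Theory Num.Theory.
Import numFieldNormedType.Exports.

Local Open Scope classical_set_scope.
Local Open Scope ring_scope.

(** The circle, i.e. [0, 1] with its endpoints identified, is represented by
    `[0, 1[; the Borel sets and the Lebesgue measure of the circle are then
    those of `[0, 1[. *)

Definition circle_dist {R : realType} (x y : R) : R :=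
  Num.min `|x - y| (1 - `|x - y|).

Definition half_cylinder {R : realType} : set (R * R) :=
  [set p | 0 <= p.1 < 1 /\ 0 < p.2].

Definition theta {R : realType} (A : set (R * R)) : \bar R :=
  (\int[@lebesgue_measure R \x @lebesgue_measure R]_(p in A `&` half_cylinder)
     (p.2 ^- 2)%:E)%E.

(** For variance 0 the centered Gaussian law is the point mass at 0;
    [normal_prob 0 0] is, by the convention of the library, the uniform law
    on [0, 1]. The second argument of [normal_prob] is the standard
    deviation. *)
Definition centered_gaussian {R : realType} {d : measure_display}
    {T : measurableType d} {P : probability T R} (X : {RV P >-> R}) (v : R) :=
  forall B : set R, measurable B ->
    distribution P X B =
      if v == 0 then \d_(0 : R) B else normal_prob 0 (Num.sqrt v) B.

Definition independent_seq {R : realType} {d : measure_display}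
    {T : measurableType d} {P : probability T R} (X : nat -> {RV P >-> R}) :=
  forall (J : {fset nat}) (B : nat -> set R), (forall n, measurable (B n)) ->
    (P (\bigcap_(n in [set` J]) (X n @^-1` B n))
       = \prod_(n <- J) P (X n @^-1` B n))%E.

Definition finite_theta {R : realType} (A : set (R * R)) :=
  [/\ measurable A, A `<=` half_cylinder & (theta A < +oo)%E].

(** Only the values of [mu] on sets satisfying [finite_theta] are constrained
    (and used). *)
Record gaussian_random_measure {R : realType} {d : measure_display}
    {T : measurableType d} (P : probability T R)
    (mu : set (R * R) -> {RV P >-> R}) : Prop := {
  grm_gaussian : forall A, finite_theta A ->
    centered_gaussian (mu A) (fine (theta A)) ;
  grm_independent : forall A : nat -> set (R * R),
    (forall n, finite_theta (A n)) -> trivIset setT A ->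
    independent_seq (fun n => mu (A n)) ;
  grm_additive : forall A : nat -> set (R * R),
    (forall n, finite_theta (A n)) -> trivIset setT A ->
    finite_theta (\bigcup_n A n) ->
    {ae P, forall w, (fun n => \sum_(0 <= k < n) mu (A k) w) @ \oo
                       --> mu (\bigcup_n A n) w}
}.

Definition cone_width {R : realType} (y : R) : R :=
  if y < 2^-1 then y else 2^-1.

(** [s - x] is a point of the circle: the bounds are required of one of its
    representatives [s - x + k], [k] an integer. *)
Definition cone {R : realType} (u x : R) : set (R * R) :=
  half_cylinder `&`
  [set p | u <= p.2 /\
     exists k : int, - (cone_width p.2 / 2) <= p.1 - x + k%:~R
                       <= cone_width p.2 / 2].

Definition omega {R : realType} {d : measure_display} {T : measurableType d}
    {P : probability T R} (mu : set (R * R) -> {RV P >-> R}) (u x : R)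
    : {RV P >-> R} :=
  mu (cone u x).

(** The point i / N is encoded by its index [i : 'I_N]. *)
Definition site {R : realType} {N : nat} (i : 'I_N) : R := i%:R / N%:R.

Definition field {R : realType} {d : measure_display} {T : measurableType d}
    {P : probability T R} (mu : set (R * R) -> {RV P >-> R}) (N : nat)
    (i : 'I_N) : {RV P >-> R} :=
  omega mu (N%:R^-1) (site i).

Definition partition_function {R : realType} {d : measure_display}
    {T : measurableType d} {P : probability T R}
    (mu : set (R * R) -> {RV P >-> R}) (beta : R) (N : nat) (w : T) : R :=
  \sum_(i < N) expR (beta * field mu i w).

Definition gibbs {R : realType} {d : measure_display} {T : measurableType d}
    {P : probability T R} (mu : set (R * R) -> {RV P >-> R}) (beta : R)
    (N : nat) (w : T) (i : 'I_N) : R :=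
  expR (beta * field mu i w) / partition_function mu beta N w.

Definition gibbs2 {R : realType} {d : measure_display} {T : measurableType d}
    {P : probability T R} (mu : set (R * R) -> {RV P >-> R}) (beta : R)
    (N : nat) (w : T) (S : {set 'I_N * 'I_N}) : R :=
  \sum_(p in S) gibbs mu beta w p.1 * gibbs mu beta w p.2.

Definition overlap {R : realType} {N : nat} (i j : 'I_N) : R :=
  if i == j then 1
  else - (ln (circle_dist (site i) (site j) : R) / ln N%:R).

(** Distances on the circle are at most 1/2, so every overlap is positive and
    this function vanishes at [q = 0]. *)
Definition mean_overlap_cdf {R : realType} {d : measure_display}
    {T : measurableType d} {P : probability T R}
    (mu : set (R * R) -> {RV P >-> R}) (beta : R) (N : nat) (q : R) : \bar R :=
  ('E_P[(fun w => gibbs2 mu beta w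
    [set p : 'I_N * 'I_N | (overlap p.1 p.2 <= q)%R]%SET)%R])%E.

Definition beta_c {R : realType} : R := Num.sqrt 2.

(* Main.v *)
Require Import Defs.
From HB Require Import structures.
From mathcomp Require Import all_boot all_order all_algebra.
From mathcomp Require Import finmap.
From mathcomp Require Import ring lra zify.
From mathcomp Require Import all_classical all_reals all_analysis.
From mathcomp Require Import measurable_realfun.
Set Implicit Arguments.
Unset Strict Implicit.
Unset Printing Implicit Defensive.
Import Order.TTheory GRing.Theory Num.Theory.
Import numFieldNormedType.Exports.
Local Open Scope classical_set_scope.
Local Open Scope ring_scope.

(** Write L = ln N, s = sqrt 2, F = E ln Z_N(beta), p_i for the Gibbs weights,
    and X for the averaged distribution function of the overlap at q < 1. The
    idea is that X is, up to o(1), a rate of change of F when one part of the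
    field is made stronger or weaker, and that F is known to leading order for
    enough of these modified fields.

    Cut every cone at the height u = N ^ (- q) into a small part, the band
    1/N <= y < u, of theta-measure (1 - q) L, and a large part, y >= u, of
    theta-measure at most 1 + q L. An overlap is at most q exactly when the two
    points are at distance at least u ([overlap_leP]). At such distances the
    small parts are disjoint ([band_cone_disjoint]); at distances at most u the
    large parts differ by a set of theta-measure at most 2
    ([rtheta_cone_diff_le]).

    For sets B_i, Gaussian integration by parts ([grm_ibp]) evaluates
    E sum_i p_i mu(B_i) as beta times [gibbs_overlap], which here is the average
    over two Gibbs points i, j of theta(B_i) - theta(B_i and C_j), C_j being the
    cone of j. By the geometry this is at least (1 - q) L X when the B_i are the
    small parts and at most (1 + q L) X + 2 when they are the large ones.
    Since ln sum_i exp(H_i) is convex in H, it lies above its tangents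
    ([ln_partition_sum_tangent]), so that multiplying the small parts by
    1 + delta, or the large parts by 1 - delta, changes F by at least
    delta beta^2 (1 - q) L X, respectively - delta beta^2 ((1 + q L) X + 2)
    ([expectation_tangent]). No derivative of a limiting free energy is taken.

    It remains to know that F >= (s beta - o(1)) L and to bound the modified
    free energies from above. For beta >= s the upper bound
    ([expectation_ln_partition_le]) compares norms to pass from beta to s, and
    then applies Jensen's inequality: with a on the large and b on the small
    parts the result is (beta / s) (L + a^2 (1 + q L) + b^2 (1 - q) L). Both
    modifications above move variance towards the small scales; for such
    fields this bound has the right leading order to first order in delta,
    which is all that is used. Comparing with the lower bound on F gives
    s q <= beta q X + O(delta) and beta (1 - q) X <= s (1 - q) + O(delta) for
    large N, hence X --> s / beta ([cvg_overlap_cdf]).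

    The lower bound on F is a multiscale second moment argument
    ([free_energy_ge]). The heights between 1/N and 1 are cut into boundedly
    many scales of ratio exp (- v). Except for the part above the first cut,
    the cone becomes a union of bands of variance exactly v; a site is called
    high when the field on each of these bands is at least s (1 - k) v, where
    k > 0 is small. Two sites use disjoint bands at all scales below their
    distance, so few pairs of high events are correlated, and with high
    probability some site is high: the bands alone then give it at least the
    energy beta s (1 - k)^2 L. Dropping the coarsest part makes distant sites
    independent, not nearly so; it costs nothing because adding an independent
    centered field can only increase E ln Z, which is again
    [expectation_tangent], with [gibbs_overlap] equal to 0. *)

(** * Real-valued integrals *)

Lemma is_derive_continuous {R : realType} (f : R -> R) (x df : R) :
  is_derive x 1 f df -> {for x, continuous f}.
Proof. by case=> df1 _; exact/differentiable_continuous/derivable1_diffP. Qed.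

Lemma measurable_forall {d : measure_display} {T : measurableType d}
    (I : finType) (E : I -> set T) : (forall i, measurable (E i)) ->
  measurable [set w | forall i, E i w].
Proof.
move=> mE; rewrite (_ : [set w | _] = \big[setI/setT]_i E i).
  exact: bigsetI_measurable.
rewrite -bigcap_seq; apply/seteqP; split => w; first by move=> H i _; exact: H.
by move=> H i; apply: H; rewrite /= mem_index_enum.
Qed.

Section real_integrals.
Context {d : measure_display} {T : measurableType d} {R : realType}.
Variable mu : {finite_measure set T -> \bar R}.
Implicit Types (f g : T -> R).
Notation integ f := (mu.-integrable [set: T] (EFin \o f)).

Lemma integ_cst (c : R) : integ (fun=> c).
Proof. exact: finite_measure_integrable_cst. Qed.

Lemma integD f g : integ f -> integ g -> integ (fun x => f x + g x).
Proof.
move=> fi gi; rewrite (_ : _ \o _ = (fun x => (EFin \o f) x + (EFin \o g) x)%E)//.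
exact: integrableD.
Qed.

Lemma integZ (c : R) f : integ f -> integ (fun x => c * f x).
Proof.
move=> fi; rewrite (_ : _ \o _ = (fun x => c%:E * (EFin \o f) x)%E)//.
exact: integrableZl.
Qed.

Lemma integB f g : integ f -> integ g -> integ (fun x => f x - g x).
Proof.
move=> fi gi; rewrite (_ : _ \o _ = (fun x => (EFin \o f) x - (EFin \o g) x)%E)//.
exact: integrableB.
Qed.

Lemma integ_measurable f : integ f -> measurable_fun setT f.
Proof. by move=> /measurable_int/measurable_EFinP. Qed.

Lemma integ_le f g : measurable_fun setT f -> (forall x, `|f x| <= g x) ->
  integ g -> integ f.
Proof.
move=> mf fg; apply: le_integrable => //; first exact/measurable_EFinP.
by move=> x _; rewrite /= lee_fin (le_trans (fg x))// ler_norm.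
Qed.

Lemma integ_norm f : integ f -> integ (fun x => `|f x|).
Proof. exact: integrable_norm. Qed.

Lemma integ_bounded f (B : R) : measurable_fun setT f -> (forall x, `|f x| <= B) ->
  integ f.
Proof. by move=> mf fB; apply: integ_le mf fB (integ_cst B). Qed.

Lemma integ_bMl f g (B : R) : measurable_fun setT g -> (forall x, `|g x| <= B) ->
  integ f -> integ (fun x => f x * g x).
Proof.
move=> mg gB fi; apply: (@integ_le _ (fun x => B * `|f x|)).
- by apply: measurable_funM => //; exact: integ_measurable.
- by move=> x; rewrite normrM mulrC ler_wpM2r.
- exact/integZ/integ_norm.
Qed.

Lemma integ_sum (I : Type) (s : seq I) (P : pred I) (F : I -> T -> R) :
  (forall i, P i -> integ (F i)) -> integ (fun x => \sum_(i <- s | P i) F i x).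
Proof.
move=> Fi; elim: s => [|a s ih].
  by under eq_fun do rewrite big_nil; exact: integ_cst.
case: (boolP (P a)) => Pa; last first.
  by under eq_fun do rewrite big_cons (negbTE Pa).
under eq_fun do rewrite big_cons Pa.
by apply: integD => //; exact: Fi.
Qed.

Lemma Rint_sum (I : Type) (s : seq I) (P : pred I) (F : I -> T -> R) :
  (forall i, P i -> integ (F i)) ->
  (\int[mu]_x (\sum_(i <- s | P i) F i x) = \sum_(i <- s | P i) \int[mu]_x F i x)%R.
Proof.
move=> Fi; elim: s => [|a s ih].
  rewrite big_nil; under eq_Rintegral => x _ do rewrite big_nil.
  by rewrite Rintegral_cst// mul0r.
rewrite big_cons; case: (boolP (P a)) => Pa; last first.
  by under eq_Rintegral => x _ do rewrite big_cons (negbTE Pa).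
under eq_Rintegral => x _ do rewrite big_cons Pa.
rewrite RintegralD//; first by rewrite ih.
- exact: Fi.
- exact: integ_sum.
Qed.

Lemma ae_eq_Rint f g : measurable_fun setT f -> measurable_fun setT g ->
  {ae mu, forall x, f x = g x} -> (\int[mu]_x f x = \int[mu]_x g x)%R.
Proof.
move=> mf mg fg; congr fine; apply: ae_eq_integral => //.
- exact/measurable_EFinP.
- exact/measurable_EFinP.
- by apply: filterS fg => x /= ->.
Qed.

Lemma ae_le_Rint f g : integ f -> integ g -> {ae mu, forall x, f x <= g x} ->
  (\int[mu]_x f x <= \int[mu]_x g x)%R.
Proof.
move=> fi gi fg.
have mf := integ_measurable fi; have mg := integ_measurable gi.
have mh : measurable_fun setT (fun x => Num.max (f x) (g x)).
  exact: measurable_maxr.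
rewrite (@ae_eq_Rint g (fun x => Num.max (f x) (g x)))//; last first.
  by apply: filterS fg => x fgx; rewrite max_r.
apply: le_Rintegral => //; last by move=> x _; rewrite le_max lexx.
apply: (@integ_le _ (fun x => `|f x| + `|g x|)) => //; last first.
  by apply: integD; exact: integ_norm.
move=> x; case: (leP (f x) (g x)) => _; first by rewrite lerDr.
by rewrite lerDl.
Qed.

End real_integrals.

Lemma measurable_sum_cond {d : measure_display} {T : measurableType d}
    {R : realType} (D : set T) (I : Type) (s : seq I) (Q : pred I)
    (h : I -> T -> R) :
  (forall i, Q i -> measurable_fun D (h i)) ->
  measurable_fun D (fun x => \sum_(i <- s | Q i) h i x).
Proof.
move=> mh; elim: s => [|i s ih].
  by under eq_fun do rewrite big_nil; exact: measurable_cst.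
case: (boolP (Q i)) => Qi.
  by under eq_fun do rewrite big_cons Qi; apply: measurable_funD => //; exact: mh.
by under eq_fun do rewrite big_cons (negbTE Qi).
Qed.

Lemma Rintegral_prob_cst {d : measure_display} {T : measurableType d}
    {R : realType} (P : probability T R) (c : R) : (\int[P]_w c = c)%R.
Proof.
rewrite Rintegral_cst//.
have -> : fine (P setT) = 1 by rewrite probability_setT.
by rewrite mulr1.
Qed.

(** * Gaussian laws on the line *)

Section normal_density.
Context {R : realType}.
Notation leb := lebesgue_measure.
Variables (m s : R).

(** A normal law has a density only through its Radon-Nikodym derivative, known
    up to a null set to be [normal_pdf]. *)
Lemma ge0_integral_normal_prob (f : R -> \bar R) :
  (forall x, 0 <= f x)%E -> measurable_fun [set: R] f ->
  (\int[normal_prob m s]_x f x = \int[leb]_x (f x * (normal_pdf m s x)%:E))%E.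
Proof.
move=> f0 mf.
have dom := normal_prob_dominates m s.
rewrite -(Radon_Nikodym_SigmaFinite.change_of_variables dom)//.
have mpdf : measurable_fun setT (fun x => (normal_pdf m s x)%:E).
  by apply/measurable_EFinP; exact: measurable_normal_pdf.
apply: ae_eq_integral => //.
- apply: emeasurable_funM => //.
  exact: measurable_int (Radon_Nikodym_SigmaFinite.f_integrable dom).
- exact: emeasurable_funM.
have ae : ae_eq lebesgue_measure setT
    (Radon_Nikodym_SigmaFinite.f (normal_prob m s) lebesgue_measure)
    (fun x => (normal_pdf m s x)%:E).
  apply: integral_ae_eq => //.
    exact: Radon_Nikodym_SigmaFinite.f_integrable dom.
  by move=> E _ mE; rewrite -Radon_Nikodym_SigmaFinite.f_integral.
by apply: filterS ae => x /= + _ => ->.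
Qed.

Lemma integrable_normal_probP (f : R -> R) :
  (normal_prob m s).-integrable setT (EFin \o f) ->
  leb.-integrable setT (fun x => (f x * normal_pdf m s x)%:E).
Proof.
move=> /integrableP[/measurable_EFinP mf foo]; apply/integrableP; split.
  apply/measurable_EFinP/measurable_funM => //; exact: measurable_normal_pdf.
under eq_integral do rewrite /= normrM EFinM (ger0_norm (normal_pdf_ge0 _ _ _)).
rewrite -ge0_integral_normal_prob//.
by apply/measurable_EFinP; exact: measurableT_comp.
Qed.

Lemma integral_normal_prob (f : R -> R) :
  (normal_prob m s).-integrable setT (EFin \o f) ->
  (\int[normal_prob m s]_x f x = \int[leb]_x (f x * normal_pdf m s x))%R.
Proof.
move=> intf; have intfp := integrable_normal_probP intf.
rewrite /Rintegral; congr fine.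
have mf : measurable_fun setT (EFin \o f) by exact: measurable_int intf.
rewrite integralE [RHS]integralE !ge0_integral_normal_prob//; last 2 first.
  exact: measurable_funeneg. exact: measurable_funepos.
congr (_ - _)%E; apply: eq_integral => x _.
  rewrite !funeposE /= -EFin_max -EFinM -EFin_max.
  by rewrite maxr_pMl ?normal_pdf_ge0// mul0r.
rewrite !funenegE /= -EFin_max -EFinM -EFin_max.
by rewrite maxr_pMl ?normal_pdf_ge0// mul0r mulNr.
Qed.

End normal_density.

Section gaussian_moments.
Context {R : realType}.
Notation leb := lebesgue_measure.
Variable (s : R).
Hypothesis s0 : s != 0.

(** Completing the square: an exponential weight shifts the mean. The moment
    generating function follows without a new integral. *)
Lemma normal_pdf_tilt (a x : R) :
  expR (a * x) * normal_pdf 0 s x =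
  expR (a ^+ 2 * s ^+ 2 / 2) * normal_pdf (a * s ^+ 2) s x.
Proof.
rewrite !normal_pdfE// /normal_fun /=.
rewrite mulrCA [RHS]mulrCA -!expRD; congr (_ * expR _).
have s2 : s ^+ 2 != 0 by rewrite sqrf_eq0.
by rewrite -mulr_natr; field.
Qed.

Lemma integral_expR_normal (a : R) :
  (\int[normal_prob 0 s]_x (expR (a * x))%:E = (expR (a ^+ 2 * s ^+ 2 / 2))%:E)%E.
Proof.
rewrite ge0_integral_normal_prob; last 2 first.
  by move=> x; rewrite lee_fin expR_ge0.
  by apply/measurable_EFinP; apply: measurableT_comp => //; exact: measurable_funM.
under eq_integral do rewrite -EFinM normal_pdf_tilt EFinM.
rewrite integralZl//; last exact: integrable_normal_pdf.
by rewrite integral_normal_pdf mule1.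
Qed.

Lemma integrable_expR_normal (a : R) :
  (normal_prob 0 s).-integrable setT (fun x => (expR (a * x))%:E).
Proof.
apply/integrableP; split.
  by apply/measurable_EFinP; apply: measurableT_comp => //; exact: measurable_funM.
under eq_integral do rewrite /= ger0_norm ?expR_ge0//.
by rewrite integral_expR_normal ltry.
Qed.

(** With the moment generating function this gives the first absolute moment;
    the scale [c] is later taken to be the inverse standard deviation. *)
Lemma norm_le_expR (c x : R) : 0 < c -> `|x| <= c^-1 * (expR (c * x) + expR (- c * x)).
Proof.
move=> c0; rewrite ler_pdivlMl// -[c in leLHS](ger0_norm (ltW c0)) -normrM mulNr.
set y := c * x.
have := expR_ge1Dx y; have := expR_ge1Dx (- y); have := expR_ge0 y; have := expR_ge0 (- y).
move=> *; rewrite ler_norml; apply/andP; split; lra.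
Qed.

Lemma integrable_id_normal : (normal_prob 0 s).-integrable setT (fun x : R => x%:E).
Proof.
have mT : measurable [set: measurableTypeR R] by [].
apply: (le_integrable mT
  (g := fun x : R => (expR (1 * x) + expR (- 1 * x))%:E)).
- exact/measurable_EFinP.
- move=> x _; rewrite /= lee_fin (le_trans (norm_le_expR x ltr01))// invr1 mul1r.
  exact: ler_norm.
- under eq_fun do rewrite EFinD.
  by apply: integrableD => //; exact: integrable_expR_normal.
Qed.

Lemma integral_norm_normal : 0 < s ->
  (\int[normal_prob 0 s]_x `|x| <= 2 * expR 1 * s)%R.
Proof.
move=> sp; have sV : 0 < s^-1 by rewrite invr_gt0.
have ie a : (normal_prob 0 s).-integrable setT (fun x => (expR (a * x))%:E).
  exact: integrable_expR_normal.
have is' : (normal_prob 0 s).-integrable setT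
    (EFin \o (fun x => expR (s^-1 * x) + expR (- s^-1 * x))).
  rewrite /comp; under eq_fun do rewrite EFinD.
  exact: integrableD.
apply: (@le_trans _ _ (\int[normal_prob 0 s]_x
    (s * (expR (s^-1 * x) + expR (- s^-1 * x))))%R).
  apply: le_Rintegral => //.
  - by have /integrable_norm := integrable_id_normal.
  - rewrite /comp; under eq_fun do rewrite EFinM; exact: integrableZl.
  - by move=> x _; rewrite (le_trans (norm_le_expR x sV))// invrK.
rewrite RintegralZl// RintegralD//; [|exact: ie|exact: ie].
rewrite /Rintegral !integral_expR_normal/= sqrrN exprVn mulVf ?sqrf_eq0//.
rewrite mulrC ler_wpM2r ?(ltW sp)//.
have : expR (1 / 2) <= expR 1 :> R by rewrite ler_expR; lra.
lra.
Qed.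
End gaussian_moments.

Section gaussian_ibp.
Context {R : realType}.
Notation leb := lebesgue_measure.
Variable (s : R).
Hypothesis s0 : s != 0.
Let phi : R -> R := normal_pdf 0 s.

Lemma is_derive_normal_pdf (x : R) :
  is_derive x 1 (normal_pdf 0 s) (- (x / s ^+ 2) * normal_pdf 0 s x).
Proof.
rewrite normal_pdfE//.
have -> : (fun x : R => normal_peak s * normal_fun 0 s x) =
    (fun x => normal_peak s * expR (- (s ^+ 2 *+ 2)^-1 * x ^+ 2)).
  by apply/funext => y; rewrite /normal_fun subr0; congr (_ * expR _); lra.
apply: is_derive_eq.
rewrite /normal_fun /GRing.scale /= subr0 mulr1.
have -> : - x ^+ 2 / (s ^+ 2 *+ 2) = - (s ^+ 2 *+ 2)^-1 * x ^+ 2 by lra.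
set e := expR _; rewrite -mulr_natr.
have s2 : s ^+ 2 != 0 by rewrite sqrf_eq0.
by field.
Qed.

Lemma normal_pdf_even (x : R) : phi (- x) = phi x.
Proof. by rewrite /phi normal_pdfE// /normal_fun !subr0 sqrrN. Qed.

(** It suffices here that the tail is below a multiple of 1/n. *)
Lemma normal_pdf_cvg0 : (fun n : nat => phi n.+1%:R) @ \oo --> 0.
Proof.
have s2 : 0 < s ^+ 2 by rewrite exprn_even_gt0.
have c0 : 0 <= normal_peak s * (s ^+ 2 *+ 2) by rewrite mulr_ge0// ?normal_peak_ge0// mulrn_wge0// ltW.
apply: (@squeeze_cvgr _ _ _ _ (cst 0) (fun n => normal_peak s * (s ^+ 2 *+ 2) * harmonic n)).
- apply: nearW => n /=; rewrite normal_pdf_ge0/= /phi normal_pdfE// -mulrA.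
  rewrite ler_wpM2l ?normal_peak_ge0// /normal_fun subr0.
  set y := n.+1%:R; have y1 : 1 <= y by rewrite ler1n.
  have y0 : 0 < y by rewrite ltr0n.
  rewrite mulNr expRN /harmonic -/y -[leRHS]invrK lef_pV2 ?posrE ?expR_gt0 ?invr_gt0 ?divr_gt0 ?mulrn_wgt0//.
  rewrite invfM invrK (le_trans _ (expR_ge1Dx _))// (@le_trans _ _ (y ^+ 2 / (s ^+ 2 *+ 2)))//; last by lra.
  by rewrite mulrC ler_wpM2r ?invr_ge0 ?mulrn_wge0 ?(ltW s2)// expr2 ler_peMr// ltW.
- exact: cvg_cst.
- rewrite -[X in _ --> X](mulr0 (normal_peak s * (s ^+ 2 *+ 2))).
  by apply: cvgMr; exact: cvg_harmonic.
Qed.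

Variables (h dh : R -> R) (C : R).
Hypothesis hdh : forall x : R, is_derive x 1 h (dh x).
Hypothesis cdh : continuous dh.
Hypothesis h1 : forall x, `|h x| <= 1.
Hypothesis dhC : forall x, `|dh x| <= C.

Let ch : continuous h.
Proof. by move=> x; exact: is_derive_continuous (hdh x). Qed.

(** Integration by parts is the fundamental theorem of calculus for the product
    [K] of [h] and the density, whose derivative is [k] times the density and
    which tends to 0 at both ends. *)
Let k x := dh x - x / s ^+ 2 * h x.
Let K x := h x * phi x.

Let cphi : continuous phi. Proof. exact: continuous_normal_pdf. Qed.

Let ck : continuous (fun x => k x * phi x).
Proof.
move=> x; apply: cvgM; last exact: cphi.
apply: cvgB; first exact: cdh.
by apply: cvgM; [apply: cvgM; [exact: cvg_id|exact: cvg_cst]|exact: ch].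
Qed.

Let dK (x : R) : is_derive x 1 K (k x * phi x).
Proof.
have := hdh x; have := is_derive_normal_pdf x => ? ?.
apply: is_derive_eq; rewrite /k /GRing.scale /= -/phi.
by ring.
Qed.

Lemma integrable_bounded_normal (f : R -> R) (B : R) : continuous f ->
  (forall x, `|f x| <= B) -> (normal_prob 0 s).-integrable setT (EFin \o f).
Proof.
move=> cf fB; apply: measurable_bounded_integrable => //.
- exact: (le_lt_trans (@probability_le1 _ _ _ (normal_prob 0 s) _ measurableT) (ltry _)).
- exact: continuous_measurable_fun.
- exists B; split => //; first by rewrite num_real.
  by move=> y By x _ /=; rewrite (le_trans (fB x))// ltW.
Qed.

Let mT : measurable [set: measurableTypeR R]. Proof. by []. Qed.

Let integrable_dh : (normal_prob 0 s).-integrable setT (EFin \o dh).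
Proof. exact: integrable_bounded_normal cdh dhC. Qed.

Let integrable_idh : (normal_prob 0 s).-integrable setT (EFin \o (fun x => x * h x)).
Proof.
apply: (le_integrable mT (g := EFin)); last exact: integrable_id_normal.
- apply/measurable_EFinP; apply: measurable_funM => //.
  exact: continuous_measurable_fun.
- by move=> x _; rewrite /= lee_fin normrM ler_piMr.
Qed.

Let integrable_k : (normal_prob 0 s).-integrable setT (EFin \o k).
Proof.
have -> : EFin \o k = (fun x : R => (dh x)%:E - ((s ^+ 2)^-1)%:E * (x * h x)%:E)%E.
  by apply/funext => x; rewrite /k /comp EFinB -EFinM; congr (_ - EFin _)%E; ring.
by apply: integrableB => //; apply: integrableZl.
Qed.

(** Over symmetric intervals the integral is a difference of boundary terms;
    the indices [n.+1] keep the intervals nondegenerate. *)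
Let integral_k_itv n : (\int[leb]_(x in `[(- n.+1%:R)%R, (n.+1%:R)%R]) (k x * phi x)%:E =
  (K n.+1%:R)%:E - (K (- n.+1%:R))%:E)%E.
Proof.
have dcK (x : R) : derivable K x 1 by have := dK x; case.
have cK : continuous K by move=> x; exact: is_derive_continuous (dK x).
apply: continuous_FTC2.
- by rewrite gtrN// ltr0n.
- exact: continuous_subspaceT.
- split; first by move=> x _; exact: dcK.
    exact/cvg_at_right_filter/cK.
  exact/cvg_at_left_filter/cK.
- by move=> x _; rewrite derive1E; have := dK x => ?; rewrite derive_val.
Qed.

Let integral_k : (\int[leb]_x (k x * phi x)%:E = 0)%E.
Proof.
pose A n := `[(- n.+1%:R)%R, (n.+1%:R)%R]%classic : set R.
pose f_ n := fun x : R => (k x * phi x * \1_(A n) x)%:E.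
have ikp := integrable_normal_probP integrable_k.
have mkp : measurable_fun [set: R] (fun x => k x * phi x) by exact: continuous_measurable_fun.
have mA n : measurable (A n) by exact: measurable_itv.
have mf_ n : measurable_fun setT (f_ n).
  by apply/measurable_EFinP; apply: measurable_funM => //; exact: measurable_indic.
have mf : measurable_fun setT (fun x : R => (k x * phi x)%:E).
  exact/measurable_EFinP.
have ff : {ae lebesgue_measure, forall x : R, setT x ->
    f_ ^~ x @ \oo --> (k x * phi x)%:E}.
  apply: aeW => x _; apply: cvg_near_cst; near=> n.
  rewrite /f_ indicE mem_set ?mulr1//= /A/= in_itv/= -ler_norml.
  rewrite (@le_trans _ _ n%:R)// ?ler_nat//.
  by near: n; exact: nbhs_infty_ger.
have fg : {ae lebesgue_measure, forall (x : R) n, setT x ->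
    `|f_ n x| <= `|(k x * phi x)%:E|}%E.
  apply: aeW => x n _; rewrite /f_ /= lee_fin normrM ler_piMr//.
  by rewrite indicE; case: (_ \in _); rewrite ?normr1 ?normr0.
have [_ _] := dominated_convergence mT mf_ mf ff (integrable_abse ikp) fg.
have -> : (fun n => \int[lebesgue_measure]_x f_ n x)%E =
   (fun n => (h n.+1%:R * phi n.+1%:R - h (- n.+1%:R) * phi n.+1%:R)%:E).
  apply/funext => n; rewrite -[in X in _ - X]normal_pdf_even EFinB -integral_k_itv.
  rewrite [RHS]integral_mkcond; apply: eq_integral => x _.
  by rewrite /f_ patchE indicE /A; case: ifP => _; rewrite ?mulr1 ?mulr0.
move=> H; apply: (cvg_unique _ H) => //.
apply: cvg_EFin; first by apply: nearW.
rewrite [X in X @ _ --> _](_ : _ = (fun n : nat =>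
  h n.+1%:R * phi n.+1%:R - h (- n.+1%:R) * phi n.+1%:R))//.
have hb (g : nat -> R) : (forall n, `|g n| <= 1) -> g n * phi n.+1%:R @[n --> \oo] --> (0:R).
  move=> g1; apply/norm_cvg0P; apply: (@squeeze_cvgr _ _ _ _ (cst 0) (fun n => phi n.+1%:R)).
  - apply: nearW => n /=; rewrite normr_ge0/= normrM (ger0_norm (normal_pdf_ge0 _ _ _)).
    by rewrite ler_piMl// normal_pdf_ge0.
  - exact: cvg_cst.
  - exact: normal_pdf_cvg0.
rewrite -[X in _ --> X](subr0 0); apply: cvgB; exact: hb.
Unshelve. all: by end_near. Qed.

Lemma gaussian_ibp :
  (\int[normal_prob 0 s]_x (x * h x) = s ^+ 2 * \int[normal_prob 0 s]_x dh x)%R.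
Proof.
have : (\int[normal_prob 0 s]_x k x = 0)%R.
  by rewrite integral_normal_prob// /Rintegral integral_k.
have s2 : s ^+ 2 != 0 by rewrite sqrf_eq0.
have -> : k = (fun x => dh x - (s ^+ 2)^-1 * (x * h x)).
  by apply/funext => x; rewrite /k; ring.
rewrite RintegralB//; last exact: integZ.
rewrite RintegralZl// => /eqP; rewrite subr_eq0 => /eqP ->.
by rewrite mulrA divff// mul1r.
Qed.
End gaussian_ibp.

Section tail.
Context {R : realType}.
(** On [[t, t + s]], an interval of length one standard deviation, the density
    is at least its value at the right end. *)
Lemma normal_tail_ge (s t : R) : 0 < s -> 0 <= t ->
  (((Num.sqrt (pi *+ 2))^-1 * expR (- (t / s + 1) ^+ 2 / 2))%:E <=
   normal_prob 0 s `[t, +oo[)%E.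
Proof.
move=> sp t0; have s0 : s != 0 by rewrite gt_eqF.
have sub : ([set` `[t, t + s]] : set R) `<=` [set` `[t, +oo[].
  by move=> x /=; rewrite !in_itv/= => /andP[->].
apply: (@le_trans _ _ (normal_prob 0 s `[t, t + s])); last first.
  by apply: le_measure => //; rewrite inE; exact: measurable_itv.
set c := _ * _.
apply: (@le_trans _ _ (\int[lebesgue_measure]_(x in `[t, (t + s)%R]) (c / s)%:E)%E).
  rewrite integral_cst; last exact: measurable_itv.
  rewrite /= lebesgue_measure_itv/= lte_fin ltrDl sp -EFinB -EFinM lee_fin.
  by rewrite addrAC subrr add0r divfK.
apply: ge0_le_integral => //.
- by move=> x _; rewrite lee_fin divr_ge0 ?(ltW sp)// mulr_ge0 ?expR_ge0// invr_ge0.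
- apply/measurable_EFinP/measurable_funTS; exact: measurable_normal_pdf.
move=> x /=; rewrite in_itv/= => /andP[tx xs].
rewrite lee_fin normal_pdfE// /normal_fun subr0 /c /normal_peak.
rewrite -mulrnAr sqrtrM ?sqr_ge0// sqrtr_sqr gtr0_norm// invfM.
rewrite mulrC mulrA ler_wpM2l// ?mulr_ge0 ?invr_ge0 ?(ltW sp)//.
rewrite ler_expR !mulNr lerN2 -[X in _ <= X / 2]mulr1.
have -> : (t / s + 1) ^+ 2 * 1 / 2 = (t + s) ^+ 2 / (s ^+ 2 *+ 2).
  by rewrite -mulr_natr; field.
rewrite ler_wpM2r ?invr_ge0 ?mulrn_wge0 ?sqr_ge0//.
by rewrite ler_pXn2r// nnegrE; lra.
Qed.
End tail.

Section law.
Context {R : realType} {d : measure_display} {T : measurableType d}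
  {P : probability T R}.
Variable X : {RV P >-> R}.

(** The same map as [X], with values in the line seen as the measurable space
    on which Lebesgue measure and the normal laws live. *)
Definition lebesgue_valued : T -> measurableTypeR R := X.

Lemma measurable_lebesgue_valued : measurable_fun setT lebesgue_valued.
Proof.
have mX : measurable_fun setT X by [].
by move=> mD A mA; exact: mX.
Qed.

HB.instance Definition _ := @isMeasurableFun.Build _ _ _ _ lebesgue_valued
  measurable_lebesgue_valued.

Definition law : probability (measurableTypeR R) R :=
  distribution P (lebesgue_valued : {RV P >-> measurableTypeR R}).

End law.

Section centered_gaussian_variables.
Context {R : realType} {d : measure_display} {T : measurableType d}
  {P : probability T R}.
Variables (X : {RV P >-> R}) (v : R).
Hypotheses (v0 : 0 <= v) (Xv : centered_gaussian X v).
Notation integ f := (P.-integrable [set: T] (EFin \o f)).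

Let mT : measurable [set: measurableTypeR R]. Proof. by []. Qed.

Lemma law_normal_integral (f : R -> R) : v != 0 ->
  (normal_prob 0 (Num.sqrt v)).-integrable setT (EFin \o f) ->
  (law X).-integrable setT (EFin \o f) /\
  (\int[law X]_x f x = \int[normal_prob 0 (Num.sqrt v)]_x f x)%R.
Proof.
move=> vN0 fi.
have H A : measurable A -> A `<=` setT -> law X A = normal_prob 0 (Num.sqrt v) A.
  by move=> mA _; have := Xv mA; rewrite (negbTE vN0).
split; last first.
  by rewrite /Rintegral (@eq_measure_integral _ _ _ setT (normal_prob 0 (Num.sqrt v)) _ _ H).
move/integrableP : fi => [mf' foo]; apply/integrableP; split => //.
by rewrite (@eq_measure_integral _ _ _ setT (normal_prob 0 (Num.sqrt v)) _ _ H).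
Qed.

(** The degenerate case: at variance 0 the law is a point mass, to be treated
    apart in everything that follows. *)
Lemma law_dirac_integral (f : R -> R) : measurable_fun [set: R] f -> v = 0 ->
  (law X).-integrable setT (EFin \o f) /\ (\int[law X]_x f x = f 0)%R.
Proof.
move=> mf vE0.
pose D : {measure set (measurableTypeR R) -> \bar R} := \d_(0 : measurableTypeR R).
have H A : measurable A -> A `<=` setT -> law X A = D A.
  by move=> mA _; have := Xv mA; rewrite vE0 eqxx.
have mf' : measurable_fun [set: measurableTypeR R] (EFin \o f) by exact/measurable_EFinP.
split; last first.
  rewrite /Rintegral (@eq_measure_integral _ _ _ setT D _ _ H) integral_dirac//=.
  by rewrite /D /dirac indicT ?mul1e ?mul1r.
apply/integrableP; split => //.
rewrite (@eq_measure_integral _ _ _ setT D _ _ H) integral_dirac//=.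
- by rewrite /D /dirac indicT ?mul1e ?mul1r ltry.
- by apply/measurable_EFinP; apply: measurableT_comp => //; exact: mf.
Qed.

Lemma integral_law (f : R -> R) : measurable_fun [set: R] f ->
  (law X).-integrable setT (EFin \o f) ->
  integ (f \o X) /\ (\int[P]_w f (X w) = \int[law X]_x f x)%R.
Proof.
move=> mf fi.
have i : integ (f \o X).
  move/integrableP : fi => [_ foo]; apply/integrableP; split.
    by apply/measurable_EFinP; exact: measurableT_comp.
  move: foo; rewrite ge0_integral_distribution//.
  by apply: measurableT_comp => //; exact/measurable_EFinP.
split=> //; rewrite /Rintegral integral_distribution//.
exact/measurable_EFinP.
Qed.

Let sv : v != 0 -> 0 < Num.sqrt v.
Proof. by move=> vN0; rewrite sqrtr_gt0 lt_def vN0. Qed.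

Let svN0 : v != 0 -> Num.sqrt v != 0.
Proof. by move=> /sv; rewrite lt_def => /andP[]. Qed.

Lemma law_integrable_id : (law X).-integrable setT (EFin \o id).
Proof.
have [vE0|vN0] := eqVneq v 0; first by have [] := law_dirac_integral (f := id) (@measurable_id _ _ setT) vE0.
by have [] := law_normal_integral (f := id) vN0 (integrable_id_normal (svN0 vN0)).
Qed.

Lemma gaussian_integrable : integ X.
Proof. by have [] := integral_law (f := id) (@measurable_id _ _ setT) law_integrable_id. Qed.

Let measurable_expR_mul (a : R) : measurable_fun [set: R] (fun x : R => expR (a * x)).
Proof. by apply: measurableT_comp => //; exact: measurable_funM. Qed.

Lemma law_mgf (a : R) : (law X).-integrable setT (EFin \o (fun x => expR (a * x))) /\
  (\int[law X]_x expR (a * x) = expR (a ^+ 2 * v / 2))%R.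
Proof.
have [vE0|vN0] := eqVneq v 0.
  have [? ->] := law_dirac_integral (measurable_expR_mul a) vE0; split => //.
  by rewrite vE0 !mulr0 mul0r.
have [|? ->] := @law_normal_integral (fun x => expR (a * x)) vN0.
  exact: integrable_expR_normal (svN0 vN0) a.
by split => //; rewrite /Rintegral integral_expR_normal ?svN0//= sqr_sqrtr.
Qed.

(** Valid at variance 0 too. *)
Lemma gaussian_mgf (a : R) : integ (fun w => expR (a * X w)) /\
  (\int[P]_w expR (a * X w) = expR (a ^+ 2 * v / 2))%R.
Proof.
have [fi fE] := law_mgf a.
by have [? H] := integral_law (measurable_expR_mul a) fi; split => //; rewrite H.
Qed.

Lemma gaussian_norm_le : (\int[P]_w `|X w| <= 2 * expR 1 * Num.sqrt v)%R.
Proof.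
have mf : measurable_fun [set: R] (fun x : R => `|x|) by exact: normr_measurable.
have fi : (law X).-integrable setT (EFin \o (fun x : R => `|x|)).
  exact: (integrable_norm law_integrable_id).
have [_ ->] := integral_law mf fi.
have [vE0|vN0] := eqVneq v 0.
  have [_ ->] := law_dirac_integral mf vE0.
  by rewrite normr0 vE0 sqrtr0 mulr0.
have [|_ ->] := @law_normal_integral (fun x : R => `|x|) vN0.
  exact: (integrable_norm (integrable_id_normal (svN0 vN0))).
exact: integral_norm_normal (svN0 vN0) (sv vN0).
Qed.

(** Stein's identity; for [v = 0] both sides vanish. *)
Lemma law_ibp (h dh : R -> R) (C : R) :
  (forall x : R, is_derive x 1 h (dh x)) -> continuous dh ->
  (forall x, `|h x| <= 1) -> (forall x, `|dh x| <= C) ->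
  (\int[law X]_x (x * h x) = v * \int[law X]_x dh x)%R.
Proof.
move=> hdh cdh h1 dhC.
have mdh : measurable_fun [set: R] dh by exact: continuous_measurable_fun.
have mh : measurable_fun [set: R] h.
  by apply: continuous_measurable_fun => x; exact: is_derive_continuous (hdh x).
have mxh : measurable_fun [set: R] (fun x => x * h x) by exact: measurable_funM.
have [vE0|vN0] := eqVneq v 0.
  have [_ ->] := law_dirac_integral mxh vE0.
  by rewrite vE0 !mul0r.
have s0 := svN0 vN0.
have [|_ ->] := @law_normal_integral (fun x => x * h x) vN0.
  exact: (@integ_bMl _ (measurableTypeR R) R (normal_prob 0 (Num.sqrt v)) id h 1 mh h1 (integrable_id_normal s0)).
have [|_ ->] := @law_normal_integral dh vN0.
  exact: (@integ_bounded _ (measurableTypeR R) R (normal_prob 0 (Num.sqrt v)) dh C mdh dhC).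
by rewrite (gaussian_ibp s0 hdh cdh h1 dhC) sqr_sqrtr.
Qed.

End centered_gaussian_variables.

(** * Integrating out one independent Gaussian variable *)

Section joint_law.
Context {R : realType} {d : measure_display} {T : measurableType d}
  {P : probability T R}.
Variables (g : {RV P >-> R}) (W : nat -> {RV P >-> R}) (J : {fset nat}).

(** The generators of the sigma-field of the variables [W n], n in [J]. Only
    finitely many variables are involved, and the intersections of such events
    are again of this form, so that the uniqueness theorem for measures applies
    to them. *)
Definition cylinders : set (set T) :=
  [set C | exists2 B : nat -> set R, (forall n, measurable (B n)) &
    C = \bigcap_(n in [set` J]) (W n @^-1` B n)].

(** The sample space with the smaller sigma-field of the [W n]: a function is
    measurable on it when it depends on these variables alone. *)
Definition sigma_field := g_sigma_algebraType cylinders.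

Lemma cylinders_measurable : cylinders `<=` measurable.
Proof.
move=> _ [B mB ->]; apply: bigcap_measurableType => n _.
by rewrite -[X in measurable X]setTI; exact: measurable_funP.
Qed.

Lemma cylindersI : setI_closed cylinders.
Proof.
move=> _ _ [B mB ->] [B' mB' ->]; exists (fun n => B n `&` B' n).
  by move=> n; exact: measurableI.
by rewrite -bigcapI; apply: eq_bigcapr => n _; rewrite preimage_setI.
Qed.

Lemma cylindersT : cylinders setT.
Proof.
exists (fun=> setT) => //.
by rewrite bigcapT.
Qed.

Definition to_sigma_field : T -> sigma_field := idfun.

Lemma measurable_to_sigma_field : measurable_fun setT to_sigma_field.
Proof.
move=> _ A mA; rewrite setTI preimage_id.
have := smallest_sub (@sigma_algebra_measurable _ T) cylinders_measurable.
by apply.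
Qed.

HB.instance Definition _ := @isMeasurableFun.Build _ _ _ _ to_sigma_field
  measurable_to_sigma_field.

Definition restricted_prob : probability sigma_field R :=
  distribution P (to_sigma_field : {RV P >-> sigma_field}).

Lemma measurable_coordinate n : n \in J ->
  measurable_fun [set: sigma_field] (W n : sigma_field -> R).
Proof.
move=> nJ _ B mB; rewrite setTI; apply: sub_sigma_algebra.
exists (fun k => if k == n then B else setT).
  by move=> k; case: ifP.
apply/seteqP; split => [w Bw k _ /=|w /(_ n nJ)/=]; last by rewrite eqxx.
by case: eqP => // ->.
Qed.

Definition with_sigma_field (w : T) : measurableTypeR R * sigma_field := (g w, w).

Lemma measurable_with_sigma_field : measurable_fun setT with_sigma_field.
Proof.
by apply: measurable_fun_pair; [exact: measurable_lebesgue_valued|exact: measurable_to_sigma_field].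
Qed.

HB.instance Definition _ := @isMeasurableFun.Build _ _ _ _ with_sigma_field
  measurable_with_sigma_field.

Hypothesis indep : forall B0 (B : nat -> set R), measurable B0 ->
  (forall n, measurable (B n)) ->
  (P (g @^-1` B0 `&` \bigcap_(n in [set` J]) (W n @^-1` B n)) =
   P (g @^-1` B0) * P (\bigcap_(n in [set` J]) (W n @^-1` B n)))%E.

(** Two finite measures that agree on a generating family stable under
    intersection are equal. The measures are P restricted to the event
    [g \in B0], and P times the probability of this event. *)
Lemma indep_sigma_field (B0 : set R) (C : set sigma_field) : measurable B0 ->
  measurable C -> (P (g @^-1` B0 `&` C) = P (g @^-1` B0) * P C)%E.
Proof.
move=> mB0 mC.
have mgB : measurable (g @^-1` B0).
  by rewrite -[X in measurable X]setTI; exact: measurable_funP.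
pose p : {nonneg R} := NngNum (fine_ge0 (measure_ge0 P (g @^-1` B0))).
have pE : (p%:num)%:E = P (g @^-1` B0) by rewrite /= fineK// fin_num_measure.
rewrite setIC -pE.
apply: (@g_sigma_algebra_measure_unique _ _ _ cylinders cylinders_measurable
  (fun=> setT) _ _ (mrestr P mgB) (mscale p P) cylindersI) => //.
- by move=> _; exact: cylindersT.
- by apply/seteqP; split => // w _; exists 0%N.
- move=> _ [B mB ->]; rewrite /= /mrestr /mscale pE setIC; exact: indep.
- move=> _; rewrite /= /mrestr setTI ltey_eq fin_num_measure//.
Qed.

(** Independence, restated so that Fubini's theorem applies: the pair of [g]
    and the sample point, the latter seen through the [W n] only, has a product
    law. *)
Lemma joint_lawE (A : set (measurableTypeR R * sigma_field)) : measurable A ->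
  (law g \x restricted_prob)%E A =
  distribution P (with_sigma_field : {RV P >-> _}) A.
Proof.
move=> mA; apply: product_measure_unique => // B C mB mC.
rewrite /= /distribution /pushforward/=.
exact: indep_sigma_field.
Qed.

Section fubini.
Variable F : measurableTypeR R * sigma_field -> R.
Hypothesis mF : measurable_fun setT F.
Hypothesis Fi : P.-integrable setT (EFin \o (F \o with_sigma_field)).

Let mF' : measurable_fun setT (EFin \o F). Proof. exact/measurable_EFinP. Qed.

Lemma integrable_joint_law : (law g \x restricted_prob)%E.-integrable setT (EFin \o F).
Proof.
move/integrableP : Fi => [_ foo]; apply/integrableP; split => //.
rewrite (@eq_measure_integral _ _ _ setT
  (distribution P (with_sigma_field : {RV P >-> _}))).
  rewrite ge0_integral_distribution//; exact: measurableT_comp.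
by move=> A mA _; exact: joint_lawE.
Qed.

(** Freezing the [W n]: [g] may be integrated first, against its own law, in a
    function that depends on the sample point only through them. *)
Lemma indep_fubini :
  (\int[P]_w (F (g w, w))%:E =
   \int[restricted_prob]_w \int[law g]_x (F (x, w))%:E)%E.
Proof.
rewrite (integral21_prod_meas1 integrable_joint_law).
rewrite (@eq_measure_integral _ _ _ setT
  (distribution P (with_sigma_field : {RV P >-> _}))).
  by rewrite integral_distribution.
by move=> A mA _; exact: joint_lawE.
Qed.

End fubini.

Lemma integral_restricted (f : sigma_field -> \bar R) : measurable_fun setT f ->
  P.-integrable setT f -> (\int[restricted_prob]_w f w = \int[P]_w f w)%E.
Proof. by move=> mf fi; rewrite integral_distribution. Qed.

Lemma ge0_indep_fubini (F : measurableTypeR R * sigma_field -> \bar R) :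
  measurable_fun setT F -> (forall p, 0 <= F p)%E ->
  (\int[P]_w F (g w, w) = \int[restricted_prob]_w \int[law g]_x F (x, w))%E.
Proof.
move=> mF F0.
rewrite -(fubini_tonelli2 F) // (@eq_measure_integral _ _ _ setT
  (distribution P (with_sigma_field : {RV P >-> _}))).
  by rewrite ge0_integral_distribution.
by move=> A mA _; exact: joint_lawE.
Qed.

Lemma indep_expectation_mul (f : R -> R) (h : T -> R) :
  measurable_fun [set: R] f -> measurable_fun [set: sigma_field] (h : sigma_field -> R) ->
  (forall x, 0 <= f x) -> (forall w, 0 <= h w) ->
  (law g).-integrable setT (EFin \o f) -> P.-integrable setT (EFin \o h) ->
  P.-integrable setT (EFin \o (fun w => f (g w) * h w)) /\
  (\int[P]_w (f (g w) * h w) = (\int[law g]_x f x) * \int[P]_w h w)%R.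
Proof.
move=> mf mh f0 h0 fi hi.
have E : (\int[P]_w (f (g w) * h w)%:E = (\int[law g]_x f x)%:E * \int[P]_w (h w)%:E)%E.
  rewrite (ge0_indep_fubini (F := fun p => (f p.1 * h p.2)%:E)); last 2 first.
  - have mfR : measurable_fun [set: measurableTypeR R] (f : measurableTypeR R -> R).
      exact: mf.
    apply/measurable_EFinP; apply: measurable_funM.
      exact: (measurableT_comp mfR (@measurable_fst _ _ (measurableTypeR R) sigma_field)).
    exact: (measurableT_comp mh (@measurable_snd _ _ (measurableTypeR R) sigma_field)).
  - by move=> p; rewrite lee_fin mulr_ge0.
  under eq_integral => w _.
    under eq_integral do rewrite /= mulrC EFinM.
    rewrite (integralZl measurableT fi) -[X in (_ * X)%E]fineK ?integrable_fin_num//.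
    rewrite muleC -/(Rintegral _ _ _).
    over.
  have mh' : measurable_fun [set: sigma_field] (fun w : sigma_field => (h w)%:E).
    exact/measurable_EFinP.
  have h' : restricted_prob.-integrable setT (EFin \o h).
    apply/integrableP; split => //.
    move/integrableP : hi => [_]; rewrite ge0_integral_distribution//.
    exact: measurableT_comp.
  by rewrite integralZl// integral_restricted.
have mfh : measurable_fun setT (fun w => f (g w) * h w).
  apply: measurable_funM; first exact: measurableT_comp.
  exact: integ_measurable hi.
have fhi : P.-integrable setT (EFin \o (fun w => f (g w) * h w)).
  apply/integrableP; split; first exact/measurable_EFinP.
  under eq_integral do rewrite /= ger0_norm ?mulr_ge0//.
  by rewrite E ltey_eq fin_numM// integrable_fin_num.
split => //; apply: EFin_inj; rewrite EFinM /Rintegral !fineK ?integrable_fin_num//.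
by rewrite E; congr (_ * _)%E; rewrite fineK ?integrable_fin_num.
Qed.

Section indep_ibp.
Variables (v : R) (H dH : R -> T -> R) (C : R).
Hypotheses (v0 : 0 <= v) (gv : centered_gaussian g v).
Hypothesis mH : measurable_fun setT
  (fun p : measurableTypeR R * sigma_field => H p.1 p.2).
Hypothesis mdH : measurable_fun setT
  (fun p : measurableTypeR R * sigma_field => dH p.1 p.2).
Hypothesis HdH : forall w (x : R), is_derive x 1 (H ^~ w) (dH x w).
Hypothesis cdH : forall w, continuous (dH ^~ w).
Hypothesis H1 : forall x w, `|H x w| <= 1.
Hypothesis dHC : forall x w, `|dH x w| <= C.

(** Gaussian integration by parts in the presence of the [W n]: with these
    frozen it is Stein's identity for [g]. *)
Lemma indep_ibp :
  (\int[P]_w (g w * H (g w) w) = v * \int[P]_w dH (g w) w)%R.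
Proof.
have gi := gaussian_integrable v0 gv.
have mHg : measurable_fun setT (fun w => H (g w) w).
  exact: (measurableT_comp mH measurable_with_sigma_field).
have mdHg : measurable_fun setT (fun w => dH (g w) w).
  exact: (measurableT_comp mdH measurable_with_sigma_field).
have gHi := integ_bMl (f := g) mHg (fun w => H1 (g w) w) gi.
have dHi := @integ_bounded _ _ _ P _ C mdHg (fun w => dHC (g w) w).
have mgH : measurable_fun setT
    (fun p : measurableTypeR R * sigma_field => p.1 * H p.1 p.2).
  by apply: measurable_funM => //; exact: measurable_fst.
apply: EFin_inj; rewrite EFinM /Rintegral !fineK ?integrable_fin_num//.
rewrite (indep_fubini mgH gHi) (indep_fubini mdH dHi)/=.
transitivity (\int[restricted_prob]_w (v%:E * \int[law g]_x (dH x w)%:E))%E.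
  apply: eq_integral => w _.
  have mHw : measurable_fun [set: measurableTypeR R] (H ^~ w).
    by apply: continuous_measurable_fun => x; exact: is_derive_continuous (HdH w x).
  have ixH := @integ_bMl _ (measurableTypeR R) R (law g) id (H ^~ w) 1 mHw (H1 ^~ w)
    (law_integrable_id v0 gv).
  have mdHw : measurable_fun [set: measurableTypeR R] (dH ^~ w).
    exact: continuous_measurable_fun.
  have idH := @integ_bounded _ (measurableTypeR R) R (law g) (dH ^~ w) C mdHw (dHC ^~ w).
  have /(congr1 (@EFin R)) := law_ibp v0 gv (HdH w) (cdH (w := w)) (H1 ^~ w) (dHC ^~ w).
  by rewrite EFinM /Rintegral !fineK ?integrable_fin_num.
rewrite integralZl//.
apply: (le_integrable measurableT (g := cst C%:E)).
- exact: (measurable_fubini_G (integrable_joint_law mdH dHi)).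
- move=> w _ /=.
  have mdHw : measurable_fun [set: measurableTypeR R] (dH ^~ w).
    exact: continuous_measurable_fun.
  apply: (le_trans (le_abse_integral _ measurableT _)); first exact/measurable_EFinP.
  apply: (@le_trans _ _ (\int[law g]_x C%:E)%E).
    apply: ge0_le_integral => //.
    + by apply: measurableT_comp => //; exact/measurable_EFinP.
    + by move=> x _; rewrite /= lee_fin.
  rewrite integral_cst// -[X in (_ <= X)%E]mule1.
  apply: (@le_trans _ _ (`|C|%:E * law g setT)%E).
    by apply: lee_wpmul2r => //; rewrite lee_fin ler_norm.
  by apply: lee_wpmul2l; rewrite ?lee_fin// probability_le1.
- exact: finite_measure_integrable_cst.
Qed.

End indep_ibp.
End joint_law.

(** * Gibbs weights and the logarithm of the partition function *)

Section softmax.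
Context {R : realType} {n : nat}.
Implicit Types (H d : 'I_n -> R) (i j : 'I_n).

Definition partition_sum H : R := \sum_j expR (H j).
Definition softmax H i : R := expR (H i) / partition_sum H.

Lemma expR_le_partition_sum H i : expR (H i) <= partition_sum H.
Proof.
rewrite /partition_sum (bigD1 i)//= lerDl sumr_ge0// => j _; exact: expR_ge0.
Qed.

Lemma partition_sum_gt0 H i : 0 < partition_sum H.
Proof. exact: lt_le_trans (expR_gt0 _) (expR_le_partition_sum H i). Qed.

Lemma softmax_ge0 H i : 0 <= softmax H i.
Proof. by rewrite divr_ge0 ?expR_ge0// ltW// (partition_sum_gt0 H i). Qed.

Lemma softmax_le1 H i : softmax H i <= 1.
Proof.
by rewrite ler_pdivrMr ?(partition_sum_gt0 H i)// mul1r expR_le_partition_sum.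
Qed.

Lemma norm_softmax_le1 H i : `|softmax H i| <= 1.
Proof. by rewrite ger0_norm ?softmax_ge0 ?softmax_le1. Qed.

Lemma sum_softmax H : (0 < n)%N -> \sum_i softmax H i = 1.
Proof.
move=> n0; rewrite -mulr_suml divff// gt_eqF//.
exact: (partition_sum_gt0 H (Ordinal n0)).
Qed.

Lemma ln_partition_sum_ge H i : H i <= ln (partition_sum H).
Proof. by rewrite -ler_expR lnK ?expR_le_partition_sum// posrE (partition_sum_gt0 H i). Qed.

(** Convexity, from exp x >= 1 + x: the increment of the left side is the
    logarithm of a Gibbs average of exp (d_i), and D is the average of d_i. *)
Lemma ln_partition_sum_tangent H d : (0 < n)%N ->
  ln (partition_sum H) + \sum_i softmax H i * d i <=
  ln (partition_sum (fun i => H i + d i)).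
Proof.
move=> n0; pose i0 := Ordinal n0.
set D := \sum_i softmax H i * d i.
have Z0 := partition_sum_gt0 H i0.
rewrite -ler_expR expRD !lnK ?posrE ?(partition_sum_gt0 _ i0)//.
rewrite -ler_pdivlMl//.
have -> : (partition_sum H)^-1 * partition_sum (fun i => H i + d i) =
    expR D * \sum_i softmax H i * expR (d i - D).
  rewrite !mulr_sumr; apply: eq_bigr => i _.
  by rewrite /softmax expRD expRB; field; rewrite !gt_eqF ?expR_gt0.
rewrite ler_peMr ?expR_ge0//.
have -> : 1 = \sum_i softmax H i * (1 + (d i - D)) :> R.
  under eq_bigr do rewrite mulrDr mulrBr mulr1.
  by rewrite big_split sumrB/= -[\sum_i softmax H i * D]mulr_suml !sum_softmax// mul1r subrr addr0.
by apply: ler_sum => i _; rewrite ler_wpM2l ?softmax_ge0 ?expR_ge1Dx.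
Qed.

(** The l^b norm of the vector exp (H_i) is at most its l^a norm: after
    normalization all entries are at most 1. *)
Lemma ln_partition_sum_scale H (a b : R) : (0 < n)%N -> 0 < a -> a <= b ->
  ln (partition_sum (fun i => b * H i)) <= b / a * ln (partition_sum (fun i => a * H i)).
Proof.
move=> n0 a0 ab; pose i0 := Ordinal n0.
set Za := partition_sum (fun i => a * H i).
have Z0 : 0 < Za := partition_sum_gt0 (fun i => a * H i) i0.
rewrite -ler_expR lnK ?posrE ?(partition_sum_gt0 _ i0)//.
have -> : partition_sum (fun i => b * H i) =
    expR (b / a * ln Za) * \sum_i expR (b / a * (a * H i - ln Za)).
  rewrite mulr_sumr; apply: eq_bigr => i _; rewrite -expRD; congr expR.
  by field; rewrite gt_eqF.
rewrite ler_piMr ?expR_ge0//.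
rewrite -(sum_softmax (fun i => a * H i) n0); apply: ler_sum => i _.
have -> : softmax (fun i => a * H i) i = expR (a * H i - ln Za).
  by rewrite /softmax expRB lnK.
have : a * H i - ln Za <= 0 by rewrite subr_le0 ln_partition_sum_ge.
by move=> le0; rewrite ler_expR -[leRHS]mul1r ler_wnM2r // ler_pdivlMr // mul1r.
Qed.

(** The energies are affine in one real variable [x], the value of a single
    independent piece of the field; integration by parts in [x] needs the
    derivative of a weight, its continuity, and a bound that does not depend on
    the other pieces [b]. *)
Section derivative.
Variables (a b : 'I_n -> R) (i : 'I_n).
Let H (x : R) j := a j * x + b j.

Let is_derive_exp j (x : R) : is_derive x 1 (fun y => expR (H y j)) (a j * expR (H x j)).
Proof.
rewrite /H; apply: is_derive_eq.
rewrite /GRing.scale/= !(mulr0, mulr1, addr0, add0r).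
by ring.
Qed.

Let is_derive_partition_sum (x : R) :
  is_derive x 1 (fun y => partition_sum (H y)) (\sum_j a j * expR (H x j)).
Proof.
rewrite /partition_sum.
have -> : (fun y => \sum_j expR (H y j)) = \sum_j (fun y => expR (H y j)).
  by apply/funext => y; rewrite fct_sumE.
exact: is_derive_sum.
Qed.

Definition softmax_slope x :=
  softmax (H x) i * (a i - \sum_j softmax (H x) j * a j).

Lemma is_derive_softmax (x : R) :
  is_derive x 1 (fun y => softmax (H y) i) (softmax_slope x).
Proof.
have Z0 := partition_sum_gt0 (H x) i.
rewrite /softmax; have ? := is_derive_exp i x.
have ? := is_derive_partition_sum x.
have ? : partition_sum (H x) != 0 by rewrite gt_eqF.
have -> : (fun y => expR (H y i) / partition_sum (H y)) =
  (fun y => expR (H y i)) * (fun y => (partition_sum (H y))^-1) by [].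
apply: is_derive_eq.
rewrite /GRing.scale/= /softmax_slope /softmax.
have -> : \sum_j expR (H x j) / partition_sum (H x) * a j =
   (\sum_j a j * expR (H x j)) / partition_sum (H x).
  by rewrite mulr_suml; apply: eq_bigr => j _; ring.
by field.
Qed.

Lemma continuous_softmax j : continuous (fun y => softmax (H y) j).
Proof.
move=> x; apply: cvgM; first exact: is_derive_continuous (is_derive_exp j x).
apply: cvgV; first by rewrite gt_eqF ?(partition_sum_gt0 _ j).
exact: is_derive_continuous (is_derive_partition_sum x).
Qed.

Lemma continuous_softmax_slope : continuous softmax_slope.
Proof.
move=> x; apply: cvgM; first exact: continuous_softmax.
apply: cvgB; first exact: cvg_cst.
apply: (@cvg_big _ _ +%R) => // [|j _]; first exact: add_continuous.
apply: cvgM; [exact: continuous_softmax|exact: cvg_cst].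
Qed.

Lemma norm_softmax_slope_le (A : R) x : (forall j, `|a j| <= A) -> `|softmax_slope x| <= A + A.
Proof.
move=> aA; rewrite normrM -[leRHS]mul1r ler_pM// ?norm_softmax_le1//.
rewrite (le_trans (ler_normB _ _))// lerD//.
rewrite (le_trans (ler_norm_sum _ _ _))//.
have -> : A = \sum_j softmax (H x) j * A.
  by rewrite -mulr_suml sum_softmax ?mul1r// (leq_ltn_trans (leq0n i)).
by apply: ler_sum => j _; rewrite normrM ger0_norm ?softmax_ge0// ler_wpM2l ?softmax_ge0.
Qed.

End derivative.
End softmax.

(** * The intensity measure of the half-cylinder *)

Section theta.
Context {R : realType}.
Implicit Types (A B : set (R * R)).
Notation leb := (@lebesgue_measure R).
Notation R2 := (measurableTypeR R * measurableTypeR R)%type.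

(** The density y ^ (-2), in a form that is a measurable function on the whole
    plane; the two agree for y > 0. *)
Definition intensity (p : R2) : \bar R := (expR (- 2 * ln p.2))%:E.

Lemma intensity_ge0 p : (0 <= intensity p)%E.
Proof. by rewrite lee_fin expR_ge0. Qed.

Lemma measurable_intensity (D : set R2) : measurable_fun D intensity.
Proof.
apply: measurable_funTS; apply/measurable_EFinP; apply: measurableT_comp => //.
apply: measurable_funM => //.
have mln : measurable_fun [set: measurableTypeR R] (@ln R) by exact: measurable_ln.
exact: (measurableT_comp mln (@measurable_snd _ _ (measurableTypeR R) (measurableTypeR R))).
Qed.

Lemma intensityE (y : R) : 0 < y -> expR (- 2 * ln y) = y ^- 2.
Proof.
by move=> y0; rewrite mulNr expRN mulrC expRM_natr lnK.
Qed.

Lemma measurable_half_cylinder : measurable (@half_cylinder R).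
Proof.
have -> : @half_cylinder R = `[0, 1[%classic `*` `]0, +oo[%classic.
  by apply/seteqP; split => -[x y]; rewrite /half_cylinder/= !in_itv/= andbT.
by apply: measurableX; exact: measurable_itv.
Qed.

Lemma thetaE A : A `<=` half_cylinder ->
  theta A = (\int[leb \x leb]_(p in A) intensity p)%E.
Proof.
move=> AH; rewrite /theta setIidl//; apply: eq_integral => p /set_mem /AH [_ p2].
by rewrite /intensity intensityE.
Qed.

Lemma theta_ge0 A : (0 <= theta A)%E.
Proof. by apply: integral_ge0 => p _; rewrite lee_fin invr_ge0 sqr_ge0. Qed.

Lemma theta0 : theta (set0 : set (R * R)) = 0%E.
Proof. by rewrite /theta set0I integral_set0. Qed.

Lemma le_theta A B : measurable A -> measurable B -> B `<=` half_cylinder ->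
  A `<=` B -> (theta A <= theta B)%E.
Proof.
move=> mA mB BH AB; rewrite !thetaE//; last exact: subset_trans BH.
apply: ge0_subset_integral => //; first exact: measurable_intensity.
by move=> *; exact: intensity_ge0.
Qed.

Lemma theta_setU A B : measurable A -> measurable B -> A `<=` half_cylinder ->
  B `<=` half_cylinder -> [disjoint A & B] ->
  (theta (A `|` B) = theta A + theta B)%E.
Proof.
move=> mA mB AH BH AB; rewrite !thetaE//; last by rewrite subUset.
apply: ge0_integral_setU => //; first exact: measurable_intensity.
by move=> *; exact: intensity_ge0.
Qed.

(** Used for sets of finite measure only, where no value is truncated. *)
Definition rtheta A : R := fine (theta A).

Lemma rtheta_ge0 A : 0 <= rtheta A.
Proof. by rewrite /rtheta fine_ge0// theta_ge0. Qed.

Lemma finite_theta_fin A : finite_theta A -> theta A \is a fin_num.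
Proof. by case=> _ _ Aoo; rewrite ge0_fin_numE// theta_ge0. Qed.

Lemma rtheta0 : rtheta set0 = 0. Proof. by rewrite /rtheta theta0. Qed.

Lemma finite_theta0 : finite_theta (set0 : set (R * R)).
Proof. by split => //; rewrite theta0 ltry. Qed.

Lemma finite_theta_sub A B : finite_theta B -> measurable A -> A `<=` B ->
  finite_theta A.
Proof.
move=> [mB BH Boo] mA AB; split => //; first exact: subset_trans BH.
by apply: le_lt_trans Boo; exact: le_theta.
Qed.

Lemma finite_thetaI A B : finite_theta A -> finite_theta B -> finite_theta (A `&` B).
Proof.
move=> fA [mB _ _]; apply: (finite_theta_sub fA); last exact: subIsetl.
by case: fA => mA _ _; exact: measurableI.
Qed.

Lemma finite_thetaD A B : finite_theta A -> finite_theta B -> finite_theta (A `\` B).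
Proof.
move=> fA [mB _ _]; apply: (finite_theta_sub fA); last exact: subDsetl.
by case: fA => mA _ _; exact: measurableD.
Qed.

Lemma rtheta_le A B : finite_theta B -> measurable A -> A `<=` B -> rtheta A <= rtheta B.
Proof.
move=> fB mA AB; have fA := finite_theta_sub fB mA AB.
rewrite /rtheta fine_le ?finite_theta_fin//.
by case: fB => *; exact: le_theta.
Qed.

Lemma rtheta_setU A B : finite_theta A -> finite_theta B -> A `&` B = set0 ->
  rtheta (A `|` B) = rtheta A + rtheta B.
Proof.
move=> fA fB AB; have [mA AH _] := fA; have [mB BH _] := fB.
rewrite /rtheta theta_setU//; last exact/disj_set2P.
by rewrite fineD ?finite_theta_fin.
Qed.

Lemma finite_thetaU A B : finite_theta A -> finite_theta B -> finite_theta (A `|` B).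
Proof.
move=> fA fB; have [mA AH Aoo] := fA; have [mB BH Boo] := fB.
have [mBA BAH BAoo] := finite_thetaD fB fA.
split; [exact: measurableU|by rewrite subUset|].
have -> : A `|` B = A `|` (B `\` A).
  apply/seteqP; split => p [Ap|]; [by left| |by left|by case; right].
  by move=> Bp; have [Ap|Ap] := pselect (A p); [left|right].
rewrite theta_setU//; first exact: lte_add_pinfty.
by apply/disj_set2P; apply/seteqP; split => // p [? []].
Qed.

Lemma finite_theta_bigsetU (I : Type) (s : seq I) (Q : pred I) (A : I -> set (R * R)) :
  (forall i, finite_theta (A i)) ->
  finite_theta (\big[setU/set0]_(i <- s | Q i) A i).
Proof.
move=> fA; elim/big_ind : _ => //; [exact: finite_theta0|exact: finite_thetaU].
Qed.

Lemma rtheta_bigsetU (I : finType) (Q : pred I) (A : I -> set (R * R)) :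
  (forall i, finite_theta (A i)) -> trivIset setT A ->
  rtheta (\big[setU/set0]_(i | Q i) A i) = \sum_(i | Q i) rtheta (A i).
Proof.
move=> fA tA; rewrite -[in LHS]big_filter -[RHS]big_filter.
have : uniq [seq i <- index_enum I | Q i] by rewrite filter_uniq// index_enum_uniq.
elim: [seq _ <- _ | _] => [|i s ih] /=; first by rewrite !big_nil rtheta0.
move=> /andP[si us]; rewrite !big_cons rtheta_setU ?ih//; first exact: finite_theta_bigsetU.
apply/seteqP; split => // p [Aip]; rewrite -bigcup_seq => -[j /= js Ajp].
have /tA ij : (A i `&` A j) !=set0 by exists p.
by move: si; rewrite (ij Logic.I Logic.I) js.
Qed.

End theta.

(** * Finite families of values of the random measure *)

Section independence.
Context {R : realType} {d : measure_display} {T : measurableType d}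
  {P : probability T R}.

(** The case used of independence: one variable against an event on others. *)
Lemma independent_seq_split (X : nat -> {RV P >-> R}) (k : nat) (J : {fset nat}) :
  independent_seq X -> k \notin J -> forall B0 (B : nat -> set R), measurable B0 ->
  (forall n, measurable (B n)) ->
  (P (X k @^-1` B0 `&` \bigcap_(n in [set` J]) (X n @^-1` B n)) =
   P (X k @^-1` B0) * P (\bigcap_(n in [set` J]) (X n @^-1` B n)))%E.
Proof.
move=> indX kJ B0 B mB0 mB.
pose B' n := if n == k then B0 else B n.
have mB' n : measurable (B' n) by rewrite /B'; case: ifP.
have BB' n : n \in J -> B' n = B n.
  by rewrite /B'; case: eqP => // -> kJ'; rewrite kJ' in kJ.
have -> : X k @^-1` B0 `&` \bigcap_(n in [set` J]) (X n @^-1` B n) =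
    \bigcap_(n in [set` (k |` J)%fset]) (X n @^-1` B' n).
  apply/seteqP; split => w /=.
    move=> [Bk BJ] n /=; rewrite in_fset1U => /orP[/eqP ->|nJ].
      by rewrite /B' eqxx.
    by rewrite BB'//; exact: BJ.
  move=> H; split.
    by have := H k; rewrite /= in_fset1U eqxx /B' eqxx; exact.
  by move=> n nJ; have := H n; rewrite /= in_fset1U BB'// nJ orbT; exact.
rewrite indX// big_fsetU1//=; congr (_ * _)%E; first by rewrite /B' eqxx.
by rewrite indX//; apply: eq_big_seq => n nJ; rewrite BB'.
Qed.
End independence.

Section random_measure.
Context {R : realType} {d : measure_display} {T : measurableType d}
  {P : probability T R}.
Variable mu : set (R * R) -> {RV P >-> R}.
Hypothesis mu_grm : gaussian_random_measure mu.

Lemma grm_rtheta A : finite_theta A -> centered_gaussian (mu A) (rtheta A).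
Proof. exact: grm_gaussian. Qed.

Lemma grm_integrable A : finite_theta A -> P.-integrable setT (EFin \o mu A).
Proof. by move=> fA; exact: gaussian_integrable (rtheta_ge0 A) (grm_rtheta fA). Qed.

(** The value at the empty set is Gaussian of variance 0. *)
Lemma grm_set0 : {ae P, forall w, mu set0 w = 0}.
Proof.
have := grm_rtheta (@finite_theta0 R); rewrite /centered_gaussian rtheta0 eqxx.
move=> /(_ (~` [set 0])) H.
exists (mu set0 @^-1` (~` [set 0])); split => //.
- by rewrite -[X in measurable X]setTI; apply: measurable_funP => //; exact: measurableC.
- by have := H (measurableC (measurable_set1 0)); rewrite /distribution /pushforward/= => ->; rewrite diracE memNset//= => /(_ erefl).
Qed.

Section finite_family.
Variables (I : finType) (A : I -> set (R * R)).
Hypotheses (fA : forall i, finite_theta (A i)) (tA : trivIset setT A).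

(** The axioms of a random measure are stated for sequences of sets: a finite
    family is numbered and continued by empty sets. *)
Definition family_seq (n : nat) : set (R * R) :=
  oapp (fun k : 'I_#|I| => A (enum_val k)) set0 (insub n).

Lemma family_seq_rank i : family_seq (enum_rank i) = A i.
Proof. by rewrite /family_seq valK /= enum_rankK. Qed.

Lemma finite_theta_family_seq n : finite_theta (family_seq n).
Proof. by rewrite /family_seq; case: insub => [k|] //=; exact: finite_theta0. Qed.

Lemma trivIset_family_seq : trivIset setT family_seq.
Proof.
move=> m n _ _ [p]; rewrite /family_seq.
case: insubP => [k _ <-|_ []//]; case: insubP => [l _ <-|_ []//] /= [Ak Al].
by congr val; apply: enum_val_inj; apply: tA => //; exists p.
Qed.

Lemma family_seq_out n : (#|I| <= n)%N -> family_seq n = set0.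
Proof. by move=> In; rewrite /family_seq insubN// -leqNgt. Qed.

Lemma sum_family_seq (f : set (R * R) -> R) :
  \sum_(0 <= k < #|I|) f (family_seq k) = \sum_i f (A i).
Proof.
rewrite big_mkord (reindex_onto (@enum_rank I) enum_val) => [|k _]; last first.
  by rewrite enum_valK.
apply: eq_big => [i|i _]; first by rewrite enum_rankK eqxx.
by rewrite family_seq_rank.
Qed.

Lemma bigcup_family_seq : \bigcup_n family_seq n = \big[setU/set0]_i A i.
Proof.
rewrite -bigcup_seq; apply/seteqP; split => p.
  move=> [n _]; rewrite /family_seq; case: insub => [k|//] /= Ap.
  by exists (enum_val k) => //=; rewrite mem_index_enum.
by move=> [i _ Ap]; exists (enum_rank i) => //; rewrite family_seq_rank.
Qed.

Lemma grm_sumT : {ae P, forall w, mu (\big[setU/set0]_i A i) w = \sum_i mu (A i) w}.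
Proof.
have := grm_additive mu_grm finite_theta_family_seq trivIset_family_seq.
rewrite bigcup_family_seq => /(_ (finite_theta_bigsetU _ _ fA)) H.
apply: filterS2 H grm_set0 => w cv w0.
apply: (cvg_unique _ cv) => //.
apply: cvg_near_cst; near=> n.
have In : (#|I| <= n)%N by near: n; exact: nbhs_infty_ge.
rewrite (big_cat_nat (leq0n _) In)//= (sum_family_seq (fun B => mu B w)) [X in _ + X]big_nat [X in _ + X]big1 ?addr0// => k /andP[Ik _].
by rewrite family_seq_out.
Unshelve. all: by end_near. Qed.

Definition others (i : I) : {fset nat} :=
  [fset k in [seq nat_of_ord (enum_rank j) | j <- enum I & j != i]]%fset.

Lemma rank_in_others i j : j != i -> nat_of_ord (enum_rank j) \in others i.
Proof.
move=> ji; rewrite in_fset /=; apply/mapP; exists j => //.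
by rewrite mem_filter ji mem_enum.
Qed.

Lemma rank_notin_others i : nat_of_ord (enum_rank i) \notin others i.
Proof.
rewrite in_fset /=; apply/mapP => -[j]; rewrite mem_filter => /andP[/eqP ji _].
by move=> /val_inj/enum_rank_inj/esym.
Qed.

Lemma family_independent i B0 (B : nat -> set R) : measurable B0 ->
  (forall n, measurable (B n)) ->
  (P (mu (A i) @^-1` B0 `&` \bigcap_(n in [set` others i]) (mu (family_seq n) @^-1` B n)) =
   P (mu (A i) @^-1` B0) * P (\bigcap_(n in [set` others i]) (mu (family_seq n) @^-1` B n)))%E.
Proof.
move=> mB0 mB; rewrite -family_seq_rank.
apply: (independent_seq_split (X := fun n => mu (family_seq n))) => //.
- exact: (grm_independent mu_grm finite_theta_family_seq trivIset_family_seq).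
- exact: rank_notin_others.
Qed.

Notation field_of i := (sigma_field (fun n => mu (family_seq n)) (others i)).

Lemma measurable_family i j : j != i ->
  measurable_fun [set: field_of i] (mu (A j) : field_of i -> R).
Proof.
move=> ji; rewrite -(family_seq_rank j).
exact: (measurable_coordinate (W := fun n => mu (family_seq n)) (rank_in_others ji)).
Qed.

End finite_family.

Lemma grm_sum (I : finType) (Q : pred I) (A : I -> set (R * R)) :
  (forall i, finite_theta (A i)) -> trivIset setT A ->
  {ae P, forall w, mu (\big[setU/set0]_(i | Q i) A i) w = \sum_(i | Q i) mu (A i) w}.
Proof.
move=> fA tA; pose A' i := if Q i then A i else set0.
have fA' i : finite_theta (A' i) by rewrite /A'; case: ifP => // _; exact: finite_theta0.
have tA' : trivIset setT A'.
  by apply/trivIsetP => i j _ _ ij; rewrite /A'; case: ifP; case: ifP => // _ _;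
     rewrite ?set0I ?setI0//; move/trivIsetP: tA; apply.
apply: filterS2 (grm_sumT fA' tA') grm_set0 => w H w0.
rewrite [in LHS]big_mkcond/= -/A' [LHS]H [RHS]big_mkcond; apply: eq_bigr => i _.
by rewrite /A'; case: ifP.
Qed.

End random_measure.

(** * Gaussian integration by parts for the random measure *)

Section atoms.
Context {R : realType} (K : finType) (D : K -> set (R * R)).
Hypothesis fD : forall k, finite_theta (D k).

(** The atom of type [S] is the set of points that belong to exactly the sets
    [D k] with k in [S]. The atom of the empty type would be the complement of
    all the [D k]; it is made empty, so that all atoms have finite measure. *)
Definition atom (S : {set K}) : set (R * R) :=
  [set p | S != finset.set0 /\ forall k, D k p <-> k \in S].

Lemma atom_sub (S : {set K}) k : k \in S -> atom S `<=` D k.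
Proof. by move=> kS p [_ /(_ k)]/iffRL; exact. Qed.

Lemma measurable_atom S : measurable (atom S).
Proof.
have [->|SN0] := eqVneq S finset.set0.
  by rewrite (_ : atom _ = set0)//; apply/seteqP; split => // p [/eqP].
have -> : atom S = \big[setI/setT]_(k : K) (if k \in S then D k else ~` D k).
  rewrite -bigcap_seq; apply/seteqP; split => p.
    by move=> [_ H] k _; case: ifPn => [/H//|kS /H]; rewrite (negbTE kS).
  move=> H; split => // k; have := H k; rewrite /= mem_index_enum => /(_ isT).
  by case: ifP.
apply: bigsetI_measurable => k _; have [mDk _ _] := fD k.
by case: ifP => // _; exact: measurableC.
Qed.

Lemma finite_theta_atom S : finite_theta (atom S).
Proof.
have [->|/finset.set0Pn[k kS]] := eqVneq S finset.set0.
  rewrite (_ : atom _ = set0); first exact: finite_theta0.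
  by apply/seteqP; split => // p [/eqP].
by apply: (finite_theta_sub (fD k)); [exact: measurable_atom|exact: atom_sub].
Qed.

Lemma trivIset_atom : trivIset setT atom.
Proof.
move=> S S' _ _ [p [[_ H] [_ H']]]; apply/setP => k.
by apply/idP/idP => [/H/H'|/H'/H].
Qed.

Lemma bigsetU_atom (Q : pred {set K}) p :
  (\big[setU/set0]_(S | Q S) atom S) p <->
  exists2 S, Q S & atom S p.
Proof.
rewrite -big_filter -bigcup_seq; split.
  by move=> [S /=]; rewrite mem_filter => /andP[QS _] Sp; exists S.
by move=> [S QS Sp]; exists S => //=; rewrite mem_filter QS mem_index_enum.
Qed.

Definition type_of (p : R * R) : {set K} := [set k | `[< D k p >]]%SET.

Lemma atom_type_of p k : D k p -> atom (type_of p) p.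
Proof.
move=> Dkp; split.
  by apply/finset.set0Pn; exists k; rewrite inE; exact/asboolP.
by move=> l; rewrite inE; split => [|/asboolP//] ?; exact/asboolP.
Qed.

(** Every [D k], and every intersection of two of them, is a disjoint union of
    atoms: sums over atoms compute all covariances. *)
Lemma bigsetU_atomI k l :
  \big[setU/set0]_(S : {set K} | (k \in S) && (l \in S)) atom S = D k `&` D l.
Proof.
apply/seteqP; split => p.
  by move/bigsetU_atom => [S /andP[kS lS] Sp]; split; exact: atom_sub Sp.
move=> [Dk Dl]; apply/bigsetU_atom; exists (type_of p); last exact: atom_type_of Dk.
by rewrite !inE; apply/andP; split; exact/asboolP.
Qed.

Lemma bigsetU_atomE k : \big[setU/set0]_(S : {set K} | k \in S) atom S = D k.
Proof.
by rewrite -[RHS]setIid -bigsetU_atomI; apply: eq_bigl => S; rewrite andbb.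
Qed.

Lemma rtheta_atoms k l :
  rtheta (D k `&` D l) = \sum_(S : {set K} | (k \in S) && (l \in S)) rtheta (atom S).
Proof.
rewrite -bigsetU_atomI rtheta_bigsetU//; first exact: finite_theta_atom.
exact: trivIset_atom.
Qed.

End atoms.

Section softmax_measurable.
Context {R : realType} {d : measure_display} {T : measurableType d} {n : nat}.
Variable H : T -> 'I_n -> R.
Hypothesis mH : forall j, measurable_fun setT (fun w => H w j).

Lemma measurable_partition_sum : measurable_fun setT (fun w => partition_sum (H w)).
Proof. by apply: measurable_sum => j; exact: measurableT_comp. Qed.

Lemma measurable_softmax i : measurable_fun setT (fun w => softmax (H w) i).
Proof.
have -> : (fun w => softmax (H w) i) =
    (fun w => expR (H w i - ln (partition_sum (H w)))).
  apply/funext => w; rewrite /softmax expRB lnK//.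
  by rewrite posrE (partition_sum_gt0 _ i).
apply: measurableT_comp => //; apply: measurable_funB => //.
by apply: (measurableT_comp (@measurable_ln R)); exact: measurable_partition_sum.
Qed.

End softmax_measurable.

Section grm_ibp.
Context {R : realType} {d : measure_display} {T : measurableType d}
  {P : probability T R}.
Variable mu : set (R * R) -> {RV P >-> R}.
Hypothesis mu_grm : gaussian_random_measure mu.
Variables (n : nat) (C : 'I_n -> set (R * R)) (B : set (R * R)) (beta : R).
Hypotheses (fC : forall j, finite_theta (C j)) (fB : finite_theta B).

Definition mu_gibbs (w : T) (i : 'I_n) : R := softmax (fun j => beta * mu (C j) w) i.

Lemma measurable_mu_gibbs i : measurable_fun setT (mu_gibbs ^~ i).
Proof. by apply: measurable_softmax => j; exact: measurable_funM. Qed.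

Lemma integrable_mu_gibbs i : P.-integrable setT (EFin \o (mu_gibbs ^~ i)).
Proof.
apply: (@integ_bounded _ _ _ P _ 1); first exact: measurable_mu_gibbs.
by move=> w; exact: norm_softmax_le1.
Qed.

Lemma integrable_mu_gibbs2 i j :
  P.-integrable setT (EFin \o (fun w => mu_gibbs w i * mu_gibbs w j)).
Proof.
apply: (@integ_bMl _ _ _ P _ _ 1); first exact: measurable_mu_gibbs.
  by move=> w; exact: norm_softmax_le1.
exact: integrable_mu_gibbs.
Qed.

(** The atoms of the algebra generated by all the sets [C j] and [B]; the index
    [None] stands for [B]. On distinct atoms [mu] is independent, and almost
    surely the energies are sums over atoms. *)
Let D (k : option 'I_n) := if k is Some j then C j else B.
Let fD k : finite_theta (D k). Proof. by case: k. Qed.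
Let A (S : {set option 'I_n}) := atom D S.
Let fA S : finite_theta (A S). Proof. exact: finite_theta_atom. Qed.
Let tA : trivIset setT A. Proof. exact: trivIset_atom. Qed.

Let energy w (j : 'I_n) := beta * \sum_(S : {set option 'I_n} | Some j \in S) mu (A S) w.

Let measurable_energy j : measurable_fun setT (energy ^~ j).
Proof.
by apply: measurable_funM => //; exact: measurable_sum_cond.
Qed.

Let mu_gibbsE : {ae P, forall w, forall i, mu_gibbs w i = softmax (energy w) i}.
Proof.
have H (j : 'I_n) : {ae P, forall w, mu (C j) w = \sum_(S : {set option 'I_n} | Some j \in S) mu (A S) w}.
  have := grm_sum mu_grm (fun S : {set option 'I_n} => Some j \in S) fA tA.
  by rewrite (bigsetU_atomE D (Some j)).
have : {ae P, forall w, forall j : 'I_n, mu (C j) w = \sum_(S : {set option 'I_n} | Some j \in S) mu (A S) w}.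
  exact: filter_forall.
apply: filterS => w Hw i; rewrite /mu_gibbs; congr (softmax _ i).
by apply/funext => j; rewrite Hw.
Qed.

Section one_atom.
Variables (S : {set option 'I_n}) (i : 'I_n).

Let a (j : 'I_n) : R := beta * (Some j \in S)%:R.
Let b (w : T) (j : 'I_n) : R :=
  beta * \sum_(S' : {set option 'I_n} | (Some j \in S') && (S' != S)) mu (A S') w.

(** The value on one atom enters affinely; the rest, [b], is a function of the
    other atoms only. *)
Let energy_split w j : energy w j = a j * mu (A S) w + b w j.
Proof.
rewrite /energy /a /b; case: (boolP (Some j \in S)) => jS.
  by rewrite (bigD1 S)//= mulr1 mulrDr.
rewrite mulr0 mul0r add0r; congr (_ * _); apply: eq_bigl => S'.
by case: eqP => [->|_]; rewrite ?andbT// (negbTE jS).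
Qed.

Notation W := (fun k => mu (family_seq A k)).
Notation SF := (sigma_field W (others S)).

Let measurable_b j : measurable_fun [set: SF] (b ^~ j : SF -> R).
Proof.
apply: measurable_funM => //; apply: measurable_sum_cond => S' /andP[_ S'S].
exact: (@measurable_family _ _ _ _ mu _ A S S' S'S).
Qed.

(** Integration by parts for a single atom, with the other atoms frozen. *)
Lemma atom_ibp :
  (\int[P]_w (mu (A S) w * softmax (energy w) i) =
   rtheta (A S) * beta * ((Some i \in S)%:R * \int[P]_w softmax (energy w) i -
     \sum_j (Some j \in S)%:R * \int[P]_w (softmax (energy w) i * softmax (energy w) j)))%R.
Proof.
pose H x w := softmax (fun j => a j * x + b w j) i.
pose dH x w := softmax_slope a (b w) i x.
have mcoord j : measurable_fun [set: measurableTypeR R * SF]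
    (fun p : measurableTypeR R * SF => a j * p.1 + b p.2 j).
  apply: measurable_funD; first by apply: measurable_funM => //; exact: measurable_fst.
  exact: (measurableT_comp (measurable_b j) (@measurable_snd _ _ (measurableTypeR R) SF)).
have msoft j : measurable_fun [set: measurableTypeR R * SF]
    (fun p : measurableTypeR R * SF => softmax (fun j => a j * p.1 + b p.2 j) j).
  exact: measurable_softmax.
have HE w j : softmax (fun j => a j * mu (A S) w + b w j) j = softmax (energy w) j.
  by congr (softmax _ j); apply/funext => k; rewrite energy_split.
have a_le j : `|a j| <= `|beta|.
  by rewrite /a normrM ler_piMr// normr_nat; case: (_ \in _).
have mdH : measurable_fun setT (fun p : measurableTypeR R * SF => dH p.1 p.2).
  rewrite /dH /softmax_slope; apply: measurable_funM => //.
  apply: measurable_funB => //; apply: measurable_sum_cond => j _.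
  exact: measurable_funM.
have := @indep_ibp _ _ _ P (mu (A S)) W (others S)
  (family_independent mu_grm fA tA S) (rtheta (A S)) H dH (`|beta| + `|beta|)
  (rtheta_ge0 _) (grm_rtheta mu_grm (fA S)) (msoft i) mdH
  (fun w x => is_derive_softmax a (b w) i x)
  (fun w => @continuous_softmax_slope _ _ a (b w) i)
  (fun x w => norm_softmax_le1 _ i) (fun x w => norm_softmax_slope_le _ _ _ a_le).
under eq_Rintegral do rewrite /H HE.
move=> ->; rewrite -mulrA; congr (_ * _).
pose q w j := softmax (energy w) j.
have mq j : measurable_fun setT (q ^~ j) by exact: measurable_softmax.
have iq j : P.-integrable setT (EFin \o (q ^~ j)).
  by apply: (@integ_bounded _ _ _ P _ 1) => // w; exact: norm_softmax_le1.
have iqq j : P.-integrable setT (EFin \o (fun w => q w i * q w j)).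
  apply: (@integ_bMl _ _ _ P _ _ 1) => //.
  by move=> w; exact: norm_softmax_le1.
transitivity (\int[P]_w (beta * ((Some i \in S)%:R * q w i -
    \sum_j (Some j \in S)%:R * (q w i * q w j))))%R.
  apply: eq_Rintegral => w _.
  rewrite /dH /softmax_slope HE -/(q w i) /a.
  under eq_bigr do rewrite HE -/(q w _).
  rewrite !mulrBr !mulr_sumr; congr (_ - _); first by ring.
  by apply: eq_bigr => j _; ring.
have isum : P.-integrable setT
    (EFin \o (fun w => \sum_j (Some j \in S)%:R * (q w i * q w j))).
  by apply: integ_sum => j _; exact: integZ.
rewrite RintegralZl//; last by apply: integB => //; exact: integZ.
rewrite RintegralB//; last exact: integZ.
rewrite RintegralZl// Rint_sum => [|j _]; last exact: integZ.
by congr (_ * (_ - _)); apply: eq_bigr => j _; rewrite RintegralZl.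
Qed.

End one_atom.

(** By linearity: [mu B] is the sum over the atoms inside [B], and summing the
    theta-measures of those that are also inside [C j] gives that of
    the intersection of [B] and [C j]. *)
Lemma grm_ibp i :
  (\int[P]_w (mu B w * mu_gibbs w i) =
   beta * (rtheta (B `&` C i) * \int[P]_w mu_gibbs w i -
     \sum_j rtheta (B `&` C j) * \int[P]_w (mu_gibbs w i * mu_gibbs w j)))%R.
Proof.
pose q w j := softmax (energy w) j.
have mq j : measurable_fun setT (q ^~ j) by exact: measurable_softmax.
have qE : {ae P, forall w, forall j, mu_gibbs w j = q w j} := mu_gibbsE.
have BE : {ae P, forall w, mu B w = \sum_(S : {set option 'I_n} | None \in S) mu (A S) w}.
  have := grm_sum mu_grm (fun S : {set option 'I_n} => None \in S) fA tA.
  by rewrite (bigsetU_atomE D None).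
have -> : (\int[P]_w mu_gibbs w i = \int[P]_w q w i)%R.
  apply: ae_eq_Rint => //; first exact: measurable_mu_gibbs.
  by apply: filterS qE => w ->.
have q2E j : (\int[P]_w (mu_gibbs w i * mu_gibbs w j) = \int[P]_w (q w i * q w j))%R.
  apply: ae_eq_Rint; try by apply: measurable_funM => //; exact: measurable_mu_gibbs.
  by apply: filterS qE => w H; rewrite !H.
under eq_bigr do rewrite q2E.
have -> : (\int[P]_w (mu B w * mu_gibbs w i) =
    \int[P]_w (\sum_(S : {set option 'I_n} | None \in S) mu (A S) w * q w i))%R.
  apply: ae_eq_Rint.
  - by apply: measurable_funM => //; exact: measurable_mu_gibbs.
  - by apply: measurable_sum_cond => S _; exact: measurable_funM.
  - by apply: filterS2 qE BE => w H ->; rewrite H mulr_suml.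
rewrite Rint_sum => [|S _]; last first.
  apply: (@integ_bMl _ _ _ P _ _ 1) => //; last exact: grm_integrable.
  by move=> w; exact: norm_softmax_le1.
have thE j : rtheta (B `&` C j) =
    \sum_(S : {set option 'I_n} | None \in S) rtheta (A S) * (Some j \in S)%:R.
  rewrite (rtheta_atoms fD None (Some j)) big_mkcondr/=; apply: eq_bigr => S _.
  by case: (_ \in _); rewrite ?mulr1 ?mulr0.
transitivity (\sum_(S : {set option 'I_n} | None \in S) (beta * ((rtheta (A S) * (Some i \in S)%:R) *
   \int[P]_w q w i - \sum_j (rtheta (A S) * (Some j \in S)%:R) *
   \int[P]_w (q w i * q w j))))%R.
  apply: eq_bigr => S _; rewrite [LHS](atom_ibp S i).
  rewrite [rtheta _ * _]mulrC -!mulrA; congr (_ * _); rewrite mulrBr; congr (_ - _).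
  by rewrite mulr_sumr; apply: eq_bigr => j _; rewrite mulrA.
rewrite -mulr_sumr; congr (_ * _); rewrite sumrB thE -mulr_suml; congr (_ - _).
rewrite exchange_big/=; apply: eq_bigr => j _.
by rewrite thE -mulr_suml.
Qed.
End grm_ibp.

(** * Arcs of the circle *)

Section circle.
Context {R : realType}.
Implicit Types (s x y z w : R).

Definition unit_circle : set R := [set s | 0 <= s < 1].

Lemma circle_distC x y : circle_dist x y = circle_dist y x.
Proof. by rewrite /circle_dist distrC. Qed.

Lemma circle_dist_ge0 x y : unit_circle x -> unit_circle y -> 0 <= circle_dist x y.
Proof.
move=> /andP[x0 x1] /andP[y0 y1]; rewrite /circle_dist le_min normr_ge0/= subr_ge0.
by rewrite ler_norml; apply/andP; split; lra.
Qed.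

Lemma circle_dist_triangle x y z : unit_circle x -> unit_circle y -> unit_circle z ->
  circle_dist x z <= circle_dist x y + circle_dist y z.
Proof.
move=> /andP[x0 x1] /andP[y0 y1] /andP[z0 z1].
rewrite /circle_dist !minElt.
by case: (ger0P (x - y)) => ?; case: (ger0P (y - z)) => ?; case: (ger0P (x - z)) => ?;
  do ![case: ifP => ?]; lra.
Qed.

(** For points of [[0, 1[] the difference lies in ]-1, 1[, so only the
    representatives k = -1, 0, 1 can be relevant. *)
Lemma circle_distP s x w : unit_circle s -> unit_circle x -> w < 1 ->
  (exists k : int, - w <= s - x + k%:~R <= w) <-> circle_dist s x <= w.
Proof.
move=> /andP[s0 s1] /andP[x0 x1] w1; rewrite /circle_dist ge_min; split.
  move=> [k /andP[k1 k2]].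
  have kl : (-2%:~R : R) < k%:~R by rewrite -[(2%:~R : R)]/(2 : R); lra.
  have ku : k%:~R < (2%:~R : R) by rewrite -[(2%:~R : R)]/(2 : R); lra.
  rewrite -mulrNz ltr_int in kl; rewrite ltr_int in ku.
  have : [|| k == -1, k == 0 | k == 1] by lia.
  move=> /or3P[] /eqP ke; rewrite ke ?mulrN1z ?mulr1z ?mulr0z in k1 k2.
  - apply/orP; right.
    have : `|s - x| = s - x by rewrite ger0_norm; lra.
    by move=> ->; lra.
  - by apply/orP; left; rewrite ler_norml; apply/andP; split; lra.
  - apply/orP; right.
    have : `|s - x| = - (s - x) by rewrite ler0_norm; lra.
    by move=> ->; lra.
move=> /orP[|].
  by rewrite ler_norml => /andP[? ?]; exists 0; rewrite mulr0z; apply/andP; split; lra.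
case: (ger0P (s - x)) => sx ?.
  by exists (-1); rewrite mulrN1z; apply/andP; split; lra.
by exists 1; rewrite mulr1z; apply/andP; split; lra.
Qed.

Definition arc x w : set R := [set s | 0 <= s < 1 /\ circle_dist s x <= w].

(** Either the arc is an interval, or it crosses the point 0 = 1 on the left or
    on the right. Half-widths up to 1/4 are those of the cones. *)
Lemma arc_cases x w : unit_circle x -> 0 <= w <= 4^-1 ->
  [\/ arc x w = `[x - w, x + w]%classic,
      x < w /\ arc x w = `[0, x + w]%classic `|` `[1 + x - w, 1[%classic |
      1 <= x + w /\ arc x w = `[0, x + w - 1]%classic `|` `[x - w, 1[%classic].
Proof.
move=> /andP[x0 x1] /andP[w0 w1].
have D s : (circle_dist s x <= w) = [|| - w <= s - x <= w, s - x <= w - 1 | 1 - w <= s - x].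
  rewrite /circle_dist ge_min ler_norml; congr (_ || _).
  case: (ger0P (s - x)) => ?.
    by apply/idP/orP => [?|[?|?]]; [right| |]; lra.
  by apply/idP/orP => [?|[?|?]]; [left| |]; lra.
have [xw|xw] := ltP x w; last have [xw1|xw1] := ltP (x + w) 1.
- constructor 2; split => //; apply/seteqP; split => s; rewrite /arc/= D !in_itv/=.
    move=> [/andP[s0 s1] /or3P[/andP[]||]] *; [left|lra|right]; lra.
  by case=> /andP[? ?]; split; lra.
- constructor 1; apply/seteqP; split => s; rewrite /arc/= D !in_itv/=.
    move=> [/andP[s0 s1] /or3P[/andP[]||]] *; lra.
  by case/andP=> ? ?; split; lra.
- constructor 3; split => //; apply/seteqP; split => s; rewrite /arc/= D !in_itv/=.
    move=> [/andP[s0 s1] /or3P[/andP[]||]] *; [right|left|lra]; lra.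
  by case=> /andP[? ?]; split; lra.
Qed.

Lemma lebesgue_itv_setU (a b c e : R) : a <= b -> b < c -> c <= e ->
  lebesgue_measure (`[a, b]%classic `|` `[c, e[%classic : set R) = ((b - a) + (e - c))%:E.
Proof.
move=> ab bc ce; rewrite measureU//; last first.
  apply/seteqP; split => // s; rewrite /= !in_itv/= => -[/andP[_ sb] /andP[cs _]].
  lra.
rewrite /= !lebesgue_measure_itv/= !lte_fin.
case: ltP => [_|ba]; case: ltP => [_|ec]; rewrite ?adde0 ?add0e -?EFinB -?EFinD//;
  congr EFin; lra.
Qed.

Lemma arc_measure x w : unit_circle x -> 0 <= w <= 4^-1 ->
  measurable (arc x w : set (measurableTypeR R)) /\
  lebesgue_measure (arc x w) = (2 * w)%:E.
Proof.
move=> xc w01; have /andP[x0 x1] := xc; have /andP[w0 w1] := w01.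
case: (arc_cases xc w01) => [->|[xw ->]|[xw ->]].
- split; first exact: measurable_itv.
  rewrite lebesgue_measure_itv/= lte_fin; case: ltP => h.
    by rewrite -EFinB; congr EFin; lra.
  by congr EFin; lra.
- split; first by apply: measurableU; exact: measurable_itv.
  by rewrite lebesgue_itv_setU; [congr EFin|..]; lra.
- split; first by apply: measurableU; exact: measurable_itv.
  by rewrite lebesgue_itv_setU; [congr EFin|..]; lra.
Qed.

End circle.

(** * The measures of cones and bands *)

Section theta_values.
Context {R : realType}.
Implicit Types (A : set (R * R)) (x y u lo hi : R).
Notation leb := (@lebesgue_measure R).
Notation R1 := (measurableTypeR R).

Lemma integral_inv lo hi : 0 < lo -> lo <= hi ->
  (\int[leb]_(y in `[lo, hi[) (y^-1)%:E = (ln hi - ln lo)%:E)%E.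
Proof.
move=> lo0; rewrite le_eqVlt => /predU1P[<-|lohi].
  by rewrite subrr set_itvco0 integral_set0.
have cinv : {within `[lo, hi], continuous (fun y : R => y^-1)}.
  apply: continuous_in_subspaceT => y /set_mem/=; rewrite in_itv/= => /andP[ly _].
  by apply: inv_continuous; rewrite gt_eqF// (lt_le_trans lo0).
have iinv : leb.-integrable `[lo, hi] (EFin \o (fun y : R => y^-1)).
  by apply: continuous_compact_integrable => //; exact: segment_compact.
rewrite integral_itv_bndo_bndc; last first.
  have := measurable_int _ iinv; apply: measurable_funS => //.
  by move=> y/=; rewrite !in_itv/= => /andP[->/ltW].
have dln y : lo <= y -> is_derive y 1 (@ln R) y^-1.
  by move=> loy; apply: is_derive1_ln; exact: lt_le_trans loy.
have cln y : lo <= y -> {for y, continuous (@ln R)}.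
  by move=> loy; apply: continuous_ln; exact: lt_le_trans loy.
rewrite (continuous_FTC2 lohi cinv (F := @ln R))//.
- split.
  + move=> y; rewrite in_itv/= => /andP[loy _].
    by have := dln y (ltW loy); case.
  + exact/cvg_at_right_filter/cln.
  + exact/cvg_at_left_filter/cln/ltW.
- move=> y; rewrite in_itv/= => /andP[loy _]; rewrite derive1E.
  by have ? := dln y (ltW loy); rewrite derive_val.
Qed.

Lemma integral_invsq (a : R) : 0 < a ->
  (\int[leb]_(y in `[a, +oo[) (expR (- 2 * ln y))%:E = (a^-1)%:E)%E.
Proof.
move=> a0.
have dF y : a <= y -> is_derive y 1 (fun z : R => - z^-1) (expR (- 2 * ln y)).
  move=> ay; have y0 : 0 < y by exact: lt_le_trans ay.
  have yN0 : y != 0 by rewrite gt_eqF.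
  have dV := @is_deriveV R id y 1 1 yN0 (is_derive_id _ _).
  have dNV := is_deriveN dV.
  apply: (is_derive_eq dNV); rewrite intensityE// /GRing.scale/=.
  by rewrite mulr1 opprK.
have cF y : a <= y -> {for y, continuous (fun z : R => - z^-1)}.
  by move=> ay; exact: is_derive_continuous (dF y ay).
rewrite (@ge0_continuous_FTC2y _ _ (fun z : R => - z^-1) a 0).
- by rewrite sub0e -EFinN opprK.
- by move=> y _; exact: expR_ge0.
- apply: continuous_in_subspaceT => y /set_mem/=; rewrite in_itv/= andbT => ay.
  apply: continuous_comp; last exact: continuous_expR.
  apply: cvgM; first exact: cvg_cst.
  by apply: continuous_ln; exact: lt_le_trans ay.
- rewrite -[X in _ --> X]oppr0; apply: cvgN; apply/gtr0_cvgV0; last exact: cvg_id.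
  exact: nbhs_pinfty_gt.
- by move=> y ay; have := dF y (ltW ay); case.
- exact/cvg_at_right_filter/cF.
- move=> y; rewrite in_itv/= andbT => ay; rewrite derive1E.
  by have ? := dF y (ltW ay); rewrite derive_val.
Unshelve. all: by end_near. Qed.

(** Integrating at fixed height first. *)
Lemma theta_sections A : measurable A -> A `<=` half_cylinder ->
  theta A = (\int[leb]_y ((expR (- 2 * ln y))%:E * leb (ysection (A : set (R1 * R1)) y)))%E.
Proof.
move=> mA AH; rewrite thetaE// integral_mkcond.
rewrite fubini_tonelli2; last 2 first.
- by apply/(measurable_restrict _ _ _).1 => //; apply: measurable_funTS; exact: measurable_intensity.
- by move=> p; apply: erestrict_ge0 => *; exact: intensity_ge0.
apply: eq_integral => y _; rewrite /fubini_G.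
transitivity (\int[leb]_x ((expR (- 2 * ln y))%:E * (\1_(ysection (A : set (R1 * R1)) y) x)%:E))%E.
  apply: eq_integral => x _; rewrite patchE indicE mem_ysection.
  by case: ifP => _; rewrite ?mule1 ?mule0.
rewrite ge0_integralZl//.
- by rewrite integral_indic ?setIT//; exact: measurable_ysection.
- apply/measurable_EFinP/measurable_indic; exact: measurable_ysection.
Qed.


Lemma cone_width_itv y : 0 < y -> 0 <= cone_width y / 2 <= 4^-1.
Proof.
by rewrite /cone_width => y0; case: ifPn => [?|_]; apply/andP; split; lra.
Qed.

Lemma coneP u x p : unit_circle x -> cone u x p <->
  [/\ 0 < p.2, u <= p.2 & arc x (cone_width p.2 / 2) p.1].
Proof.
move=> xc; split.
  move=> [[p1 p2] [up H]]; split => //; split => //.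
  by apply/(circle_distP _ _ _) => //; have := cone_width_itv p2; lra.
move=> [p2 up [p1 H]]; split => //; split => //.
by apply/(circle_distP _ _ _) => //; have := cone_width_itv p2; lra.
Qed.

Lemma cone_half_cylinder u x : cone u x `<=` half_cylinder.
Proof. by move=> p []. Qed.

Let measurable_height : measurable_fun [set: R * R] (fun p : R * R => p.2).
Proof. exact: measurable_snd. Qed.

Let measurable_circle_dist x :
  measurable_fun [set: R * R] (fun p : R * R => circle_dist p.1 x).
Proof.
have m : measurable_fun [set: R * R] (fun p : R * R => `|p.1 - x|).
  by apply: measurableT_comp => //; apply: measurable_funB => //; exact: measurable_fst.
by apply: measurable_minr => //; apply: measurable_funB.
Qed.

Let measurable_cone_width :
  measurable_fun [set: R * R] (fun p : R * R => cone_width p.2 / 2).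
Proof.
apply: measurable_funM => //; rewrite /cone_width.
by apply: measurable_fun_ifT => //; exact: measurable_fun_ltr.
Qed.

Lemma measurable_cone u x : unit_circle x -> measurable (cone u x).
Proof.
move=> xc.
have -> : cone u x = half_cylinder `&`
    ([set p | u <= p.2] `&` [set p | circle_dist p.1 x <= cone_width p.2 / 2]).
  apply/seteqP; split => p.
    by move=> H; have [p2 up [p1 Hp]] := (coneP u p xc).1 H.
  by move=> [[p1 p2] [up Hp]]; apply/coneP.
apply: measurableI; first exact: measurable_half_cylinder.
apply: measurableI.
  rewrite -[X in measurable X]setTI.
  exact: (measurable_fun_ler (@measurable_cst _ _ _ _ _ u) measurable_height).
rewrite -[X in measurable X]setTI.
exact: (measurable_fun_ler (measurable_circle_dist x) measurable_cone_width).
Qed.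

Definition band lo hi x : set (R * R) := cone lo x `&` [set p | p.2 < hi].

Lemma band_cone lo hi x : band lo hi x `<=` cone lo x.
Proof. exact: subIsetl. Qed.

Lemma measurable_band lo hi x : unit_circle x -> measurable (band lo hi x).
Proof.
move=> xc; apply: measurableI; first exact: measurable_cone.
rewrite -[X in measurable X]setTI.
exact: (measurable_fun_ltr measurable_height (@measurable_cst _ _ _ _ _ hi)).
Qed.

Let arc_section lo x y (Q : set (R * R)) : unit_circle x -> 0 < y -> lo <= y ->
  ysection (cone lo x `&` Q : set (R1 * R1)) y =
  arc x (cone_width y / 2) `&` [set z | Q (z, y)].
Proof.
move=> xc y0 loy; apply/seteqP; split => z.
  by move/ysectionP => -[/(coneP lo (z, y) xc)[_ _ zy] Qzy].
by move=> [zy Qzy]; apply/ysectionP; split => //; apply/coneP.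
Qed.

Let arc_section_out lo x y (Q : set (R * R)) : unit_circle x -> y < lo ->
  ysection (cone lo x `&` Q : set (R1 * R1)) y = set0.
Proof.
move=> xc loy; apply/seteqP; split => z //.
by move/ysectionP => -[/(coneP lo (z, y) xc)[/= _ ? _] _]; lra.
Qed.

(** Below height 1/2 the section at height y is an arc of length y, so the
    measure is the integral of 1/y. *)
Lemma theta_band lo hi x : unit_circle x -> 0 < lo -> lo <= hi -> hi <= 2^-1 ->
  theta (band lo hi x) = (ln hi - ln lo)%:E.
Proof.
move=> xc lo0 lohi hi2; rewrite theta_sections; last 2 first.
- exact: measurable_band.
- exact: subset_trans (@band_cone _ _ _) (@cone_half_cylinder _ _).
rewrite -integral_inv// [RHS]integral_mkcond; apply: eq_integral => y _.
rewrite patchE; case: ifPn => [/set_mem|]; last first.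
  move=> /negP ylohi.
  rewrite (_ : ysection _ _ = set0) ?measure0 ?mule0//.
  apply/seteqP; split => z //.
  move/ysectionP => -[/(coneP lo (z, y) xc)[/= _ ? _] /= ?]; apply: ylohi.
  by apply/mem_set; rewrite /= in_itv/=; apply/andP.
rewrite /= in_itv/= => /andP[loy yhi]; have y0 := lt_le_trans lo0 loy.
rewrite arc_section// (_ : _ `&` _ = arc x (cone_width y / 2)); last first.
  by apply/seteqP; split => z; [case|split].
rewrite (arc_measure xc (cone_width_itv y0)).2 -EFinM intensityE//; congr EFin.
rewrite /cone_width (lt_le_trans yhi)//.
have yN0 : y != 0 by rewrite gt_eqF.
by field.
Qed.

Let measurable_density :
  measurable_fun [set: R1] (fun y : R1 => (expR (- 2 * ln y))%:E).
Proof.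
apply/measurable_EFinP/measurableT_comp => //.
by apply: measurable_funM => //; exact: measurable_ln.
Qed.

(** A uniform bound on the sections leaves the integral of y ^ (-2) from [u]
    on, which is 1/u. *)
Lemma theta_cone_le_section u x (Q : set (R * R)) (c : R) :
  unit_circle x -> 0 < u -> 0 <= c -> measurable (cone u x `&` Q) ->
  (forall y, u <= y ->
    (leb (arc x (cone_width y / 2) `&` [set z | Q (z, y)]) <= c%:E)%E) ->
  (theta (cone u x `&` Q) <= (c / u)%:E)%E.
Proof.
move=> xc u0 c0 mA H; rewrite theta_sections//; last first.
  by apply: subset_trans (@cone_half_cylinder u x); exact: subIsetl.
rewrite EFinM -(integral_invsq u0) -integralZl//; last first.
  apply/integrableP; split.
    exact: measurable_funTS measurable_density.
  under eq_integral do rewrite /= ger0_norm ?expR_ge0//.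
  by rewrite integral_invsq// ltry.
rewrite [leRHS]integral_mkcond; apply: ge0_le_integral => //.
- by move=> y _; rewrite mule_ge0// lee_fin expR_ge0.
- by apply: emeasurable_funM => //; exact: measurable_fun_ysection.
- apply/(measurable_restrict _ _ _).1 => //; apply: emeasurable_funM => //.
  exact: measurable_funTS measurable_density.
move=> y _; rewrite patchE; case: ifPn => [/set_mem|/negP].
  rewrite /= in_itv/= andbT => uy; rewrite arc_section// ?(lt_le_trans u0)//.
  by rewrite muleC; apply: lee_wpmul2r; rewrite ?lee_fin ?expR_ge0//; exact: H.
move=> yu; have {}yu : y < u.
  rewrite ltNge; apply/negP => uy; apply: yu.
  by apply/mem_set; rewrite /= in_itv/= andbT.
by rewrite arc_section_out// measure0 mule0.
Qed.

Lemma theta_cone_half_le x : unit_circle x -> (theta (cone 2^-1 x) <= 1%:E)%E.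
Proof.
move=> xc; rewrite -[cone _ _]setIT.
have -> : 1%:E = (2^-1 / 2^-1)%:E :> \bar R by rewrite divff.
apply: theta_cone_le_section => //.
- by rewrite setIT; exact: measurable_cone.
- move=> y y2; have y0 : 0 < y by lra.
  rewrite setIT (arc_measure xc (cone_width_itv y0)).2 lee_fin.
  by have := cone_width_itv y0; lra.
Qed.

Lemma finite_theta_cone u x : unit_circle x -> 0 < u -> u <= 2^-1 ->
  finite_theta (cone u x) /\ rtheta (cone u x) <= 1 - ln u.
Proof.
move=> xc u0 u2.
have cE : cone u x = band u 2^-1 x `|` cone 2^-1 x.
  apply/seteqP; split => p.
    move=> H; have [p2 up pa] := (coneP u p xc).1 H.
    by have [h|h] := ltP p.2 2^-1; [left|right; apply/coneP].
  by move=> [[]//|/(coneP 2^-1 p xc)[? ? ?]]; apply/coneP => //; split => //; lra.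
have fb : finite_theta (band u 2^-1 x).
  split; first exact: measurable_band.
    exact: subset_trans (@band_cone _ _ _) (@cone_half_cylinder _ _).
  by rewrite theta_band// ltry.
have fc : finite_theta (cone 2^-1 x).
  split; [exact: measurable_cone|exact: cone_half_cylinder|].
  exact: le_lt_trans (theta_cone_half_le xc) (ltry _).
rewrite cE; split; first exact: finite_thetaU.
rewrite rtheta_setU//.
  have : rtheta (cone 2^-1 x) <= 1.
    by have := theta_cone_half_le xc; rewrite -lee_fin /rtheta fineK// finite_theta_fin.
  have : ln (2^-1) <= 0 :> R by rewrite ln_le0// invf_le1// ler1n.
  have -> : rtheta (band u 2^-1 x) = ln 2^-1 - ln u by rewrite /rtheta theta_band.
  lra.
apply/seteqP; split => // p [[_ /= p2] /(coneP 2^-1 p xc)[_ ? _]]; lra.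
Qed.

(** At each height the points within w of x but not of y are within the
    annulus w - r < distance <= w around x, where r is the distance of x and y;
    its length is 2 r. Above u >= r this integrates to at most 2. *)
Lemma rtheta_cone_diff_le u x y : unit_circle x -> unit_circle y -> 0 < u -> u <= 2^-1 ->
  circle_dist x y <= u -> rtheta (cone u x `\` cone u y) <= 2.
Proof.
move=> xc yc u0 u2 xyu.
have [fx _] := finite_theta_cone xc u0 u2; have [fy _] := finite_theta_cone yc u0 u2.
have fxy := finite_thetaD fx fy.
rewrite -lee_fin /rtheta fineK ?finite_theta_fin//.
pose r := circle_dist x y; have r0 : 0 <= r by exact: circle_dist_ge0.
apply: (@le_trans _ _ (2 * r / u)%:E); last first.
  by rewrite lee_fin ler_pdivrMr// ler_pM2l.
apply: theta_cone_le_section => //; first by rewrite mulr_ge0.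
  by case: fxy.
move=> v uv; have v0 : 0 < v by exact: lt_le_trans uv.
set w := cone_width v / 2; have w01 := cone_width_itv v0.
have mw := arc_measure xc w01.
set S := _ `&` _.
have SE z : S z -> arc x w z /\ w - r < circle_dist z x.
  move=> [[z1 zx] Hz]; split => //; rewrite ltNge; apply/negP => zr; apply: Hz.
  apply/coneP => //; split => //; split => //=.
  have := circle_dist_triangle z1 xc yc; rewrite -/r -/w; lra.
have mS : measurable (S : set R1).
  rewrite /S -(@arc_section u x v (~` cone u y))//.
  by apply: measurable_ysection; case: fxy.
have [rw|wr] := leP r w; last first.
  apply: (@le_trans _ _ (leb (arc x w))).
    by apply: le_measure; rewrite ?inE//; [exact: mw.1|exact: subIsetl].
  by rewrite mw.2 lee_fin ler_pM2l// ltW.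
have w'01 : 0 <= w - r <= 4^-1 by move: w01; rewrite -/w => /andP[? ?]; apply/andP; split; lra.
have mw' := arc_measure xc w'01.
apply: (@le_trans _ _ (leb (arc x w `\` arc x (w - r)))).
  apply: le_measure; rewrite ?inE//; first by apply: measurableD; [exact: mw.1|exact: mw'.1].
  by move=> z /SE[za zr]; split => // -[_]; lra.
rewrite measureD//; [|exact: mw.1|exact: mw'.1|by rewrite /= mw.2 ltry].
rewrite setIidr; last by move=> z [z1 zw]; split => //; lra.
by rewrite /= mw.2 mw'.2 -EFinB lee_fin -/w; lra.
Qed.

(** A common point at height y would be within y/2 of both apexes. *)
Lemma band_cone_disjoint lo hi lo' x y : unit_circle x -> unit_circle y ->
  hi <= circle_dist x y -> band lo hi x `&` cone lo' y = set0.
Proof.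
move=> xc yc hixy; apply/seteqP; split => // p.
move=> [[/(coneP lo p xc)[p2 _ [p1 px]] /= phi] /(coneP lo' p yc)[_ _ [_ py]]].
have := circle_dist_triangle xc p1 yc; rewrite (circle_distC x p.1).
have : cone_width p.2 <= p.2 by rewrite /cone_width; case: ifPn; rewrite -?leNgt.
lra.
Qed.

End theta_values.

(** * The annealed upper bound *)

Section ln_partition_sum_integrable.
Context {R : realType} {d : measure_display} {T : measurableType d}
  {P : probability T R} {n : nat}.
Hypothesis n0 : (0 < n)%N.

Lemma norm_ln_partition_sum_le (H : 'I_n -> R) :
  `|ln (partition_sum H)| <= ln n%:R + \sum_i `|H i|.
Proof.
pose i0 := Ordinal n0; have Z0 := partition_sum_gt0 H i0.
have ln0 : 0 <= ln n%:R :> R by rewrite ln_ge0// ler1n.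
have Hle i : `|H i| <= \sum_i `|H i|.
  by rewrite (bigD1 i)//= lerDl sumr_ge0.
rewrite ler_norml; apply/andP; split.
  have := ln_partition_sum_ge H i0; have := Hle i0.
  have : - `|H i0| <= H i0 by rewrite lerNl -normrN ler_norm.
  lra.
rewrite -ler_expR lnK ?posrE// expRD lnK ?posrE ?ltr0n//.
apply: (@le_trans _ _ (\sum_(i < n) expR (\sum_i `|H i|))).
  apply: ler_sum => i _; rewrite ler_expR.
  by rewrite (le_trans _ (Hle i))// ler_norm.
by rewrite sumr_const card_ord mulr_natl.
Qed.

Lemma measurable_ln_partition_sum (H : T -> 'I_n -> R) :
  (forall i, measurable_fun setT (H ^~ i)) ->
  measurable_fun setT (fun w => ln (partition_sum (H w))).
Proof.
move=> mH; apply: (measurableT_comp (@measurable_ln R)).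
exact: measurable_partition_sum.
Qed.

Lemma integrable_ln_partition_sum (H : T -> 'I_n -> R) :
  (forall i, P.-integrable setT (EFin \o (H ^~ i))) ->
  P.-integrable setT (EFin \o (fun w => ln (partition_sum (H w)))).
Proof.
move=> Hi; apply: (@integ_le _ _ _ P _ (fun w => ln n%:R + \sum_i `|H w i|)).
- by apply: measurable_ln_partition_sum => i; exact: integ_measurable (Hi i).
- by move=> w; exact: norm_ln_partition_sum_le.
- apply: integD; first exact: integ_cst.
  by apply: integ_sum => i _; exact: integ_norm.
Qed.

End ln_partition_sum_integrable.

Section upper_bound.
Context {R : realType} {d : measure_display} {T : measurableType d}
  {P : probability T R}.
Variable mu : set (R * R) -> {RV P >-> R}.
Hypothesis mu_grm : gaussian_random_measure mu.

Lemma grm_mgf2 (A B : set (R * R)) (a b : R) : finite_theta A -> finite_theta B ->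
  A `&` B = set0 ->
  P.-integrable setT (EFin \o (fun w => expR (a * mu A w + b * mu B w))) /\
  (\int[P]_w expR (a * mu A w + b * mu B w) =
    expR (a ^+ 2 * rtheta A / 2 + b ^+ 2 * rtheta B / 2))%R.
Proof.
move=> fA fB AB.
pose F (k : bool) := if k then A else B.
have fF k : finite_theta (F k) by case: k.
have tF : trivIset setT F.
  by apply/trivIsetP => -[] [] //= _ _ _; rewrite setIC.
pose W k := mu (family_seq F k).
have mh : measurable_fun [set: sigma_field W (others true)]
    ((fun w => expR (b * mu B w)) : sigma_field W (others true) -> R).
  apply: measurableT_comp => //; apply: measurable_funM => //.
  exact: (@measurable_family _ _ _ _ mu _ F true false).
pose f x : R := expR (a * x).
have mf : measurable_fun [set: R] f.
  by apply: measurableT_comp => //; exact: measurable_funM.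
have [ih Eh] := gaussian_mgf (rtheta_ge0 B) (grm_rtheta mu_grm fB) b.
have [fi fE] := law_mgf (rtheta_ge0 A) (grm_rtheta mu_grm fA) a.
have [i1 E1] := indep_expectation_mul (family_independent mu_grm fF tF true) mf mh
  (fun x => expR_ge0 _) (fun w => expR_ge0 _) fi ih.
have eq : (fun w => f (mu A w) * expR (b * mu B w)) = (fun w => expR (a * mu A w + b * mu B w)).
  by apply/funext => w; rewrite expRD.
rewrite -eq; split => //.
by rewrite E1 fE Eh -expRD.
Qed.

Variables (n : nat) (A B : 'I_n -> set (R * R)) (va vb : R).
Hypotheses (n0 : (0 < n)%N) (fA : forall i, finite_theta (A i))
  (fB : forall i, finite_theta (B i)) (AB : forall i, A i `&` B i = set0)
  (Ava : forall i, rtheta (A i) <= va) (Bvb : forall i, rtheta (B i) <= vb).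

(** From [beta] to sqrt 2 by comparison of norms, then Jensen's inequality in
    the form ln z <= ln c + z / c - 1. *)
Lemma expectation_ln_partition_le (a b beta : R) : Num.sqrt 2 <= beta ->
  (\int[P]_w ln (partition_sum (fun i => beta * (a * mu (A i) w + b * mu (B i) w))) <=
   beta / Num.sqrt 2 * (ln n%:R + a ^+ 2 * va + b ^+ 2 * vb))%R.
Proof.
move=> s2b; set s2 := Num.sqrt 2 in s2b *.
have s20 : 0 < s2 by rewrite sqrtr_gt0.
have bs : 0 <= beta / s2.
  by rewrite divr_ge0 ?(ltW s20)// (le_trans (ltW s20)).
have s2s : s2 ^+ 2 = 2 by rewrite sqr_sqrtr.
(* The bound for E Z at inverse temperature sqrt 2: the factor 2 of the
   squared temperature cancels the 1/2 of the Gaussian moments. *)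
pose c := n%:R * expR (a ^+ 2 * va + b ^+ 2 * vb).
have c0 : 0 < c by rewrite mulr_gt0 ?expR_gt0// ltr0n.
have lnc : ln c = ln n%:R + a ^+ 2 * va + b ^+ 2 * vb.
  by rewrite lnM ?posrE ?expR_gt0 ?ltr0n// expRK addrA.
pose H w i := a * mu (A i) w + b * mu (B i) w.
have iH i : P.-integrable setT (EFin \o (H ^~ i)).
  by apply: integD; apply: integZ; exact: grm_integrable.
pose E i w := expR (s2 * H w i).
have EE i : P.-integrable setT (EFin \o (E i)) /\ (\int[P]_w E i w <= c / n%:R)%R.
  have [] := grm_mgf2 (s2 * a) (s2 * b) (fA i) (fB i) (AB i).
  have eq : (fun w => expR (s2 * a * mu (A i) w + s2 * b * mu (B i) w)) = E i.
    by apply/funext => w; rewrite /E /H mulrDr !mulrA.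
  rewrite eq => iE ->; split => //.
  rewrite /c [leRHS]mulrAC divff ?mul1r ?pnatr_eq0 -?lt0n// ler_expR !exprMn s2s.
  have := ler_wpM2l (sqr_ge0 a) (Ava i); have := ler_wpM2l (sqr_ge0 b) (Bvb i).
  lra.
have iZ : P.-integrable setT (EFin \o (fun w => partition_sum (fun i => s2 * H w i))).
  by apply: integ_sum => i _; exact: (EE i).1.
have EZ : (\int[P]_w partition_sum (fun i => s2 * H w i) <= c)%R.
  rewrite Rint_sum => [|i _]; last exact: (EE i).1.
  apply: (@le_trans _ _ (\sum_(i < n) c / n%:R)); first by apply: ler_sum => i _; exact: (EE i).2.
  by rewrite sumr_const card_ord -(mulr_natr (c / n%:R)) divfK// pnatr_eq0 -lt0n.
have ib : P.-integrable setT (EFin \o (fun w => (beta / s2) *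
    ((ln c - 1) + c^-1 * partition_sum (fun i => s2 * H w i)))).
  by apply: integZ; apply: integD; [exact: integ_cst|exact: integZ].
apply: (@le_trans _ _ (\int[P]_w ((beta / s2) *
    ((ln c - 1) + c^-1 * partition_sum (fun i => s2 * H w i))))%R).
  apply: le_Rintegral => //.
    apply: (@integrable_ln_partition_sum _ _ _ P _ n0 (fun w i => beta * H w i)) => i.
    by apply: integZ; exact: iH.
  move=> w _; apply: (le_trans (ln_partition_sum_scale (H w) n0 s20 s2b)).
  rewrite ler_wpM2l//.
  set Z := partition_sum _; have Z0 : 0 < Z := partition_sum_gt0 _ (Ordinal n0).
  have Zc : 0 < Z / c by rewrite divr_gt0.
  have := @le_ln1Dx R (Z / c - 1); rewrite addrCA subrr addr0 ln_div ?posrE//.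
  rewrite [c^-1 * _]mulrC => H1; have : -1 < Z / c - 1 by lra.
  by move=> /H1; lra.
rewrite RintegralZl//; last by apply: integD; [exact: integ_cst|exact: integZ].
rewrite RintegralD//; [|exact: integ_cst|exact: integZ].
rewrite RintegralZl// Rintegral_prob_cst.
rewrite -lnc ler_wpM2l//.
have : c^-1 * (\int[P]_w partition_sum (fun i => s2 * H w i))%R <= 1.
  by rewrite mulrC ler_pdivrMr// mul1r.
lra.
Qed.

End upper_bound.

(** * The second moment method over the scales *)

Section product_of_events.
Context {R : realType} {d : measure_display} {T : measurableType d}
  {P : probability T R}.
Variable mu : set (R * R) -> {RV P >-> R}.
Hypothesis mu_grm : gaussian_random_measure mu.

Lemma grm_events (I : finType) (A : I -> set (R * R)) (B : I -> set R) :
  (forall i, finite_theta (A i)) -> trivIset setT A ->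
  (forall i, measurable (B i)) ->
  P [set w | forall i, B i (mu (A i) w)] = (\prod_i P (mu (A i) @^-1` B i))%E.
Proof.
move=> fA tA mB.
pose B' n := oapp (fun k : 'I_#|I| => B (enum_val k)) setT (insub n).
have B'E i : B' (enum_rank i) = B i by rewrite /B' valK /= enum_rankK.
have mB' n : measurable (B' n) by rewrite /B'; case: insub => [k|] //=.
pose J := [fset k in iota 0 #|I|]%fset.
have JE k : (k \in J) = (k < #|I|)%N by rewrite in_fset /= mem_iota.
have := grm_independent mu_grm (finite_theta_family_seq fA) (trivIset_family_seq tA) J mB'.
have -> : \bigcap_(n in [set` J]) (mu (family_seq A n) @^-1` B' n) =
    [set w | forall i, B i (mu (A i) w)].
  apply/seteqP; split => w.
    move=> H i; have := H (enum_rank i); rewrite /= B'E family_seq_rank; apply.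
    by rewrite JE.
  move=> H k /=; rewrite JE => kI.
  by rewrite -[k]/(val (Ordinal kI)) -[Ordinal kI]enum_valK B'E family_seq_rank.
move=> ->.
rewrite (perm_big (iota 0 #|I|)) /=; last first.
  by apply: uniq_perm => //; [exact: fset_uniq|exact: iota_uniq|move=> k; rewrite JE mem_iota].
rewrite -[X in iota 0 X]subn0 -/(index_iota _ _) big_mkord.
rewrite (reindex_onto (@enum_rank I) enum_val) => [|k _]; last by rewrite enum_valK.
by apply: eq_big => [i|i _]; rewrite ?enum_rankK ?eqxx// B'E family_seq_rank.
Qed.

End product_of_events.

Section counting.
Context {R : realType}.

Lemma card_ord_interval (N a b : nat) :
  (#|[set j : 'I_N | (a <= j < b)%N]%SET| <= b - a)%N.
Proof.
rewrite cardE -(size_map (@nat_of_ord N)) -(size_iota a (b - a)).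
apply: uniq_leq_size; first by rewrite map_inj_uniq ?enum_uniq//; exact: val_inj.
move=> k /mapP[j]; rewrite mem_enum inE mem_iota => /andP[aj jb] ->.
by rewrite aj subnKC// (leq_trans aj (ltnW jb)).
Qed.

Lemma site_unit_circle (N : nat) (i : 'I_N) : unit_circle (site i : R).
Proof.
rewrite /unit_circle /site/= divr_ge0//= ltr_pdivrMr ?mul1r ?ltr_nat//.
by rewrite ltr0n (leq_ltn_trans (leq0n i)).
Qed.

(** Sites that are close on the circle have indices that are close, up to N:
    the last two intervals collect the pairs close across the point 0 = 1. *)
Lemma close_sites (N : nat) (i j : 'I_N) (u : R) (m : nat) : N%:R * u <= m%:R ->
  circle_dist (site i) (site j) < u ->
  [|| (i.+1 - m <= j < i + m)%N, (0 <= j < m)%N | (N.+1 - m <= j < N)%N].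
Proof.
move=> Num; have N0 : 0 < N%:R :> R by rewrite ltr0n (leq_ltn_trans (leq0n i)).
have iN := ltn_ord i; have jN := ltn_ord j.
have E : N%:R * (site i - site j : R) = i%:R - j%:R.
  by rewrite /site; field; rewrite gt_eqF.
rewrite /circle_dist gt_min => /orP[|].
  rewrite -(ltr_pM2l N0) -[N%:R in X in X < _ -> _]ger0_norm// -normrM E.
  move=> /lt_le_trans /(_ Num); rewrite ltr_norml => /andP[h1 h2].
  have : (i < j + m)%N by rewrite -(ltr_nat R) natrD; lra.
  have : (j < i + m)%N by rewrite -(ltr_nat R) natrD; lra.
  by lia.
rewrite -(ltr_pM2l N0) mulrBr mulr1 -[N%:R in X in _ - X < _ -> _]ger0_norm// -normrM E.
move=> /lt_le_trans /(_ Num); case: (ger0P (i%:R - j%:R : R)) => _ h.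
  have : (N + j < i + m)%N by rewrite -(ltr_nat R) !natrD; lra.
  by lia.
have : (N + i < j + m)%N by rewrite -(ltr_nat R) !natrD; lra.
by lia.
Qed.

(** The hypothesis excludes radii below the spacing of the sites, for which the
    site itself would spoil a bound proportional to u. *)
Lemma card_close_sites (N : nat) (i : 'I_N) (u : R) : 1 <= N%:R * u ->
  (#|[set j : 'I_N | (circle_dist (site i) (site j) < u)%R]%SET|%:R : R) <= 8 * (N%:R * u).
Proof.
move=> Nu1; set x := N%:R * u in Nu1 *.
have x0 : 0 <= x by lra.
pose m := (Num.truncn x).+1.
have /andP[mx xm] := truncn_itv x0.
have m2 : m%:R <= 2 * x by rewrite /m -natr1; lra.
have : (#|[set j : 'I_N | (circle_dist (site i) (site j) < u)%R]%SET| <= 4 * m)%N.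
  apply: (@leq_trans #|[set j : 'I_N | (i.+1 - m <= j < i + m)%N]%SET :|:
    ([set j : 'I_N | (0 <= j < m)%N]%SET :|: [set j : 'I_N | (N.+1 - m <= j < N)%N]%SET)|).
    apply: subset_leq_card; apply/fintype.subsetP => j; rewrite !inE => close.
    exact: (close_sites (ltW xm) close).
  apply: (leq_trans (leq_card_setU _ _)).
  have := (leq_card_setU [set j : 'I_N | (0 <= j < m)%N]%SET [set j : 'I_N | (N.+1 - m <= j < N)%N]%SET).1.
  have := card_ord_interval N (i.+1 - m) (i + m); have := card_ord_interval N 0 m.
  have := card_ord_interval N (N.+1 - m) N.
  by lia.
by rewrite -(ler_nat R) natrM => h; apply: (le_trans h); lra.
Qed.

End counting.

Section second_moment.
Context {R : realType} {d : measure_display} {T : measurableType d}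
  {P : probability T R}.

Definition Pr (A : set T) : R := fine (P A).

Lemma PrE A : measurable A -> (Pr A)%:E = P A.
Proof. by move=> mA; rewrite /Pr fineK// fin_num_measure. Qed.

Lemma Pr_le A B : measurable A -> measurable B -> A `<=` B -> Pr A <= Pr B.
Proof.
move=> mA mB AB; rewrite -lee_fin !PrE//.
by apply: le_measure; rewrite ?inE.
Qed.

Lemma integrable_indic_prob A : measurable A -> P.-integrable setT (EFin \o (\1_A : T -> R)).
Proof.
move=> mA; apply: (@integ_bounded _ _ _ P _ 1) => //.
by move=> w; rewrite indicE; case: (_ \in _); rewrite ?normr1 ?normr0.
Qed.

Lemma Rint_indic A : measurable A -> (\int[P]_w (\1_A w) = Pr A)%R.
Proof. by move=> mA; rewrite /Rintegral integral_indic// setIT. Qed.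

(** Chebyshev's inequality for the number W of events that occur, whose mean is
    m = N p: if none occurs then (W - m)^2 = m^2. *)
Lemma second_moment_empty (N : nat) (E : 'I_N -> set T) (D : 'I_N -> 'I_N -> R) (p delta : R) :
  (0 < N)%N -> 0 < p -> (forall i, measurable (E i)) -> (forall i, Pr (E i) = p) ->
  (forall i j, Pr (E i `&` E j) <= p ^+ 2 * (1 + D i j)) ->
  \sum_i \sum_j D i j <= delta * N%:R ^+ 2 ->
  Pr [set w | forall i, ~ E i w] <= delta.
Proof.
move=> N0 p0 mE Ep EE HD.
set S := [set w | _].
have mS : measurable S.
  by apply: (measurable_forall (E := fun i => ~` E i)) => i; exact: measurableC.
pose W (w : T) : R := \sum_i \1_(E i) w.
pose m : R := N%:R * p.
have m0 : 0 < m by rewrite mulr_gt0// ltr0n.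
have iW : P.-integrable setT (EFin \o W).
  by apply: integ_sum => i _; exact: integrable_indic_prob.
pose W2 (w : T) : R := \sum_i \sum_j \1_(E i `&` E j) w.
have mEE i j : measurable (E i `&` E j) by exact: measurableI.
have iW2 : P.-integrable setT (EFin \o W2).
  by apply: integ_sum => i _; apply: integ_sum => j _; exact: integrable_indic_prob.
have WW w : (W w - m) ^+ 2 = W2 w - 2 * m * W w + m ^+ 2.
  have -> : W2 w = W w ^+ 2.
    rewrite expr2 mulr_suml; apply: eq_bigr => i _; rewrite mulr_sumr.
    by apply: eq_bigr => j _; rewrite indicI.
  by ring.
have EW : (\int[P]_w W w = m)%R.
  rewrite Rint_sum => [|i _]; last exact: integrable_indic_prob.
  under eq_bigr do rewrite Rint_indic// Ep.
  by rewrite sumr_const card_ord /m mulr_natl.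
have EW2 : (\int[P]_w W2 w <= m ^+ 2 + delta * m ^+ 2)%R.
  rewrite Rint_sum => [|i _]; last first.
    by apply: integ_sum => j _; exact: integrable_indic_prob.
  apply: (@le_trans _ _ (\sum_i \sum_j p ^+ 2 * (1 + D i j))).
    apply: ler_sum => i _; rewrite Rint_sum => [|j _]; last exact: integrable_indic_prob.
    by apply: ler_sum => j _; rewrite Rint_indic.
  under eq_bigr do rewrite -mulr_sumr.
  rewrite -mulr_sumr.
  have -> : \sum_(i < N) \sum_j (1 + D i j) = N%:R ^+ 2 + \sum_i \sum_j D i j.
    under eq_bigr do rewrite big_split/= sumr_const card_ord.
    by rewrite big_split/= sumr_const card_ord -mulrnA -natrX mulnn.
  have p2 : 0 <= p ^+ 2 by rewrite sqr_ge0.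
  have := ler_wpM2l p2 HD; rewrite /m exprMn; nra.
have iS := integrable_indic_prob mS.
have : (\int[P]_w (m ^+ 2 * \1_S w) <= \int[P]_w (W2 w - 2 * m * W w + m ^+ 2))%R.
  apply: le_Rintegral => //.
  - exact: integZ.
  - by apply: integD; [apply: integB => //; exact: integZ|exact: integ_cst].
  move=> w _; rewrite -WW indicE; case: (boolP (w \in S)) => [/set_mem Sw|_].
    rewrite /W big1; first by rewrite sub0r sqrrN mulr1.
    by move=> i _; rewrite indicE memNset//; exact: Sw.
  by rewrite mulr0 sqr_ge0.
rewrite RintegralZl// Rint_indic// RintegralD//; [|by apply: integB => //; exact: integZ|exact: integ_cst].
rewrite RintegralB//; last exact: integZ.
rewrite RintegralZl// EW Rintegral_prob_cst => H.
have m20 : 0 < m ^+ 2 by rewrite exprn_gt0.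
rewrite -(ler_pM2l m20); nra.
Qed.

End second_moment.

Section scales.
Context {R : realType} {d : measure_display} {T : measurableType d}
  {P : probability T R}.
Variable mu : set (R * R) -> {RV P >-> R}.
Hypothesis mu_grm : gaussian_random_measure mu.

Lemma grm_events_Pr (I : finType) (A : I -> set (R * R)) (B : I -> set R) :
  (forall i, finite_theta (A i)) -> trivIset setT A ->
  (forall i, measurable (B i)) ->
  measurable [set w | forall i, B i (mu (A i) w)] /\
  Pr (P := P) [set w | forall i, B i (mu (A i) w)] =
    \prod_i Pr (P := P) (mu (A i) @^-1` B i).
Proof.
move=> fA tA mB.
have mp i : measurable (mu (A i) @^-1` B i).
  by rewrite -[X in measurable X]setTI; exact: measurable_funP.
have mall : measurable [set w | forall i, B i (mu (A i) w)].
  exact: (measurable_forall (E := fun i => mu (A i) @^-1` B i)).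
split => //; apply: EFin_inj; rewrite PrE//.
have := grm_events mu_grm fA tA mB => ->.
elim/big_rec2 : _ => // i x y _ ->.
by rewrite EFinM PrE.
Qed.

Variables (N M : nat).
Hypothesis N1 : (1 < N)%N.
(** The variance of the field carried by one scale. There are M + 1 scales; the
    cuts are [scale l] = N ^ (- l / (M + 1)), from 1 for l = 0 down to 1/N. *)
Definition scale_var : R := ln N%:R / M.+1%:R.
Notation v := scale_var.
Definition scale (l : nat) : R := expR (- (l%:R * v)).
Hypothesis scale1 : scale 1 <= 2^-1.

Let N0 : 0 < N%:R :> R. Proof. by rewrite ltr0n (ltn_trans _ N1). Qed.
Let v0 : 0 < v. Proof. by rewrite divr_gt0 ?ln_gt0 ?ltr1n// ltr0n. Qed.

Lemma scale_gt0 l : 0 < scale l. Proof. exact: expR_gt0. Qed.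

Lemma scale_le k l : (k <= l)%N -> scale l <= scale k.
Proof. by move=> kl; rewrite ler_expR lerN2 ler_wpM2r ?(ltW v0)// ler_nat. Qed.

Lemma scale_last : scale M.+1 = N%:R^-1.
Proof. by rewrite /scale /scale_var mulrC divfK ?pnatr_eq0// expRN lnK. Qed.

Lemma scaleX l : scale l = scale 1 ^+ l.
Proof. by rewrite /scale mul1r -expRM_natl mulrN. Qed.

Let xc (i : 'I_N) : unit_circle (site i : R) := site_unit_circle i.

(** The l-th band of the site i, counted from the coarsest; the cuts are
    shifted by one because the part above [scale 1] is left out. *)
Definition level (i : 'I_N) (l : 'I_M) : set (R * R) :=
  band (scale l.+2) (scale l.+1) (site i).

Lemma level_sub i l : level i l `<=` band N%:R^-1 (scale 1) (site i).
Proof.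
move=> p [/(coneP _ _ (xc i))[p2 h1 pa] /= h2]; split => /=.
  apply/(coneP _ _ (xc i)); split => //; apply: le_trans h1.
  by rewrite -scale_last scale_le// ltnS ltn_ord.
by apply: (lt_le_trans h2); exact: scale_le.
Qed.

Lemma finite_theta_level i l : finite_theta (level i l) /\ rtheta (level i l) = v.
Proof.
have tb : theta (level i l) = v%:E.
  rewrite theta_band ?scale_gt0//.
  - by rewrite /scale !expRK; congr EFin; rewrite -(natr1 l.+1); ring.
  - exact: scale_le.
  - by apply: le_trans scale1; exact: scale_le.
split; last by rewrite /rtheta tb.
split; [exact: measurable_band| |by rewrite tb ltry].
by move=> p /band_cone; exact: cone_half_cylinder.
Qed.

Lemma level_disjoint i j k l : k != l -> level i k `&` level j l = set0.
Proof.
wlog kl : i j k l / (k < l)%N => [H kNl|_].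
  have [kl|lk|kl] := ltngtP k l; first exact: H.
    by rewrite setIC; apply: H; rewrite // eq_sym.
  by move: kNl; rewrite (val_inj kl) eqxx.
apply/seteqP; split => // p [[/(coneP _ _ (xc i))[_ h1 _] _] [_ /= h2]].
by have := @scale_le k.+2 l.+1 kl; rewrite leNgt (le_lt_trans h1 h2).
Qed.

Lemma trivIset_level i : trivIset setT (level i).
Proof.
by apply/trivIsetP => k l _ _ kl; exact: level_disjoint.
Qed.

(** The level containing a point is found as the least cut below its height. *)
Lemma band_levels i :
  \big[setU/set0]_l level i l = band N%:R^-1 (scale 1) (site i).
Proof.
rewrite -bigcup_seq; apply/seteqP; split => p.
  by move=> [l _]; exact: level_sub.
move=> [/(coneP _ _ (xc i))[p2 h1 pa] /= h2].
have ex : exists k, scale k.+1 <= p.2 by exists M; rewrite scale_last.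
case: (ex_minnP ex) => [[|k]] hk kmin; first by move: (lt_le_trans h2 hk); rewrite ltxx.
have kM : (k < M)%N by apply: kmin; rewrite scale_last.
exists (Ordinal kM); first by rewrite /= mem_index_enum.
split => /=; first by apply/(coneP _ _ (xc i)); split.
by rewrite ltNge; apply/negP => /kmin; rewrite ltnn.
Qed.

Lemma level_far (i j : 'I_N) (l : 'I_M) : scale l.+1 <= circle_dist (site i) (site j : R) ->
  level i l `&` level j l = set0.
Proof.
move=> far; apply/seteqP; split => // p [pi pj].
have /seteqP[H _] := band_cone_disjoint (scale l.+2) (scale l.+2) (xc i) (xc j) far.
by apply: (H p); split => //; exact: band_cone pj.
Qed.

Variable t : R.
Hypothesis t0 : 0 <= t.

Definition level_prob : R := fine (normal_prob 0 (Num.sqrt v) `[t, +oo[).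
Notation p := level_prob.

Let mt : measurable (`[t, +oo[%classic : set R). Proof. exact: measurable_itv. Qed.

Lemma Pr_level i l : Pr (P := P) (mu (level i l) @^-1` `[t, +oo[) = p.
Proof.
have [fl tl] := finite_theta_level i l.
have := grm_rtheta mu_grm fl mt; rewrite tl gt_eqF//.
by rewrite /distribution /pushforward /Pr => ->.
Qed.

Lemma level_prob_ge : (Num.sqrt (pi *+ 2))^-1 * expR (- (t / Num.sqrt v + 1) ^+ 2 / 2) <= p.
Proof.
have sv : 0 < Num.sqrt v by rewrite sqrtr_gt0.
rewrite -lee_fin /level_prob fineK; first exact: normal_tail_ge.
by rewrite fin_num_measure.
Qed.

Lemma level_prob_gt0 : 0 < p.
Proof.
apply: lt_le_trans level_prob_ge; rewrite mulr_gt0 ?expR_gt0// invr_gt0 sqrtr_gt0.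
by rewrite mulrn_wgt0// pi_gt0.
Qed.

Lemma level_prob_le1 : p <= 1.
Proof.
rewrite -lee_fin /level_prob fineK; first exact: probability_le1.
by rewrite fin_num_measure.
Qed.

Definition high (i : 'I_N) : set T := [set w | forall l, t <= mu (level i l) w].

Let highE i : high i = [set w | forall l, `[t, +oo[%classic (mu (level i l) w)].
Proof.
by apply/seteqP; split => w H l; have := H l; rewrite /= in_itv/= andbT.
Qed.

Lemma Pr_high i : measurable (high i) /\ Pr (P := P) (high i) = p ^+ M.
Proof.
rewrite highE.
have [mH ->] := grm_events_Pr (fun l => (finite_theta_level i l).1)
  (trivIset_level (i := i)) (fun=> mt).
split => //; under eq_bigr do rewrite Pr_level.
by rewrite prodr_const card_ord.
Qed.

Definition correlated (i j : 'I_N) (l : 'I_M) : bool :=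
  circle_dist (site i) (site j : R) < scale l.+1.

(** The levels of i, together with those levels of j at which the two sites are
    far apart, are pairwise disjoint, so that these events are independent.
    Dropping the remaining requirements on j costs a factor p for each scale
    that is larger than the distance. These scales form an initial segment, the
    last one being the l for which p ^ (- l - 1) is the factor lost; it is one
    term of the sum. *)
Lemma Pr_high_pair i j : Pr (P := P) (high i `&` high j) <=
  (p ^+ M) ^+ 2 * (1 + \sum_(l < M) (correlated i j l)%:R * p ^- l.+1).
Proof.
(* The dropped requirements are replaced by an empty set of the half-cylinder
   and the whole line, so that a single family of events is used. *)
pose F (k : 'I_M + 'I_M) := match k with
  | inl l => level i l | inr l => if correlated i j l then set0 else level j l end.
pose B (k : 'I_M + 'I_M) : set R := match k with
  | inl l => `[t, +oo[%classic | inr l => if correlated i j l then setT else `[t, +oo[%classic end.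
have fF k : finite_theta (F k).
  case: k => l /=; first exact: (finite_theta_level i l).1.
  by case: ifP => _; [exact: finite_theta0|exact: (finite_theta_level j l).1].
have tF : trivIset setT F.
  apply/trivIsetP => -[k|k] [l|l] _ _ kl /=.
  - by apply: level_disjoint; apply: contraNneq kl => ->.
  - case: ifPn => [_|]; first by rewrite setI0.
    rewrite /correlated -leNgt => far.
    have [kl'|kl'] := eqVneq k l; last exact: level_disjoint.
    by rewrite kl'; exact: level_far.
  - case: ifPn => [_|]; first by rewrite set0I.
    rewrite /correlated -leNgt => far.
    have [kl'|kl'] := eqVneq k l; last exact: level_disjoint.
    by rewrite kl' setIC; apply: level_far; rewrite -kl'.
  - case: ifP; case: ifP => _ _; rewrite ?set0I ?setI0//.
    by apply: level_disjoint; apply: contraNneq kl => ->.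
have mB k : measurable (B k) by case: k => l //=; case: ifP.
have [mall Eall] := grm_events_Pr fF tF mB.
have [mi _] := Pr_high i; have [mj _] := Pr_high j.
apply: (@le_trans _ _ (\prod_k Pr (P := P) (mu (F k) @^-1` B k))).
  rewrite -Eall; apply: Pr_le => //; first exact: measurableI.
  move=> w [Hi Hj] [l|l] /=; first by rewrite in_itv/= andbT; exact: Hi.
  by case: ifP => //= _; rewrite in_itv/= andbT; exact: Hj.
rewrite big_sumType/=.
have -> : \prod_(l < M) Pr (P := P) (mu (level i l) @^-1` `[t, +oo[) = p ^+ M.
  by under eq_bigr do rewrite Pr_level; rewrite prodr_const card_ord.
rewrite expr2 -mulrA ler_pM2l ?exprn_gt0 ?level_prob_gt0//.
have p0 := level_prob_gt0.
pose near_prod := \prod_(l < M) (if correlated i j l then p else 1).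
set far_prod := \prod_(l < M) _.
have farE : far_prod * near_prod = p ^+ M.
  rewrite /far_prod /near_prod -big_split/= -[in RHS](card_ord M) -prodr_const.
  apply: eq_bigr => l _; case: ifP => _; last by rewrite Pr_level mulr1.
  rewrite preimage_setT /Pr.
  have -> : fine (P setT) = 1 by rewrite probability_setT.
  by rewrite mul1r.
have nearE : near_prod = p ^+ #|[pred l | correlated i j l]|.
  by rewrite /near_prod -big_mkcond prodr_const.
have near0 : 0 < near_prod by rewrite nearE exprn_gt0.
have -> : far_prod = p ^+ M / near_prod by rewrite -farE mulfK// gt_eqF.
rewrite ler_pM2l ?exprn_gt0//.
have term0 (l : 'I_M) : 0 <= (correlated i j l)%:R * p ^- l.+1.
  by rewrite mulr_ge0// invr_ge0 exprn_ge0// ltW.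
have [/existsP[l0 cl0]|/existsPn none] := boolP [exists l, correlated i j l]; last first.
  rewrite nearE (_ : #|_| = 0%N) ?expr0 ?invr1 ?lerDl ?sumr_ge0//.
  by apply: eq_card0 => l; rewrite inE; apply/negbTE.
(* One term of the sum, that of the finest correlated scale, pays for all the
   lost factors. *)
case: (arg_maxnP (fun l : 'I_M => nat_of_ord l) cl0) => l cl lmax.
rewrite (bigD1 l)//= cl mul1r addrCA -[leLHS]addr0 lerD//; last first.
  by rewrite addr_ge0// sumr_ge0.
rewrite lef_pV2 ?posrE ?exprn_gt0// nearE ler_wiXn2l ?(ltW p0) ?level_prob_le1//.
rewrite -[leqRHS]subn0; apply: leq_trans (card_ord_interval M 0 l.+1).
apply: subset_leq_card; apply/fintype.subsetP => k; rewrite !inE => ck.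
by rewrite ltnS; exact: lmax.
Qed.

End scales.

(** * Tangents of the free energy and its lower bound *)

Section tangent.
Context {R : realType} {d : measure_display} {T : measurableType d}
  {P : probability T R}.
Variable mu : set (R * R) -> {RV P >-> R}.
Hypothesis mu_grm : gaussian_random_measure mu.
Variables (n : nat) (C B : 'I_n -> set (R * R)) (beta c : R).
Hypotheses (n0 : (0 < n)%N) (fC : forall i, finite_theta (C i))
  (fB : forall i, finite_theta (B i)).

(** What [grm_ibp] gives for E sum_i p_i mu(B_i), divided by [beta]: the mean,
    over two Gibbs points, of the difference of the covariances of mu(B_i) with
    the field at the first and at the second point. *)
Definition gibbs_overlap : R :=
  \sum_i (rtheta (B i `&` C i) * (\int[P]_w mu_gibbs mu C beta w i)%R -
    \sum_j rtheta (B i `&` C j) *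
      (\int[P]_w (mu_gibbs mu C beta w i * mu_gibbs mu C beta w j))%R).

Lemma integrable_ln_partition_mu :
  P.-integrable setT (EFin \o (fun w => ln (partition_sum (fun i => beta * mu (C i) w)))).
Proof.
apply: (@integrable_ln_partition_sum _ _ _ P _ n0 (fun w i => beta * mu (C i) w)) => i.
by apply: integZ; exact: grm_integrable.
Qed.

(** The expectation of the tangent inequality at the field [mu (C i)], in the
    direction [mu (B i)]. *)
Lemma expectation_tangent :
  (\int[P]_w ln (partition_sum (fun i => beta * mu (C i) w)) + c * beta * gibbs_overlap <=
   \int[P]_w ln (partition_sum (fun i => beta * mu (C i) w + c * mu (B i) w)))%R.
Proof.
have iBp i : P.-integrable setT (EFin \o (fun w => mu (B i) w * mu_gibbs mu C beta w i)).
  apply: (@integ_bMl _ _ _ P _ _ 1); last exact: grm_integrable.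
    exact: measurable_mu_gibbs.
  by move=> w; exact: norm_softmax_le1.
have iS : P.-integrable setT
    (EFin \o (fun w => c * \sum_i mu (B i) w * mu_gibbs mu C beta w i)).
  by apply: integZ; apply: integ_sum => i _.
have -> : c * beta * gibbs_overlap =
    (\int[P]_w (c * \sum_i mu (B i) w * mu_gibbs mu C beta w i))%R.
  rewrite RintegralZl//; last by apply: integ_sum => i _.
  rewrite -mulrA; congr (_ * _); rewrite Rint_sum// mulr_sumr.
  by apply: eq_bigr => i _; rewrite (grm_ibp mu_grm beta fC (fB i) i).
rewrite -RintegralD//; last exact: integrable_ln_partition_mu.
apply: le_Rintegral => //.
- by apply: integD => //; exact: integrable_ln_partition_mu.
- apply: (@integrable_ln_partition_sum _ _ _ P _ n0
    (fun w i => beta * mu (C i) w + c * mu (B i) w)) => i.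
  by apply: integD; apply: integZ; exact: grm_integrable.
move=> w _.
have := ln_partition_sum_tangent (fun i => beta * mu (C i) w) (fun i => c * mu (B i) w) n0.
congr (_ + _ <= _); rewrite mulr_sumr; apply: eq_bigr => i _.
by rewrite /mu_gibbs; ring.
Qed.

End tangent.

Section cone_split.
Context {R : realType}.
Implicit Types (x y lo u : R).

Lemma cone_splitE lo u x : unit_circle x -> lo <= u ->
  cone lo x = band lo u x `|` cone u x.
Proof.
move=> xc lou; apply/seteqP; split => p.
  move=> H; have [p2 h pa] := (coneP lo p xc).1 H.
  by have [pu|up] := ltP p.2 u; [left|right; apply/coneP].
move=> [[]//|/(coneP _ _ xc)[p2 h pa]]; apply/coneP => //; split => //.
exact: le_trans h.
Qed.

Lemma band_cone_split lo u x y : unit_circle y -> band lo u x `&` cone u y = set0.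
Proof.
move=> yc; apply/seteqP; split => // p [[_ /= pu] /(coneP _ _ yc)[_ up _]].
by move: pu; rewrite ltNge up.
Qed.

Lemma finite_theta_band lo u x : unit_circle x -> 0 < lo -> lo <= u -> u <= 2^-1 ->
  finite_theta (band lo u x) /\ rtheta (band lo u x) = ln u - ln lo.
Proof.
move=> xc lo0 lou u2; have E := theta_band xc lo0 lou u2.
split; last by rewrite /rtheta E.
split; [exact: measurable_band| |by rewrite E ltry].
by move=> p /band_cone; exact: cone_half_cylinder.
Qed.

End cone_split.

Lemma grm_cone_split {R : realType} {d : measure_display} {T : measurableType d}
    {P : probability T R} (mu : set (R * R) -> {RV P >-> R})
    (mu_grm : gaussian_random_measure mu) (lo u x : R) :
  unit_circle x -> 0 < lo -> lo <= u -> u <= 2^-1 ->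
  {ae P, forall w, mu (cone lo x) w = mu (band lo u x) w + mu (cone u x) w}.
Proof.
move=> xc lo0 lou u2; have u0 := lt_le_trans lo0 lou.
pose F (b : bool) := if b then band lo u x else cone u x.
have fF b : finite_theta (F b).
  by case: b; [have [] := finite_theta_band xc lo0 lou u2|have [] := finite_theta_cone xc u0 u2].
have tF : trivIset setT F.
  apply/trivIsetP => -[] [] //= _ _ _; last rewrite setIC; exact: band_cone_split.
have := grm_sumT mu_grm fF tF; rewrite big_bool/= -(cone_splitE xc lou).
by apply: filterS => w ->; rewrite big_bool.
Qed.

Section lower_bound.
Context {R : realType} {d : measure_display} {T : measurableType d}
  {P : probability T R}.
Variable mu : set (R * R) -> {RV P >-> R}.
Hypothesis mu_grm : gaussian_random_measure mu.
Variables (N M : nat).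
Hypothesis N1 : (1 < N)%N.
Hypothesis scale1 : scale (R := R) N M 1 <= 2^-1.
Variable t : R.
Hypothesis t0 : 0 <= t.
Notation v := (scale_var (R := R) N M).
Notation p := (level_prob (R := R) N M t).
Notation high := (@high R d T P mu N M t).

Let N0 : 0 < N%:R :> R. Proof. by rewrite ltr0n (ltn_trans _ N1). Qed.
Let xc (i : 'I_N) : unit_circle (site i : R) := site_unit_circle i.

(** A bound for the relative variance of the number of high sites: a site has
    at most 8 N scale(l) others within the distance scale(l), and for these a
    factor p ^ l is lost. *)
Definition second_moment_error : R := \sum_(l < M) 8 * scale N M l.+1 * p ^- l.+1.
Notation delta := second_moment_error.

(** Summing [Pr_high_pair] over the pairs, by counting close sites at each
    scale. *)
Lemma Pr_no_high_le : Pr (P := P) [set w | forall i, ~ high i w] <= delta.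
Proof.
have p0 := level_prob_gt0 M N1 t0.
apply: (second_moment_empty (p := p ^+ M)
  (D := fun i j => \sum_(l < M) (correlated (R := R) i j l)%:R * p ^- l.+1)).
- exact: ltn_trans N1.
- exact: exprn_gt0.
- by move=> i; exact: (Pr_high mu_grm N1 scale1 t i).1.
- by move=> i; exact: (Pr_high mu_grm N1 scale1 t i).2.
- by move=> i j; exact: Pr_high_pair.
apply: (@le_trans _ _ (\sum_(i < N) N%:R * delta)); last first.
  by rewrite sumr_const card_ord -(mulr_natl (N%:R * delta)) mulrA -expr2 mulrC.
apply: ler_sum => i _; rewrite exchange_big/= mulr_sumr; apply: ler_sum => l _.
rewrite -mulr_suml mulrA ler_wpM2r ?invr_ge0 ?exprn_ge0 ?(ltW p0)//.
rewrite mulrCA; apply: le_trans (card_close_sites (u := scale N M l.+1) i _).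
  rewrite -sum1_card natr_sum [leRHS]big_mkcond/=; apply: ler_sum => j _.
  by rewrite inE /correlated; case: ifP.
by rewrite -ler_pdivrMl// mulr1 -(scale_last M N1) scale_le// ltnS ltnW.
Qed.


Let eps0 : 0 < N%:R^-1 :> R. Proof. by rewrite invr_gt0. Qed.
Let eps_le : N%:R^-1 <= scale N M 1 :> R.
Proof. by rewrite -(scale_last M N1) scale_le. Qed.
Let small (i : 'I_N) : set (R * R) := band N%:R^-1 (scale N M 1) (site i).
Let large (i : 'I_N) : set (R * R) := cone (scale N M 1) (site i).

Let finite_small i : finite_theta (small i) /\ rtheta (small i) <= ln N%:R.
Proof.
have [f E] := finite_theta_band (xc i) eps0 eps_le scale1.
split => //; rewrite /small E lnV ?posrE// opprK gerDr ln_le0//.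
by rewrite (le_trans scale1)// invf_le1// ler1n.
Qed.

Let finite_large i : finite_theta (large i).
Proof. by have [] := finite_theta_cone (xc i) (scale_gt0 N M 1) scale1. Qed.

Let mu_small i : {ae P, forall w, mu (small i) w = \sum_(l < M) mu (level i l) w}.
Proof.
have := grm_sumT mu_grm (fun l => (finite_theta_level N1 scale1 i l).1)
  (@trivIset_level _ N M N1 i).
by rewrite (band_levels M N1).
Qed.

Let i0 : 'I_N := Ordinal (ltn_trans (ltn0Sn 0) N1).

(** The coarsest part of the cones is disjoint from all the bands, so its
    overlap with them is 0 and it can be removed. Then, when some site is high,
    ln Z is at least beta M t; otherwise it is at least the energy of any fixed
    site, whose first absolute moment is of order sqrt L. *)
Lemma expectation_ln_partition_ge (beta : R) : 0 <= beta ->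
  beta * (M%:R * t * (1 - delta) - 2 * expR 1 * Num.sqrt (ln N%:R)) <=
  (\int[P]_w ln (partition_sum (fun i : 'I_N => beta * mu (cone N%:R^-1 (site i)) w)))%R.
Proof.
move=> beta0; have Npos : (0 < N)%N := ltn_trans (ltn0Sn 0) N1.
have ff i := (finite_small i).1.
have mH : measurable [set w | forall i, ~ high i w].
  apply: (measurable_forall (E := fun i => ~` high i)) => i; apply: measurableC.
  exact: (Pr_high mu_grm N1 scale1 t i).1.
set S := [set w | _] in mH.
have -> : (\int[P]_w ln (partition_sum (fun i : 'I_N => beta * mu (cone N%:R^-1 (site i)) w)) =
   \int[P]_w ln (partition_sum (fun i => beta * mu (small i) w + beta * mu (large i) w)))%R.
  apply: ae_eq_Rint.
  - by apply: measurable_ln_partition_sum => i; exact: measurable_funM.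
  - by apply: measurable_ln_partition_sum => i; apply: measurable_funD; exact: measurable_funM.
  have : {ae P, forall w i, mu (cone N%:R^-1 (site i)) w = mu (small i) w + mu (large i) w}.
    apply: filter_forall => i.
    exact: (grm_cone_split mu_grm (xc i) eps0 eps_le scale1).
  apply: filterS => w H; congr (ln (partition_sum _)); apply/funext => i.
  by rewrite H mulrDr.
apply: le_trans (expectation_tangent mu_grm beta beta Npos ff finite_large).
have -> : gibbs_overlap mu small large beta = 0.
  apply: big1 => i _; rewrite big1 => [|j _].
    by rewrite setIC band_cone_split// rtheta0 mul0r subr0.
  by rewrite setIC band_cone_split// rtheta0 mul0r.
rewrite mulr0 addr0.
have iX0 := integ_norm (grm_integrable mu_grm (ff i0)).
have iS := integrable_indic_prob (P := P) mH.
have Mt0 : 0 <= M%:R * t by rewrite mulr_ge0.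
apply: (@le_trans _ _ (\int[P]_w (beta * (M%:R * t * (1 - \1_S w) - `|mu (small i0) w|)))%R).
  have i1 : P.-integrable setT (EFin \o (fun w => 1 - \1_S w)).
    by apply: integB => //; exact: integ_cst.
  have i2 : P.-integrable setT (EFin \o (fun w => M%:R * t * (1 - \1_S w))).
    exact: integZ.
  rewrite RintegralZl//; last exact: integB.
  rewrite ler_wpM2l// RintegralB// RintegralZl// RintegralB//; last exact: integ_cst.
  rewrite Rintegral_prob_cst Rint_indic//.
  have X0 := gaussian_norm_le (rtheta_ge0 _) (grm_rtheta mu_grm (ff i0)).
  have X1 : (\int[P]_w `|mu (small i0) w| <= 2 * expR 1 * Num.sqrt (ln N%:R))%R.
    apply: (le_trans X0); rewrite ler_wpM2l ?mulr_ge0 ?expR_ge0//.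
    by rewrite ler_wsqrtr// (finite_small i0).2.
  have := Pr_no_high_le; rewrite -/S => SD.
  have : M%:R * t * (1 - delta) <= M%:R * t * (1 - Pr (P := P) S) by rewrite ler_wpM2l// lerB.
  lra.
have H : {ae P, forall w i, mu (small i) w = \sum_(l < M) mu (level i l) w}.
  by apply: filter_forall => i; exact: mu_small.
pose g w := beta * (M%:R * t * (1 - \1_S w) - `|mu (small i0) w|).
pose f w := ln (partition_sum (fun i => beta * mu (small i) w)).
have ig : P.-integrable setT (EFin \o g).
  by apply: integZ; apply: integB => //; apply: integZ; apply: integB => //; exact: integ_cst.
have if_ : P.-integrable setT (EFin \o f).
  exact: integrable_ln_partition_mu.
have ae_le : {ae P, forall w, g w <= f w}.
  apply: filterS H => w Hw; rewrite /g /f indicE.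
  case: (boolP (w \in S)) => [_|wS].
    rewrite subrr mulr0 add0r; apply: le_trans (ln_partition_sum_ge _ i0).
    by rewrite ler_wpM2l// lerNl -normrN ler_norm.
  have [i hi] : exists i, high i w.
    by apply: contrapT => /forallNP Hn; move/negP: wS; apply; exact/mem_set.
  rewrite subr0 mulr1; apply: le_trans (ln_partition_sum_ge _ i).
  rewrite ler_wpM2l// (@le_trans _ _ (M%:R * t))//; first by rewrite gerBl.
  rewrite Hw -[M in M%:R]card_ord mulr_natl -sumr_const.
  by apply: ler_sum => l _; exact: hi.
exact: ae_le_Rint.
Qed.

End lower_bound.

Section asymptotics.
Context {R : realType}.

Lemma near_ln_ge (A : R) : \forall N \near \oo, (1 < N)%N /\ A <= ln N%:R.
Proof.
near=> N.
have N1 : (1 < N)%N by near: N; exact: nbhs_infty_gt.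
split => //; rewrite -ler_expR lnK ?posrE ?ltr0n ?(ltn_trans _ N1)//.
by near: N; exact: nbhs_infty_ger.
Unshelve. all: by end_near. Qed.

(** The inequality between the two means, for k v / 2 and 1 / k. *)
Lemma sqrt_le_linear (k v : R) : 0 < k -> 0 <= v ->
  Num.sqrt 2 * Num.sqrt v <= k * v / 2 + k^-1.
Proof.
move=> k0 v0; rewrite -sqrtrM//.
have y0 : 0 <= k * v / 2 + k^-1.
  by rewrite addr_ge0 ?divr_ge0 ?mulr_ge0 ?invr_ge0 ?(ltW k0).
rewrite -[leRHS]ger0_norm// -sqrtr_sqr ler_wsqrtr//.
have -> : (k * v / 2 + k^-1) ^+ 2 = (k * v / 2 - k^-1) ^+ 2 + 2 * v.
  by field; rewrite gt_eqF.
by rewrite lerDr sqr_ge0.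
Qed.

(** Every term of the error is a power of the ratio of the first scale
    exp (- v) to the probability p, which by the Gaussian tail is about
    exp (- (1 - k)^2 v) times lower-order factors. This leaves about
    exp (- 2 k v), part of which pays for the square root of v in the
    exponent. *)
Lemma second_moment_error_le (N M : nat) (k : R) : (1 < N)%N -> 0 < k -> k <= 1 ->
  let v := scale_var N M in
  let C := Num.sqrt (pi *+ 2) * expR (k^-1 + 2^-1) in
  C * expR (- (k * v / 2)) <= 1 ->
  second_moment_error N M (Num.sqrt 2 * (1 - k) * v) <=
    8 * M%:R * (C * expR (- (k * v / 2))).
Proof.
move=> N1 k0 k1 v C small.
have v0 : 0 < v by rewrite divr_gt0 ?ln_gt0 ?ltr1n ?ltr0n.
have sv : 0 < Num.sqrt v by rewrite sqrtr_gt0.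
have t0 : 0 <= Num.sqrt 2 * (1 - k) * v.
  by rewrite mulr_ge0 ?(ltW v0)// mulr_ge0 ?sqrtr_ge0 ?subr_ge0.
set t := Num.sqrt 2 * (1 - k) * v in t0 *.
have p0 := level_prob_gt0 M N1 t0; have pge := level_prob_ge M N1 t0.
set p := level_prob N M t in p0 pge *.
pose rho := scale (R := R) N M 1 / p.
have rho_le : rho <= C * expR (- (k * v / 2)).
  rewrite /rho ler_pdivrMr//.
  have spi : 0 < Num.sqrt (pi *+ 2) :> R by rewrite sqrtr_gt0 mulrn_wgt0// pi_gt0.
  apply: (@le_trans _ _ (C * expR (- (k * v / 2)) * ((Num.sqrt (pi *+ 2))^-1 *
      expR (- (t / Num.sqrt v + 1) ^+ 2 / 2)))); last first.
    have C0 : 0 < C by rewrite /C mulr_gt0 ?expR_gt0.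
    apply: ler_wpM2l; last exact: pge.
    by rewrite mulr_ge0 ?expR_ge0 ?(ltW C0).
  have -> : C * expR (- (k * v / 2)) * ((Num.sqrt (pi *+ 2))^-1 *
      expR (- (t / Num.sqrt v + 1) ^+ 2 / 2)) =
      expR (k^-1 + 2^-1 - k * v / 2 - (t / Num.sqrt v + 1) ^+ 2 / 2).
    rewrite mulNr /C !expRD.
    by field; rewrite gt_eqF.
  rewrite /scale mul1r ler_expR -/v.
  have -> : t / Num.sqrt v = Num.sqrt 2 * (1 - k) * Num.sqrt v.
    rewrite /t -[X in _ * X / _](sqr_sqrtr (ltW v0)).
    by field; rewrite gt_eqF.
  set s := Num.sqrt v; set r := Num.sqrt 2.
  have s2 : s ^+ 2 = v by rewrite sqr_sqrtr// ltW.
  have r2 : r ^+ 2 = 2 by rewrite sqr_sqrtr.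
  have -> : (r * (1 - k) * s + 1) ^+ 2 = r ^+ 2 * (1 - k) ^+ 2 * s ^+ 2 + 2 * (1 - k) * (r * s) + 1.
    by ring.
  rewrite r2 s2.
  have := sqrt_le_linear k0 (ltW v0); rewrite -/s -/r => lin.
  have rs0 : 0 <= r * s by rewrite mulr_ge0 ?sqrtr_ge0.
  have : (1 - k) * (r * s) <= r * s by rewrite ler_piMl// gerBl ltW.
  have : k ^+ 2 * v <= k * v by rewrite ler_wpM2r ?(ltW v0)// expr2 ler_piMl// ltW.
  have -> : (1 - k) ^+ 2 = 1 - 2 * k + k ^+ 2 by ring.
  lra.
have rho0 : 0 <= rho by rewrite divr_ge0// ltW// scale_gt0.
rewrite /second_moment_error.
apply: (@le_trans _ _ (\sum_(l < M) 8 * rho)); last first.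
  rewrite sumr_const card_ord -(mulr_natl (8 * rho)) mulrCA mulrA.
  by rewrite ler_wpM2l// mulr_ge0.
apply: ler_sum => l _; rewrite scaleX -mulrA ler_wpM2l//.
rewrite -exprVn -exprMn -/rho ler_iXnr// (le_trans rho_le)//.
Qed.

End asymptotics.

Section free_energy_lower_bound.
Context {R : realType} {d : measure_display} {T : measurableType d}
  {P : probability T R}.
Variable mu : set (R * R) -> {RV P >-> R}.
Hypothesis mu_grm : gaussian_random_measure mu.

Definition free_energy (beta : R) (N : nat) : R :=
  (\int[P]_w ln (partition_sum (fun i : 'I_N => beta * mu (cone N%:R^-1 (site i)) w)))%R.

(** The number of scales depends on [k] alone, so that the variance v per scale
    tends to infinity with N and the second moment error vanishes. One factor
    1 - k comes from the threshold, one from the omitted scale, and one from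
    the error. *)
Lemma free_energy_ge (beta k : R) : 0 <= beta -> 0 < k -> k <= 2^-1 ->
  \forall N \near \oo,
    beta * (Num.sqrt 2 * (1 - k) ^+ 3 - k) * ln N%:R <= free_energy beta N.
Proof.
move=> beta0 k0 k2; pose M := Num.truncn k^-1.
have /andP[_ Mk] : M%:R <= k^-1 < M.+1%:R by apply: truncn_itv; rewrite invr_ge0 ltW.
pose C := Num.sqrt (pi *+ 2) * expR (k^-1 + 2^-1) : R.
have C0 : 0 < C.
  by rewrite mulr_gt0 ?expR_gt0// sqrtr_gt0 mulrn_wgt0// pi_gt0.
(* Chosen so that exp (- k v / 2) <= 1 / D makes both the error and the
   ratio bounding it at most k. *)
pose D := C * (8 * M%:R + 1) / k.
have D0 : 0 < D by rewrite divr_gt0// mulr_gt0// ltr_wpDl// mulr_ge0.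
near=> N.
have [N1 LA] : (1 < N)%N /\ M.+1%:R * (1 + 2 * D / k) <= ln N%:R :> R.
  by near: N; exact: near_ln_ge.
have [_ LB] : (1 < N)%N /\ (2 * expR 1 / k) ^+ 2 <= ln N%:R :> R.
  by near: N; exact: near_ln_ge.
set L := ln N%:R in LA LB *; set v := scale_var (R := R) N M.
have L0 : 0 < L by rewrite ln_gt0// ltr1n.
have LE : L = M.+1%:R * v by rewrite /v /scale_var -/L mulrC divfK// pnatr_eq0.
have vA : 1 + 2 * D / k <= v by move: LA; rewrite LE ler_pM2l// ltr0n.
have Dk0 : 0 < 2 * D / k by rewrite divr_gt0// mulr_gt0.
have v1 : 1 <= v by lra.
have v0 : 0 < v by lra.
have expv : expR (- (k * v / 2)) <= D^-1.
  rewrite expRN lef_pV2 ?posrE ?expR_gt0//.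
  have : D <= k * v / 2.
    rewrite ler_pdivlMr// mulrC -ler_pdivrMl//; rewrite mulrC.
    by lra.
  by move=> h; apply: le_trans (expR_ge1Dx _); lra.
have CDk : C * (8 * M%:R + 1) * expR (- (k * v / 2)) <= k.
  apply: (@le_trans _ _ (C * (8 * M%:R + 1) * D^-1)).
    by rewrite ler_wpM2l// mulr_ge0 ?(ltW C0)// addr_ge0// mulr_ge0.
  rewrite /D invf_div mulrC divfK//.
  by rewrite gt_eqF// mulr_gt0// ltr_wpDl// mulr_ge0.
have e0 := expR_gt0 (- (k * v / 2)).
have Ce0 : 0 < C * expR (- (k * v / 2)) by rewrite mulr_gt0.
have M0 : 0 <= M%:R :> R by [].
have small1 : C * expR (- (k * v / 2)) <= k by nra.
have small2 : 8 * M%:R * (C * expR (- (k * v / 2))) <= k by nra.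
have s1 : scale (R := R) N M 1 <= 2^-1.
  rewrite /scale mul1r -/v expRN lef_pV2 ?posrE ?expR_gt0//.
  by apply: le_trans (expR_ge1Dx _); lra.
pose t := Num.sqrt 2 * (1 - k) * v.
have t0 : 0 <= t.
  by rewrite mulr_ge0 ?(ltW v0)// mulr_ge0 ?sqrtr_ge0// subr_ge0; lra.
have k1 : k <= 1 by lra.
have err : second_moment_error N M t <= k.
  apply: le_trans small2; apply: second_moment_error_le => //.
  by apply: (le_trans small1).
have := expectation_ln_partition_ge mu_grm N1 s1 t0 beta0; rewrite -/L.
apply: le_trans; rewrite -mulrA ler_wpM2l// mulrBl lerB//; last first.
  have sL : 0 < Num.sqrt L by rewrite sqrtr_gt0.
  rewrite -[in leRHS](sqr_sqrtr (ltW L0)) expr2 mulrA ler_wpM2r ?(ltW sL)//.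
  rewrite -ler_pdivrMl// mulrC.
  have h0 : 0 <= 2 * expR 1 / k by rewrite divr_ge0 ?(ltW k0)// mulr_ge0 ?expR_ge0.
  by rewrite -[leLHS](ger0_norm h0) -sqrtr_sqr; exact: ler_wsqrtr.
have Mt : Num.sqrt 2 * (1 - k) ^+ 2 * L <= M%:R * t.
  rewrite /t LE; set r := Num.sqrt 2.
  have r0 : 0 <= r by rewrite sqrtr_ge0.
  have -> : r * (1 - k) ^+ 2 * (M.+1%:R * v) = (r * (1 - k) * v) * ((1 - k) * M.+1%:R) by ring.
  rewrite mulrC [leRHS]mulrC; rewrite mulrC ler_wpM2l//.
  have : 1 <= k * M.+1%:R by rewrite -ler_pdivrMl// mulr1 ltW.
  by rewrite -natr1; lra.
apply: (@le_trans _ _ (M%:R * t * (1 - k))); last first.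
  by apply: ler_wpM2l; [exact: mulr_ge0|exact: lerB].
have -> : Num.sqrt 2 * (1 - k) ^+ 3 * L = Num.sqrt 2 * (1 - k) ^+ 2 * L * (1 - k) by ring.
by rewrite ler_wpM2r// subr_ge0.
Unshelve. all: by end_near. Qed.

End free_energy_lower_bound.

(** * From the free energy to the overlap *)

Section overlap_bounds.
Context {R : realType}.

Lemma circle_dist_site (N : nat) (i j : 'I_N) : i != j ->
  N%:R^-1 <= circle_dist (site i) (site j : R).
Proof.
move=> ij; have N0 : 0 < N%:R :> R by rewrite ltr0n (leq_ltn_trans (leq0n i)).
have E : N%:R * (site i - site j : R) = i%:R - j%:R.
  by rewrite /site; field; rewrite gt_eqF.
have nE : N%:R * `|site i - site j : R| = `|i%:R - j%:R|.
  by rewrite -E normrM ger0_norm// ltW.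
have iN := ltn_ord i; have jN := ltn_ord j.
have nij : nat_of_ord i != j by [].
have [lo hi] : 1 <= `|i%:R - j%:R : R| /\ `|i%:R - j%:R : R| <= N%:R - 1.
  case: (ltngtP i j) nij => // [lij|lji] _.
    rewrite ler0_norm ?subr_le0 ?ler_nat ?(ltnW lij)// opprB.
    have : (i.+1 <= j)%N by []; rewrite -(ler_nat R) -natr1 => h1.
    have : (j.+1 <= N)%N by []; rewrite -(ler_nat R) -natr1 => h2.
    by have := ler0n R i; move=> ?; split; lra.
  rewrite ger0_norm ?subr_ge0 ?ler_nat ?(ltnW lji)//.
  have : (j.+1 <= i)%N by []; rewrite -(ler_nat R) -natr1 => h1.
  have : (i.+1 <= N)%N by []; rewrite -(ler_nat R) -natr1 => h2.
  by have := ler0n R j; move=> ?; split; lra.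
rewrite /circle_dist le_min; apply/andP; split; rewrite -(ler_pM2l N0) divff ?gt_eqF//.
  by rewrite nE.
by rewrite mulrBr mulr1 nE; lra.
Qed.

Lemma overlap_le1 (N : nat) (i j : 'I_N) : (1 < N)%N -> overlap i j <= 1 :> R.
Proof.
move=> N1; rewrite /overlap; case: eqVneq => // ij.
have N0 : 0 < N%:R :> R by rewrite ltr0n (ltn_trans _ N1).
have L0 : 0 < ln N%:R :> R by rewrite ln_gt0// ltr1n.
have D := circle_dist_site ij.
rewrite -mulNr ler_pdivrMr// mul1r lerNl -lnV ?posrE// ler_ln ?posrE ?invr_gt0//.
by apply: lt_le_trans D; rewrite invr_gt0.
Qed.

(** Since q < 1 the diagonal, of overlap 1 and distance 0, is on the same side
    as the pairs of close sites. *)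
Lemma overlap_leP (N : nat) (i j : 'I_N) (q : R) : (1 < N)%N -> q < 1 ->
  (overlap i j <= q) = (expR (- (q * ln N%:R)) <= circle_dist (site i) (site j)).
Proof.
move=> N1 q1; rewrite /overlap; case: eqVneq => [->|ij].
  rewrite /circle_dist subrr normr0 subr0 minEle ler01.
  by rewrite [LHS]leNgt q1 [RHS]leNgt expR_gt0.
have N0 : 0 < N%:R :> R by rewrite ltr0n (ltn_trans _ N1).
have L0 : 0 < ln N%:R :> R by rewrite ln_gt0// ltr1n.
have D := circle_dist_site ij.
have D0 : 0 < circle_dist (site i) (site j : R) by apply: lt_le_trans D; rewrite invr_gt0.
by rewrite -mulNr ler_pdivrMr// lerNl -[in RHS](lnK D0) ler_expR.
Qed.

End overlap_bounds.

Section two_sided_bounds.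
Context {R : realType} {d : measure_display} {T : measurableType d}
  {P : probability T R}.
Variable mu : set (R * R) -> {RV P >-> R}.
Hypothesis mu_grm : gaussian_random_measure mu.
Variables (beta q : R) (N : nat).
Hypotheses (beta2 : Num.sqrt 2 <= beta) (q1 : q < 1) (N1 : (1 < N)%N).
Let L : R := ln N%:R.
Let u : R := expR (- (q * L)).
Hypothesis u2 : u <= 2^-1.
Let C (i : 'I_N) : set (R * R) := cone N%:R^-1 (site i).
Let large (i : 'I_N) : set (R * R) := cone u (site i).
Let small (i : 'I_N) : set (R * R) := band N%:R^-1 u (site i).
Let xc (i : 'I_N) : unit_circle (site i : R) := site_unit_circle i.
Let Npos : (0 < N)%N. Proof. exact: ltn_trans N1. Qed.
Let N0 : 0 < N%:R :> R. Proof. by rewrite ltr0n. Qed.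
Let L0 : 0 < L. Proof. by rewrite ln_gt0// ltr1n. Qed.
Let beta0 : 0 < beta. Proof. by apply: lt_le_trans beta2; rewrite sqrtr_gt0. Qed.
Let eps0 : 0 < N%:R^-1 :> R. Proof. by rewrite invr_gt0. Qed.
Let u0 : 0 < u. Proof. exact: expR_gt0. Qed.
Let eps_u : N%:R^-1 <= u.
Proof.
rewrite -[N%:R in leLHS]lnK ?posrE// -expRN ler_expR lerN2 -/L.
by rewrite ler_piMl// ltW.
Qed.

Let large_fin i : finite_theta (large i) /\ rtheta (large i) <= 1 + q * L.
Proof.
have [f le] := finite_theta_cone (xc i) u0 u2; split => //.
by apply: le_trans le _; rewrite /u expRK opprK.
Qed.

Let small_fin i : finite_theta (small i) /\ rtheta (small i) = (1 - q) * L.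
Proof.
have [f E] := finite_theta_band (xc i) eps0 eps_u u2; split => //.
by rewrite E /u expRK lnV ?posrE// -/L; ring.
Qed.

Let CE i : C i = small i `|` large i. Proof. exact: cone_splitE. Qed.

Let smallI i j : small i `&` large j = set0. Proof. exact: band_cone_split. Qed.

Let C_fin i : finite_theta (C i).
Proof. by rewrite CE; apply: finite_thetaU; [exact: (small_fin i).1|exact: (large_fin i).1]. Qed.

Let mu_C : {ae P, forall w i, mu (C i) w = mu (large i) w + mu (small i) w}.
Proof.
apply: filter_forall => i.
apply: filterS (grm_cone_split mu_grm (xc i) eps0 eps_u u2) => w ->.
exact: addrC.
Qed.

Let pair (i j : 'I_N) : R :=
  (\int[P]_w (mu_gibbs mu C beta w i * mu_gibbs mu C beta w j))%R.

Let pair_ge0 i j : 0 <= pair i j.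
Proof. by apply: Rintegral_ge0 => w _; rewrite mulr_ge0 ?softmax_ge0. Qed.

Let sum_pair i : \sum_j pair i j = (\int[P]_w mu_gibbs mu C beta w i)%R.
Proof.
rewrite -Rint_sum => [|j _]; last exact: integrable_mu_gibbs2.
by apply: eq_Rintegral => w _; rewrite -mulr_sumr sum_softmax// mulr1.
Qed.

Let sum_pair2 : \sum_i \sum_j pair i j = 1.
Proof.
under eq_bigr do rewrite sum_pair.
rewrite -Rint_sum => [|i _]; last exact: integrable_mu_gibbs.
rewrite -[RHS](Rintegral_prob_cst P); apply: eq_Rintegral => w _.
exact: sum_softmax.
Qed.

(** The real number of which [mean_overlap_cdf] is the extended-real version;
    see [mean_overlap_cdfE]. *)
Definition overlap_cdf : R := \sum_i \sum_(j | (overlap i j <= q)%R) pair i j.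
Notation X := overlap_cdf.

Let overlap_cdfE : X = \sum_i \sum_j (overlap i j <= q)%R%:R * pair i j.
Proof.
apply: eq_bigr => i _; rewrite big_mkcond; apply: eq_bigr => j _.
by case: ifP; rewrite ?mul1r ?mul0r.
Qed.

Let cdf_ge0 : 0 <= X.
Proof. by apply: sumr_ge0 => i _; apply: sumr_ge0 => j _. Qed.

Let cdf_le1 : X <= 1.
Proof.
rewrite -sum_pair2 overlap_cdfE; apply: ler_sum => i _; apply: ler_sum => j _.
by rewrite ler_piMl// lern1 leq_b1.
Qed.

Let gibbs_overlapE (B : 'I_N -> set (R * R)) :
  gibbs_overlap mu C B beta =
  \sum_i \sum_j (rtheta (B i `&` C i) - rtheta (B i `&` C j)) * pair i j.
Proof.
apply: eq_bigr => i _; rewrite -sum_pair mulr_sumr -sumrB.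
by apply: eq_bigr => j _; rewrite mulrBl.
Qed.

Let rtheta_diff (A B : set (R * R)) : finite_theta A -> finite_theta B ->
  rtheta A - rtheta (A `&` B) = rtheta (A `\` B).
Proof.
move=> fA fB; rewrite -{1}(setUIDK A B) rtheta_setU.
- by rewrite addrC addKr.
- exact: finite_thetaI.
- exact: finite_thetaD.
- by rewrite setDE setIACA setICr setI0.
Qed.

Let finite_theta_measurable (A : set (R * R)) : finite_theta A -> measurable A.
Proof. by case. Qed.

(** Pairs at distance at least u contribute at most the whole measure of a large
    part; the other pairs at most 2 each, and their total weight is at
    most 1. *)
Let gibbs_overlap_large : gibbs_overlap mu C large beta <= (1 + q * L) * X + 2.
Proof.
have two : 2 = 2 * \sum_i \sum_j pair i j :> R by rewrite sum_pair2 mulr1.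
rewrite gibbs_overlapE overlap_cdfE [X in _ + X]two !mulr_sumr -big_split/=.
apply: ler_sum => i _; rewrite !mulr_sumr -big_split/=; apply: ler_sum => j _.
rewrite mulrA -mulrDl ler_wpM2r// (overlap_leP _ _ N1 q1) -/L -/u.
have [fl le] := large_fin i.
have thi : rtheta (large i `&` C i) <= rtheta (large i).
  apply: rtheta_le => //.
  exact: finite_theta_measurable (finite_thetaI fl (C_fin i)).
case: (leP u (circle_dist (site i) (site j))) => far; rewrite /= ?mulr1n ?mulr0n ?mulr1 ?mulr0 ?add0r.
  by have := rtheta_ge0 (large i `&` C j); lra.
apply: le_trans (rtheta_cone_diff_le (xc i) (xc j) u0 u2 (ltW far)).
rewrite -/(large i) -/(large j) -rtheta_diff//; last exact: (large_fin j).1.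
apply: lerB => //; apply: rtheta_le.
- exact: finite_thetaI.
- exact: finite_theta_measurable (finite_thetaI fl (large_fin j).1).
- by rewrite CE; move=> p [? ?]; split => //; right.
Qed.

(** Pairs at distance at least u contribute the whole measure of a small part,
    the other pairs something nonnegative. *)
Let gibbs_overlap_small : (1 - q) * L * X <= gibbs_overlap mu C small beta.
Proof.
rewrite gibbs_overlapE overlap_cdfE mulr_sumr.
apply: ler_sum => i _; rewrite mulr_sumr; apply: ler_sum => j _.
rewrite mulrA ler_wpM2r// (overlap_leP _ _ N1 q1) -/L -/u.
have [fs E] := small_fin i.
have thi : rtheta (small i `&` C i) = rtheta (small i).
  by rewrite CE setIidl//; left.
case: (leP u (circle_dist (site i) (site j))) => far; rewrite /= ?mulr1n ?mulr0n ?mulr1 ?mulr0 thi.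
  by rewrite /small /C band_cone_disjoint// rtheta0 subr0 -/(small i) E.
by rewrite rtheta_diff// rtheta_ge0.
Qed.

Let ln_partition_split (c1 c2 c : R) (B : 'I_N -> set (R * R)) :
  (forall w i, beta * (mu (large i) w + mu (small i) w) + c * mu (B i) w =
     beta * (c1 * mu (large i) w + c2 * mu (small i) w)) ->
  (\int[P]_w ln (partition_sum (fun i => beta * mu (C i) w + c * mu (B i) w)) =
   \int[P]_w ln (partition_sum (fun i => beta * (c1 * mu (large i) w + c2 * mu (small i) w))))%R.
Proof.
move=> H; apply: ae_eq_Rint.
- by apply: measurable_ln_partition_sum => i; apply: measurable_funD; exact: measurable_funM.
- apply: measurable_ln_partition_sum => i; apply: measurable_funM => //.
  by apply: measurable_funD; exact: measurable_funM.
apply: filterS mu_C => w Hw; congr (ln (partition_sum _)); apply/funext => i.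
by rewrite Hw H.
Qed.

Let upper (a b : R) :
  (\int[P]_w ln (partition_sum (fun i => beta * (a * mu (large i) w + b * mu (small i) w))) <=
  beta / Num.sqrt 2 * (L + a ^+ 2 * (1 + q * L) + b ^+ 2 * ((1 - q) * L)))%R.
Proof.
apply: expectation_ln_partition_le => //.
- by move=> i; exact: (large_fin i).1.
- by move=> i; exact: (small_fin i).1.
- by move=> i; rewrite setIC smallI.
- by move=> i; exact: (large_fin i).2.
- by move=> i; rewrite (small_fin i).2.
Qed.

(** Weakening the large parts by the factor 1 - delta: the tangent inequality
    below, the annealed bound above. *)
Lemma cdf_lower_bound (delta : R) : 0 <= delta ->
  free_energy (P := P) mu beta N - delta * beta ^+ 2 * ((1 + q * L) * X + 2) <=
  beta / Num.sqrt 2 * (L + (1 - delta) ^+ 2 * (1 + q * L) + (1 - q) * L).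
Proof.
move=> d0.
have tan := expectation_tangent mu_grm beta (- (delta * beta)) Npos C_fin (fun i => (large_fin i).1).
have up := upper (1 - delta) 1; rewrite expr1n mul1r in up.
apply: le_trans up; rewrite -(@ln_partition_split _ _ (- (delta * beta)) large); last first.
  by move=> w i; ring.
apply: le_trans tan; rewrite -/(free_energy mu beta N) lerD2l.
have -> : - (delta * beta) * beta * gibbs_overlap mu C large beta =
  - (delta * beta ^+ 2 * gibbs_overlap mu C large beta) by ring.
by rewrite lerN2 ler_wpM2l// mulr_ge0// sqr_ge0.
Qed.

(** The same with the small parts strengthened by the factor 1 + delta. *)
Lemma cdf_upper_bound (delta : R) : 0 <= delta ->
  free_energy (P := P) mu beta N + delta * beta ^+ 2 * ((1 - q) * L * X) <=
  beta / Num.sqrt 2 * (L + (1 + q * L) + (1 + delta) ^+ 2 * ((1 - q) * L)).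
Proof.
move=> d0.
have tan := expectation_tangent mu_grm beta (delta * beta) Npos C_fin (fun i => (small_fin i).1).
have up := upper 1 (1 + delta); rewrite expr1n mul1r in up.
apply: le_trans up; rewrite -(@ln_partition_split _ _ (delta * beta) small); last first.
  by move=> w i; ring.
apply: le_trans tan; rewrite -/(free_energy mu beta N) lerD2l.
have -> : delta * beta * beta * gibbs_overlap mu C small beta =
  delta * beta ^+ 2 * gibbs_overlap mu C small beta by ring.
by rewrite ler_wpM2l// mulr_ge0// sqr_ge0.
Qed.

Lemma cdf_bounds : 0 <= X <= 1. Proof. by rewrite cdf_ge0 cdf_le1. Qed.

Lemma overlap_cdf_eq1 : (forall i j : 'I_N, overlap i j <= q) -> X = 1.
Proof.
move=> H; rewrite -sum_pair2 overlap_cdfE.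
by apply: eq_bigr => i _; apply: eq_bigr => j _; rewrite H mul1r.
Qed.

Lemma mean_overlap_cdfE : mean_overlap_cdf mu beta N q = X%:E.
Proof.
pose g (i j : 'I_N) w := mu_gibbs mu C beta w i * mu_gibbs mu C beta w j.
have E w : gibbs2 mu beta w [set p : 'I_N * 'I_N | (overlap p.1 p.2 <= q)%R]%SET =
    \sum_i \sum_(j | (overlap i j <= q)%R) g i j w.
  rewrite /gibbs2 pair_big_dep/=; apply: eq_bigl => -[i j].
  by rewrite inE.
rewrite /mean_overlap_cdf unlock; under eq_integral do rewrite /= E.
have ig i j : P.-integrable setT (EFin \o (g i j)) by exact: integrable_mu_gibbs2.
have iall : P.-integrable setT
    (EFin \o (fun w => \sum_i \sum_(j | (overlap i j <= q)%R) g i j w)).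
  by apply: integ_sum => i _; apply: integ_sum => j _.
rewrite -[LHS]fineK ?integrable_fin_num//; congr EFin.
rewrite -/(Rintegral _ _ _) Rint_sum => [|i _]; last by apply: integ_sum => j _.
by apply: eq_bigr => i _; rewrite Rint_sum.
Qed.

End two_sided_bounds.

(** * The limit *)

Section limit.
Context {R : realType}.
Implicit Types (s beta q L delta X F : R).

(** [cdf_lower_bound] divided by delta L, with [F] at its asymptotic value. The
    terms without a factor L are compared with delta^2 L, which is at least 1,
    so that they too become O(delta). *)
Lemma cdf_ge_estimate s beta q L delta X F : 0 < s -> s ^+ 2 = 2 -> 0 < beta ->
  0 < q -> q < 1 -> 0 < delta -> delta <= 1 -> 1 <= delta ^+ 2 * L -> 0 <= X <= 1 ->
  beta * (s - delta ^+ 2) * L <= F ->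
  F - delta * beta ^+ 2 * ((1 + q * L) * X + 2) <=
    beta / s * (L + (1 - delta) ^+ 2 * (1 + q * L) + (1 - q) * L) ->
  s * q - delta * (3 + 3 * beta) <= beta * q * X.
Proof.
move=> s0 s2 b0 q0 q1 d0 d1 dL /andP[X0 X1] FL FU.
have L0 : 0 < L by rewrite -(pmulr_rgt0 L (exprn_gt0 2 d0)); lra.
have sle : s <= 2 by nra.
have H : (s - delta ^+ 2) * L <= delta * beta * ((1 + q * L) * X + 2) +
    s / 2 * (L + (1 - delta) ^+ 2 * (1 + q * L) + (1 - q) * L).
  rewrite -(ler_pM2l b0); move: FU.
  have -> : beta / s = beta * (s / 2) by rewrite -s2; field; rewrite gt_eqF.
  move=> FU.
  have -> : beta * (delta * beta * ((1 + q * L) * X + 2) + s / 2 *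
      (L + (1 - delta) ^+ 2 * (1 + q * L) + (1 - q) * L)) =
    delta * beta ^+ 2 * ((1 + q * L) * X + 2) + beta * (s / 2) *
      (L + (1 - delta) ^+ 2 * (1 + q * L) + (1 - q) * L) by ring.
  by rewrite mulrA; lra.
have Ha : s / 2 * (1 - delta) ^+ 2 <= delta ^+ 2 * L.
  apply: le_trans dL; have : (1 - delta) ^+ 2 <= 1 by nra.
  move=> h; rewrite -[leRHS]mulr1; apply: ler_pM; rewrite ?sqr_ge0//; lra.
have D0 : 0 <= delta ^+ 2 * L by lra.
have sq1 : s / 2 * q <= 1 by apply: mulr_ile1; lra.
have Hb : s / 2 * q * (delta ^+ 2 * L) <= delta ^+ 2 * L by exact: ler_piMl.
have Hc : delta * beta * (X + 2) <= 3 * beta * (delta ^+ 2 * L).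
  apply: (@le_trans _ _ (3 * beta * 1)); last by rewrite ler_wpM2l//; lra.
  have dX : delta * (X + 2) <= 3 by nra.
  by rewrite mulr1 mulrAC ler_wpM2r// ltW.
have dL0 : 0 < delta * L by rewrite mulr_gt0.
rewrite -(ler_pM2l dL0).
have e1 : s / 2 * (L + (1 - delta) ^+ 2 * (1 + q * L) + (1 - q) * L) =
  s * L + s / 2 * (1 - delta) ^+ 2 - s * delta * q * L + s / 2 * q * (delta ^+ 2 * L) by field.
have e2 : delta * beta * ((1 + q * L) * X + 2) =
  delta * beta * (X + 2) + delta * L * (beta * q * X) by ring.
have e3 : delta * L * (s * q - delta * (3 + 3 * beta)) =
  s * delta * q * L - 3 * (delta ^+ 2 * L) - 3 * beta * (delta ^+ 2 * L) by ring.
rewrite e3; rewrite e1 e2 in H; lra.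
Qed.

(** [cdf_upper_bound] divided by delta L, likewise. *)
Lemma cdf_le_estimate s beta q L delta X F : 0 < s -> s ^+ 2 = 2 -> 0 < beta ->
  0 < q -> q < 1 -> 0 < delta -> delta <= 1 -> 1 <= delta ^+ 2 * L ->
  beta * (s - delta ^+ 2) * L <= F ->
  F + delta * beta ^+ 2 * ((1 - q) * L * X) <=
    beta / s * (L + (1 + q * L) + (1 + delta) ^+ 2 * ((1 - q) * L)) ->
  beta * (1 - q) * X <= s * (1 - q) + 3 * delta.
Proof.
move=> s0 s2 b0 q0 q1 d0 d1 dL FL FU.
have L0 : 0 < L by rewrite -(pmulr_rgt0 L (exprn_gt0 2 d0)); lra.
have sle : s <= 2 by nra.
have H : (s - delta ^+ 2) * L + delta * beta * ((1 - q) * L * X) <=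
    s / 2 * (L + (1 + q * L) + (1 + delta) ^+ 2 * ((1 - q) * L)).
  rewrite -(ler_pM2l b0); move: FU.
  have -> : beta / s = beta * (s / 2) by rewrite -s2; field; rewrite gt_eqF.
  move=> FU; rewrite [leRHS]mulrA.
  have -> : beta * ((s - delta ^+ 2) * L + delta * beta * ((1 - q) * L * X)) =
     beta * (s - delta ^+ 2) * L + delta * beta ^+ 2 * ((1 - q) * L * X) by ring.
  by lra.
have D0 : 0 <= delta ^+ 2 * L by lra.
have sq1 : s / 2 * (1 - q) <= 1 by apply: mulr_ile1; lra.
have Hb : s / 2 * (1 - q) * (delta ^+ 2 * L) <= delta ^+ 2 * L by exact: ler_piMl.
have dL0 : 0 < delta * L by rewrite mulr_gt0.
rewrite -(ler_pM2l dL0).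
have e1 : s / 2 * (L + (1 + q * L) + (1 + delta) ^+ 2 * ((1 - q) * L)) =
  s * L + s / 2 + delta * L * (s * (1 - q)) + s / 2 * (1 - q) * (delta ^+ 2 * L) by field.
have e2 : delta * beta * ((1 - q) * L * X) = delta * L * (beta * (1 - q) * X) by ring.
have e3 : delta * L * (s * (1 - q) + 3 * delta) =
  delta * L * (s * (1 - q)) + 3 * (delta ^+ 2 * L) by ring.
rewrite e3; rewrite e1 e2 in H; lra.
Qed.

Context {d : measure_display} {T : measurableType d} {P : probability T R}.
Variable mu : set (R * R) -> {RV P >-> R}.
Hypothesis mu_grm : gaussian_random_measure mu.

(** First delta is fixed according to the required precision, then N is sent to
    infinity. *)
Lemma cvg_overlap_cdf (beta q : R) : Num.sqrt 2 < beta -> 0 < q -> q < 1 ->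
  (fun N => overlap_cdf mu beta q N) @ \oo --> Num.sqrt 2 / beta.
Proof.
move=> sb q0 q1; set s := Num.sqrt 2 in sb *.
have s0 : 0 < s by rewrite sqrtr_gt0.
have s2 : s ^+ 2 = 2 by rewrite sqr_sqrtr.
have s32 : s <= 3 / 2 by nra.
have b0 : 0 < beta by exact: lt_trans sb.
have q1' : 0 < 1 - q by lra.
apply/cvgrPdist_le => e e0.
(* The sum of the two constants in front of delta in [cdf_ge_estimate] and
   [cdf_le_estimate]; k is such that the free energy is known up to
   beta delta^2 L. *)
pose K0 := (3 + 3 * beta) / (beta * q) + 3 / (beta * (1 - q)).
have K1 : 0 < (3 + 3 * beta) / (beta * q).
  by rewrite divr_gt0 ?mulr_gt0//; lra.
have K2 : 0 < 3 / (beta * (1 - q)) by rewrite divr_gt0 ?mulr_gt0.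
have K00 : 0 < K0 by rewrite addr_gt0.
pose delta := Num.min 1 (e / K0).
have d0 : 0 < delta by rewrite lt_min ltr01 divr_gt0.
have d1 : delta <= 1 by rewrite ge_min lexx.
have dK : delta * K0 <= e by rewrite -ler_pdivlMr// ge_min lexx orbT.
have dd0 : 0 < delta ^+ 2 by rewrite exprn_gt0.
have dd1 : delta ^+ 2 <= 1 by rewrite expr_le1// ltW.
pose k := delta ^+ 2 / 6.
have k0 : 0 < k by rewrite divr_gt0.
have k2 : k <= 2^-1 by rewrite /k; lra.
have FE := free_energy_ge mu_grm (ltW b0) k0 k2.
near=> N.
have [N1 LA] : (1 < N)%N /\ (delta ^+ 2)^-1 <= ln N%:R :> R.
  by near: N; exact: near_ln_ge.
have [_ LB] : (1 < N)%N /\ q^-1 <= ln N%:R :> R.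
  by near: N; exact: near_ln_ge.
have FEN : beta * (s * (1 - k) ^+ 3 - k) * ln N%:R <= free_energy (P := P) mu beta N.
  by near: N; exact: FE.
set L := ln N%:R in LA LB FEN *.
have L0 : 0 < L by rewrite ln_gt0// ltr1n.
have dL : 1 <= delta ^+ 2 * L by rewrite -ler_pdivrMl// mulr1.
have qL : 1 <= q * L by rewrite -ler_pdivrMl// mulr1.
have u2 : expR (- (q * L)) <= 2^-1.
  rewrite expRN lef_pV2 ?posrE ?expR_gt0//.
  by apply: le_trans (expR_ge1Dx _); lra.
have FL : beta * (s - delta ^+ 2) * L <= free_energy (P := P) mu beta N.
  apply: le_trans FEN; rewrite ler_pM2r// ler_pM2l//.
  have kE : delta ^+ 2 = 6 * k by rewrite /k; lra.
  have : 1 - 3 * k <= (1 - k) ^+ 3.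
    have -> : (1 - k) ^+ 3 = 1 - 3 * k + k ^+ 2 * (3 - k) by ring.
    by rewrite lerDl mulr_ge0 ?sqr_ge0//; lra.
  by rewrite kE; nra.
have X01 := cdf_bounds mu beta q N1.
have lo := cdf_lower_bound mu_grm (ltW sb) q1 N1 u2 (ltW d0).
have hi := cdf_upper_bound mu_grm (ltW sb) q1 N1 u2 (ltW d0).
have {}lo := cdf_ge_estimate s0 s2 b0 q0 q1 d0 d1 dL X01 FL lo.
have {}hi := cdf_le_estimate s0 s2 b0 q0 q1 d0 d1 dL FL hi.
set X := overlap_cdf _ _ _ _ in lo hi *.
rewrite distrC ler_distl; apply/andP; split.
  apply: (@le_trans _ _ (s / beta - delta * ((3 + 3 * beta) / (beta * q)))).
    rewrite lerB//; apply: le_trans dK; rewrite ler_wpM2l ?(ltW d0)//.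
    by rewrite lerDl ltW.
  have bq : 0 < beta * q by rewrite mulr_gt0.
  rewrite -(ler_pM2l bq).
  have -> : beta * q * (s / beta - delta * ((3 + 3 * beta) / (beta * q))) =
    s * q - delta * (3 + 3 * beta) by field; rewrite !gt_eqF.
  exact: lo.
apply: (@le_trans _ _ (s / beta + delta * (3 / (beta * (1 - q))))); last first.
  rewrite lerD2l; apply: le_trans dK; rewrite ler_wpM2l ?(ltW d0)//.
  by rewrite lerDr ltW.
have bq : 0 < beta * (1 - q) by rewrite mulr_gt0.
rewrite -(ler_pM2l bq).
have -> : beta * (1 - q) * (s / beta + delta * (3 / (beta * (1 - q)))) =
  s * (1 - q) + 3 * delta by field; rewrite !gt_eqF.
exact: hi.
Unshelve. all: by end_near. Qed.

End limit.

Theorem theorem1p4 (R : realType) (d : measure_display) (T : measurableType d)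
    (P : probability T R) (mu : set (R * R) -> {RV P >-> R})
    (mu_grm : gaussian_random_measure mu)
    (beta : R) (beta_gt : beta_c < beta) (q : R) (q_itv : 0 < q <= 1) :
  (fun N : nat => mean_overlap_cdf mu beta N q) @ \oo -->
    (if q < 1 then beta_c / beta else 1)%:E.
Proof.
have /andP[q0 q1] := q_itv.
rewrite (_ : (fun N => _) = (fun N => (overlap_cdf mu beta q N)%:E)); last first.
  by apply/funext => N; exact: mean_overlap_cdfE.
have [q1'|q1'] := ltP q 1.
  by apply: cvg_EFin; [exact: nearW|exact: cvg_overlap_cdf].
apply: cvg_near_cst; near=> N; congr EFin.
have N1 : (1 < N)%N by near: N; exact: nbhs_infty_gt.
apply: overlap_cdf_eq1 => // i j.
exact: le_trans (overlap_le1 i j N1) q1'.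
Unshelve. all: by end_near. Qed.
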